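(* Let $\Lambda$ be an Artin algebra. The following conditions are equivalent: (i) $\Lambda$ is a $1$-Gorenstein G-semisimple algebra. (ii) $\mathrm{rad}\,\Lambda\oplus\Lambda$ generates $\mathrm{Gprj}\text{-}\Lambda$, i.e. $\mathrm{Gprj}\text{-}\Lambda=\mathrm{add}(\mathrm{rad}\,\Lambda\oplus\Lambda)$.
   Context: Modules are finitely generated right modules. A module is Gorenstein projective if it is a syzygy of an acyclic complex $\mathbf{P}^\bullet$ of projective modules such that $\mathrm{Hom}_\Lambda(\mathbf{P}^\bullet,Q)$ is acyclic for every projective module $Q$. $\mathrm{Gprj}\text{-}\Lambda$ is the category of Gorenstein projective modules and $\underline{\mathrm{Gprj}}\text{-}\Lambda$ its stable category modulo projectives. Standing assumption: $\mathrm{Gprj}\text{-}\Lambda$ is contravariantly finite in $\mathrm{mod}\text{-}\Lambda$. For an additive category $\mathcal{X}$, $\mathrm{mod}\text{-}\mathcal{X}$ denotes the category of finitely presented contravariant additive functors from $\mathcal{X}$ to abelian groups. $\Lambda$ is G-semisimple if $\mathrm{mod}\text{-}(\underline{\mathrm{Gprj}}\text{-}\Lambda)$ is a semisimple abelian category, i.e. all its objects are projective. $\Lambda$ is $1$-Gorenstein if the injective dimension of $\Lambda$ as a left or right module is at most one (one side suffices). $\mathrm{add}(X)$ is the full subcategory of direct summands of finite direct sums of copies of $X$. *)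

(* Defs.v *)
From HB Require Import structures.
From mathcomp Require Import all_boot all_order all_algebra.
From mathcomp Require Import boolp prodnormedzmodule.

Set Implicit Arguments.
Unset Strict Implicit.
Unset Printing Implicit Defensive.

Import GRing.Theory.

Local Open Scope ring_scope.
Local Open Scope quotient_scope.

Section LinearZmod.
Variables (R : pzRingType) (U V : lmodType R).
Implicit Types f g h : {linear U -> V}.

Lemma linear_eqP f g : f =1 g -> f = g.
Proof.
case: f g => [f [[fD] [fZ]]] [g [[gD] [gZ]]] /= /funext fg.
by subst g; rewrite (Prop_irrelevance gD fD) (Prop_irrelevance gZ fZ).
Qed.

Definition linear_zero : {linear U -> V} := \0.
Definition linear_opp f : {linear U -> V} := \- f.
Definition linear_add f g : {linear U -> V} := f \+ g.

Lemma linear_addA : associative linear_add.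
Proof. by move=> f g h; apply: linear_eqP => x /=; rewrite addrA. Qed.

Lemma linear_addC : commutative linear_add.
Proof. by move=> f g; apply: linear_eqP => x /=; rewrite addrC. Qed.

Lemma linear_add0 : left_id linear_zero linear_add.
Proof. by move=> f; apply: linear_eqP => x /=; rewrite add0r. Qed.

Lemma linear_addN : left_inverse linear_zero linear_opp linear_add.
Proof. by move=> f; apply: linear_eqP => x /=; rewrite addNr. Qed.

HB.instance Definition _ := GRing.isZmodule.Build {linear U -> V}
  linear_addA linear_addC linear_add0 linear_addN.

End LinearZmod.

Definition lcomp (R : pzRingType) (U V W : lmodType R)
  (g : {linear V -> W}) (f : {linear U -> V}) : {linear U -> W} := g \o f.

Definition surjective (A B : Type) (f : A -> B) := forall b, exists a, f a = b.

Definition exact_at (A B C : zmodType) (f : A -> B) (g : B -> C) :=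
  forall b, g b = 0 <-> exists a, f a = b.

Definition fin_gen (R : pzRingType) (M : lmodType R) :=
  exists (n : nat) (v : 'I_n -> M),
    forall m, exists c : 'I_n -> R, m = \sum_i c i *: v i.

Definition artinian_module (R : pzRingType) (M : lmodType R) :=
  forall I : nat -> submodClosed M,
    (forall n, {subset I n.+1 <= I n}) ->
    exists N, forall n, (N <= n)%N -> I n =i I N.

Definition artin_algebra (k : comNzRingType) (L : algType k) :=
  artinian_module (k^o : lmodType k) /\ fin_gen (L : lmodType k).

(* A right module over [L] is an [lmodType] over the converse ring [L^c];
   everything below is written for [lmodType R] with [R] arbitrary. *)

Record fgModType (R : pzRingType) := FgMod {
  fg_sort :> lmodType R;
  fg_fin_gen : fin_gen fg_sort }.

Section RegularModule.
Variable R : pzRingType.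

Fact regular_fin_gen : fin_gen (R^o : lmodType R).
Proof.
exists 1%N, (fun=> 1) => m; exists (fun=> m).
by rewrite big_ord1 [RHS]mulr1.
Qed.

Definition regular : fgModType R := FgMod regular_fin_gen.

End RegularModule.

Section Modules.
Variable R : pzRingType.
Implicit Types M N P Q : fgModType R.

Definition projective P :=
  forall M N (g : {linear M -> N}) (f : {linear P -> N}),
    surjective g -> exists h : {linear P -> M}, lcomp g h = f.

Definition injective_module Q :=
  forall M N (g : {linear M -> N}) (f : {linear M -> Q}),
    injective g -> exists h : {linear N -> Q}, lcomp h g = f.

Definition injdim_le M (n : nat) :=
  exists (I : nat -> fgModType R) (d : forall j, {linear I j -> I j.+1})
         (e : {linear M -> I 0}),
    [/\ forall j, injective_module (I j),
        injective e,
        exact_at e (d 0),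
        forall j, exact_at (d j) (d j.+1)
      & forall j, (n < j)%N -> forall x : I j, x = 0].

Record precomplex := PreComplex {
  cx_obj :> int -> fgModType R;
  cx_d : forall i, {linear cx_obj i -> cx_obj (i + 1)} }.

Definition acyclic (C : precomplex) :=
  forall i, exact_at (cx_d C i) (cx_d C (i + 1)).

Definition hom_acyclic (C : precomplex) Q :=
  forall i, exact_at
    (fun u : {linear C (i + 1 + 1) -> Q} => lcomp u (cx_d C (i + 1)))
    (fun u : {linear C (i + 1) -> Q} => lcomp u (cx_d C i)).

Definition syzygy_of (C : precomplex) M :=
  exists (i : int) (f : {linear M -> C i}),
    injective f /\ exact_at f (cx_d C i).

Definition gorenstein_projective M :=
  exists C : precomplex,
    [/\ forall i, projective (C i), acyclic C,
        forall Q, projective Q -> hom_acyclic C Q & syzygy_of C M].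

Record gprjType := GprjMod {
  gprj_mod :> fgModType R;
  gprj_gp : gorenstein_projective gprj_mod }.

Definition gprj_contravariantly_finite :=
  forall M, exists (G : gprjType) (f : {linear G -> M}),
    forall (G' : gprjType) (f' : {linear G' -> M}),
      exists h : {linear G' -> G}, lcomp f h = f'.

(* [X] need not be finitely generated here, so [rad_ring L], defined below,
   qualifies without a proof that it is. *)
Definition in_add (X : lmodType R) M :=
  exists (n : nat) (N : lmodType R)
         (f : {linear (M * N)%type -> {ffun 'I_n -> X}}), bijective f.

Definition factors_projective M N (f : {linear M -> N}) :=
  exists P, projective P /\
    exists (g : {linear P -> N}) (h : {linear M -> P}), f = lcomp g h.

Definition factors_projective_pred M N : {pred {linear M -> N}} :=
  [pred f | `[< factors_projective f >]].

End Modules.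

Section PairInjections.
Variables (R : pzRingType) (U V : lmodType R).

Definition pair_inl (x : U) : (U * V)%type := (x, 0).
Definition pair_inr (y : V) : (U * V)%type := (0, y).

Fact pair_inl_linear : linear pair_inl.
Proof.
by move=> a x y; apply: injective_projections; rewrite /= ?scaler0 ?addr0.
Qed.

Fact pair_inr_linear : linear pair_inr.
Proof.
by move=> a x y; apply: injective_projections; rewrite /= ?scaler0 ?addr0.
Qed.

HB.instance Definition _ :=
  GRing.isLinear.Build R U (U * V)%type *:%R pair_inl pair_inl_linear.
HB.instance Definition _ :=
  GRing.isLinear.Build R V (U * V)%type *:%R pair_inr pair_inr_linear.

End PairInjections.

Section StableCategory.
Variable R : pzRingType.
Implicit Types M N P Q : fgModType R.

Fact zero_fin_gen : fin_gen ({ffun 'I_0 -> R^o} : lmodType R).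
Proof.
exists 0%N, (fun=> 0) => m; exists (fun=> 0).
by rewrite big_ord0; apply/ffunP=> -[].
Qed.

Fact pair_fin_gen M N : fin_gen ((M * N)%type : lmodType R).
Proof.
have [m [v vP]] := fg_fin_gen M; have [n [w wP]] := fg_fin_gen N.
have splitl i : split (lshift n i) = inl i by exact: (unsplitK (inl i)).
have splitr i : split (rshift m i) = inr i by exact: (unsplitK (inr i)).
pose u (i : 'I_(m + n)) : (M * N)%type :=
  match split i with inl j => (v j, 0) | inr j => (0, w j) end.
exists (m + n)%N, u => -[x y].
have [a ->] := vP x; have [b ->] := wP y.
exists (fun i => match split i with inl j => a j | inr j => b j end).
rewrite big_split_ord /= /u; apply: injective_projections.
- rewrite raddfD !(raddf_sum (fst : {additive (M * N)%type -> M})) /=.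
  rewrite [X in _ = _ + X]big1 ?addr0 => [|i _]; last by rewrite splitr scaler0.
  by apply: eq_bigr => i _; rewrite splitl.
- rewrite raddfD !(raddf_sum (snd : {additive (M * N)%type -> N})) /=.
  rewrite [X in _ = X + _]big1 ?add0r => [|i _]; last by rewrite splitl scaler0.
  by apply: eq_bigr => i _; rewrite splitr.
Qed.

Definition zero_fg : fgModType R := FgMod zero_fin_gen.
Definition pair_fg M N : fgModType R := FgMod (pair_fin_gen M N).

Lemma projective_zero : projective zero_fg.
Proof.
move=> M N g f _; exists 0; apply: linear_eqP => x /=.
have -> : x = 0 by apply/ffunP => -[].
by rewrite [RHS]raddf0 [LHS]raddf0.
Qed.

Lemma projective_pair P Q :
  projective P -> projective Q -> projective (pair_fg P Q).
Proof.
move=> pP pQ M N g f g_surj.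
have [h hP] := pP M N g (lcomp f (@pair_inl R P Q)) g_surj.
have [h' hQ] := pQ M N g (lcomp f (@pair_inr R P Q)) g_surj.
exists (lcomp h (fst : {linear (P * Q)%type -> P}) +
        lcomp h' (snd : {linear (P * Q)%type -> Q})).
apply: linear_eqP => -[x y] /=.
have /= hPx := congr1 (fun u : {linear P -> N} => u x) hP.
have /= hQy := congr1 (fun u : {linear Q -> N} => u y) hQ.
transitivity (f (@pair_inl R P Q x) + f (@pair_inr R P Q y)).
  by rewrite [LHS]raddfD; congr (_ + _).
rewrite -raddfD; congr (f _).
by apply: injective_projections; rewrite /= ?addr0 ?add0r.
Qed.

Section Factor.
Variables M N : fgModType R.

Fact factors_projective_zmod_closed :
  zmod_closed (@factors_projective_pred R M N).
Proof.
split=> [|f f'].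
  apply/asboolP; exists zero_fg; split; first exact: projective_zero.
  by exists 0, 0; apply: linear_eqP.
move=> /asboolP[P [pP [g [h ->]]]] /asboolP[P' [pP' [g' [h' ->]]]].
apply/asboolP; exists (pair_fg P P'); split; first exact: projective_pair.
exists (lcomp g (fst : {linear (P * P')%type -> P}) -
        lcomp g' (snd : {linear (P * P')%type -> P'})).
exists (lcomp (@pair_inl R P P') h + lcomp (@pair_inr R P P') h').
apply: linear_eqP => x /=.
by congr (g _ - g' _); rewrite ?addr0 ?add0r.
Qed.

HB.instance Definition _ :=
  GRing.isZmodClosed.Build {linear M -> N} (@factors_projective_pred R M N)
    factors_projective_zmod_closed.

End Factor.

(* Hom(M, N) modulo the maps that factor through a projective module. *)
Definition stable_hom M N : zmodType :=
  Quotient.quot (@factors_projective_pred R M N : zmodClosed {linear M -> N}).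

Definition stable_pi M N (f : {linear M -> N}) : stable_hom M N := \pi f.

Definition stable_id M : stable_hom M M := stable_pi idfun.

Definition stable_comp M N P (g : stable_hom N P) (f : stable_hom M N) :
  stable_hom M P := stable_pi (lcomp (repr g) (repr f)).

Lemma stable_piE M N (f g : {linear M -> N}) :
  stable_pi f = stable_pi g <-> factors_projective (f - g).
Proof.
rewrite -(asboolE (factors_projective _)).
split=> [/eqP|h]; [|apply/eqP]; rewrite /stable_pi -Quotient.idealrBE //.
Qed.

Lemma stable_reprK M N (f : stable_hom M N) : stable_pi (repr f) = f.
Proof. exact: reprK. Qed.

Lemma stable_piD M N (f g : {linear M -> N}) :
  stable_pi (f + g) = stable_pi f + stable_pi g.
Proof. by rewrite /stable_pi !piE. Qed.

Lemma stable_pi_comp M N P (g : {linear N -> P}) (f : {linear M -> N}) :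
  stable_comp (stable_pi g) (stable_pi f) = stable_pi (lcomp g f).
Proof.
set g' := repr (stable_pi g); set f' := repr (stable_pi f).
have /stable_piE[Q [pQ [a [b gE]]]] : stable_pi g' = stable_pi g.
  exact: stable_reprK.
have /stable_piE[Q' [pQ' [c [d fE]]]] : stable_pi f' = stable_pi f.
  exact: stable_reprK.
transitivity (stable_pi (lcomp g' f)).
  apply/stable_piE; exists Q'; split=> //; exists (lcomp g' c), d.
  apply: linear_eqP => x /=.
  have /= <- := congr1 (fun u : {linear M -> N} => u x) fE.
  by rewrite [RHS]raddfB.
apply/stable_piE; exists Q; split=> //; exists a, (lcomp b f).
apply: linear_eqP => x.
exact: (congr1 (fun u : {linear N -> P} => u (f x)) gE).
Qed.

Lemma stable_compA M N P Q (h : stable_hom P Q) (g : stable_hom N P)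
    (f : stable_hom M N) :
  stable_comp h (stable_comp g f) = stable_comp (stable_comp h g) f.
Proof.
rewrite -(stable_reprK h) -(stable_reprK g) -(stable_reprK f) !stable_pi_comp.
by congr stable_pi; apply: linear_eqP.
Qed.

Lemma stable_comp1l M N (f : stable_hom M N) : stable_comp (stable_id N) f = f.
Proof.
rewrite -(stable_reprK f) stable_pi_comp.
by congr stable_pi; apply: linear_eqP.
Qed.

Lemma stable_comp1r M N (f : stable_hom M N) : stable_comp f (stable_id M) = f.
Proof.
rewrite -(stable_reprK f) stable_pi_comp.
by congr stable_pi; apply: linear_eqP.
Qed.

Lemma stable_compDl M N P (g g' : stable_hom N P) (f : stable_hom M N) :
  stable_comp (g + g') f = stable_comp g f + stable_comp g' f.
Proof.
rewrite -(stable_reprK g) -(stable_reprK g') -(stable_reprK f).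
rewrite -stable_piD !stable_pi_comp -stable_piD.
by congr stable_pi; apply: linear_eqP.
Qed.

Lemma stable_compDr M N P (g : stable_hom N P) (f f' : stable_hom M N) :
  stable_comp g (f + f') = stable_comp g f + stable_comp g f'.
Proof.
rewrite -(stable_reprK g) -(stable_reprK f) -(stable_reprK f').
rewrite -stable_piD !stable_pi_comp -stable_piD.
by congr stable_pi; apply: linear_eqP => x /=; rewrite [LHS]raddfD.
Qed.

End StableCategory.

Record preAddCat := PreAddCat {
  cat_ob :> Type;
  cat_hom : cat_ob -> cat_ob -> zmodType;
  cat_id : forall X, cat_hom X X;
  cat_comp : forall X Y Z, cat_hom Y Z -> cat_hom X Y -> cat_hom X Z;
  cat_compA : forall X Y Z W
    (h : cat_hom Z W) (g : cat_hom Y Z) (f : cat_hom X Y),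
    cat_comp h (cat_comp g f) = cat_comp (cat_comp h g) f;
  cat_comp1l : forall X Y (f : cat_hom X Y), cat_comp (cat_id Y) f = f;
  cat_comp1r : forall X Y (f : cat_hom X Y), cat_comp f (cat_id X) = f;
  cat_compDl : forall X Y Z (g g' : cat_hom Y Z) (f : cat_hom X Y),
    cat_comp (g + g') f = cat_comp g f + cat_comp g' f;
  cat_compDr : forall X Y Z (g : cat_hom Y Z) (f f' : cat_hom X Y),
    cat_comp g (f + f') = cat_comp g f + cat_comp g f' }.

Arguments cat_id {p} X.
Arguments cat_comp {p X Y Z} g f.

Section FunctorCategory.
Variable C : preAddCat.

Record contraFunctor := ContraFunctor {
  fun_ob :> C -> zmodType;
  fun_map : forall X Y, cat_hom X Y -> {additive fun_ob Y -> fun_ob X};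
  fun_map1 : forall X x, fun_map (cat_id X) x = x;
  fun_mapM : forall X Y Z (g : cat_hom Y Z) (f : cat_hom X Y) x,
    fun_map (cat_comp g f) x = fun_map f (fun_map g x);
  fun_mapD : forall X Y (f g : cat_hom X Y) x,
    fun_map (f + g) x = fun_map f x + fun_map g x }.

Record natTrans (F G : contraFunctor) := NatTrans {
  nat_app :> forall X, {additive F X -> G X};
  nat_natural : forall X Y (f : cat_hom X Y) x,
    nat_app X (fun_map F f x) = fun_map G f (nat_app Y x) }.

Definition nat_eq F G (a b : natTrans F G) := forall X, a X =1 b X.

Definition nat_comp_app F G H (b : natTrans G H) (a : natTrans F G) X :
  {additive F X -> H X} := b X \o a X.

Fact nat_comp_natural F G H (b : natTrans G H) (a : natTrans F G)
    X Y (f : cat_hom X Y) x :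
  nat_comp_app b a X (fun_map F f x) = fun_map H f (nat_comp_app b a Y x).
Proof. by rewrite /= !nat_natural. Qed.

Definition nat_comp F G H (b : natTrans G H) (a : natTrans F G) :
  natTrans F H := NatTrans (@nat_comp_natural F G H b a).

Section Representable.
Variable A : C.

Definition precomp X Y (f : cat_hom X Y) (u : cat_hom Y A) : cat_hom X A :=
  cat_comp u f.

Fact precomp_zmod_morphism X Y (f : cat_hom X Y) : zmod_morphism (precomp f).
Proof.
move=> u v; apply: (addIr (precomp f v)).
by rewrite /precomp -cat_compDl !subrK.
Qed.

HB.instance Definition _ X Y (f : cat_hom X Y) :=
  GRing.isZmodMorphism.Build (cat_hom Y A) (cat_hom X A) (precomp f)
    (precomp_zmod_morphism f).

Fact precomp1 X u : precomp (cat_id X) u = u.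
Proof. exact: cat_comp1r. Qed.

Fact precompM X Y Z (g : cat_hom Y Z) (f : cat_hom X Y) u :
  precomp (cat_comp g f) u = precomp f (precomp g u).
Proof. exact: cat_compA. Qed.

Fact precompD X Y (f g : cat_hom X Y) u :
  precomp (f + g) u = precomp f u + precomp g u.
Proof. exact: cat_compDr. Qed.

Definition representable : contraFunctor :=
  @ContraFunctor (fun X => cat_hom X A) (fun X Y f => precomp f)
    precomp1 precompM precompD.

End Representable.

Definition fin_presented (F : contraFunctor) :=
  exists (A B : C) (a : natTrans (representable A) (representable B))
         (p : natTrans (representable B) F),
    forall X, exact_at (a X) (p X) /\ surjective (p X).

(* Objects of mod-C; its morphisms are the natural transformations. *)
Record fpFunctor := FpFunctor {
  fp_fun :> contraFunctor;
  fp_fin_presented : fin_presented fp_fun }.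

Definition fp_epi (F G : fpFunctor) (e : natTrans F G) :=
  forall (H : fpFunctor) (u v : natTrans G H),
    nat_eq (nat_comp u e) (nat_comp v e) -> nat_eq u v.

Definition fp_projective (P : fpFunctor) :=
  forall (F G : fpFunctor) (e : natTrans F G) (f : natTrans P G),
    fp_epi e -> exists g : natTrans P F, nat_eq (nat_comp e g) f.

(* mod-C is semisimple abelian: all of its objects are projective. *)
Definition fp_semisimple := forall F : fpFunctor, fp_projective F.

End FunctorCategory.

Definition stable_gprj (R : pzRingType) : preAddCat :=
  @PreAddCat (gprjType R) (fun M N => stable_hom M N)
    (fun M => stable_id M) (fun M N P => @stable_comp R M N P)
    (fun M N P Q => @stable_compA R M N P Q)
    (fun M N => @stable_comp1l R M N) (fun M N => @stable_comp1r R M N)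
    (fun M N P => @stable_compDl R M N P) (fun M N P => @stable_compDr R M N P).

Section Radical.
Variables (R : pzRingType) (M : lmodType R).

Definition maximal_submod (A : submodClosed M) :=
  (exists x, x \notin A) /\
  forall B : submodClosed M, {subset A <= B} ->
    B =i A \/ forall x, x \in B.

Definition rad_pred : {pred M} :=
  [pred x | `[< forall A : submodClosed M, maximal_submod A -> x \in A >]].

Fact rad_submod_closed : submod_closed rad_pred.
Proof.
split=> [|a x y]; first by apply/asboolP => A _; exact: rpred0.
move=> /asboolP xP /asboolP yP; apply/asboolP => A mA.
by rewrite rpredD ?rpredZ ?xP ?yP.
Qed.

HB.instance Definition _ :=
  GRing.isSubmodClosed.Build R M rad_pred rad_submod_closed.

Record rad_type := RadElt { rad_val :> M; _ : rad_val \in rad_pred }.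

HB.instance Definition _ := [isSub for rad_val].
HB.instance Definition _ := [Choice of rad_type by <:].
HB.instance Definition _ := [SubChoice_isSubLmodule of rad_type by <:].

End Radical.

(* The maximal submodules of [(L^c)^o] are the maximal right ideals of [L]. *)
Definition rad_ring (L : pzRingType) : lmodType L^c :=
  rad_type ((L^c)^o : lmodType L^c).

(* For an Artin algebra either side implies the other. *)
Definition one_gorenstein (L : pzRingType) :=
  injdim_le (regular L^c) 1 \/ injdim_le (regular L) 1.

Definition G_semisimple (L : pzRingType) := fp_semisimple (stable_gprj L^c).

(* Main.v *)
From HB Require Import structures.
From mathcomp Require Import all_boot all_order all_algebra.
From mathcomp Require Import boolp prodnormedzmodule zify.
Require Import Defs.

Set Implicit Arguments.
Unset Strict Implicit.
Unset Printing Implicit Defensive.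

Import GRing.Theory Num.Theory.

Local Open Scope ring_scope.
Local Open Scope quotient_scope.

(** Write R for the opposite ring of L, so that right L-modules are left
R-modules, and call a module torsionless if it embeds in a free module of
finite rank.

The algebra is 1-Gorenstein exactly when torsionless modules and Gorenstein
projective modules coincide. One half is dimension shifting: injective
dimension at most one over R says that torsionless modules have no extensions
by projectives ([closed_are_ext]). The other half is that modules without
extensions by projectives are torsionless ([ext_are_closed]); given both,
syzygies and cosyzygies of torsionless modules stay torsionless and splice
into totally acyclic complexes ([tors_gprj]). Presenting modules by matrices
and transposing shows that [ext_are_closed] over a ring is [closed_are_ext]
over the opposite ring ([closed_ext_op]), so it remains to see that
[closed_are_ext] implies [ext_are_closed] ([closed_are_ext_ext_are_closed]).
This is the counting argument behind Bongartz's lemma: for torsionless X the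
length of the group of maps from X to an indecomposable projective depends
linearly on the composition factors of X, through a square matrix. A module
without maps and extensions to projectives yields a vector killed by this
matrix, while a projective is determined, up to summands of powers, by the
lengths of the groups of maps into it ([retract_of_homlen]), so the matrix is
invertible. Lengths are taken over the centre, over which the algebra has
finite length ([artin_fl]).

Both conditions of the theorem are then compared with a third one: for every
Gorenstein projective N the inclusion of the radical of N factors through a
projective ([rad_stably_zero]).

Let N have a free cover P with kernel M, and let E be the preimage of the
radical of N in P. The inclusion of the radical factors through a projective
exactly when M splits off E. Since E contains the radical of P, it has a
complement modulo that radical, and therefore it is a summand of the sum of P
and its radical ([retr_rad]). This gives the summands required by the second
condition ([gprj_in_add]); conversely a splitting of M off a power of the sum
of the radical and the ring extends to E ([in_add_rad_zero]). That the second
condition makes R 1-Gorenstein is Baer's criterion, since maximal left ideals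
are such summands ([in_add_injdim]).

A category has semisimple finitely presented functors exactly when all its
maps f are regular, i.e. f g f = f for some g ([semisimple_regular],
[regular_semisimple]). If the inclusion j of the radical of N is stably
regular, Nakayama's lemma makes 1 - j g invertible and j is stably zero
([regular_rad_zero]). Conversely, if all these inclusions are stably zero,
regularity of the maps into N is proved by induction on the length of N
([rad_zero_regular]): up to semisimple quotients a map out of N is cut out of
a direct decomposition by idempotents, and its regularity follows from that of
a complementary map into the radical of N; rotating triangles passes from maps
out of N to maps into N. *)

(** * Length of groups with operators *)

Lemma pred_ext (G : Type) (U V : G -> Prop) : (forall x, U x <-> V x) -> U = V.
Proof. by move=> UV; apply/funext => x; apply/propext. Qed.

(** Modules and groups of homomorphisms are measured with the same notion of
length, so it is set up for abelian groups with a set of operators: the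
operators only decide which subgroups count. *)
Record opGroup (T : Type) := OpGroup {
  og_sort :> zmodType;
  og_act : T -> og_sort -> og_sort;
  og_act0 : forall t, og_act t 0 = 0 }.

Section Length.
Variable T : Type.
Implicit Types G H K : opGroup T.

Definition opsub G (U : G -> Prop) :=
  [/\ U 0, forall x y, U x -> U y -> U (x - y)
    & forall t x, U x -> U (og_act t x)].

Fixpoint chain G (n : nat) (U : G -> Prop) : Prop :=
  if n is n'.+1 then
    exists V : G -> Prop,
      [/\ opsub V, forall x, V x -> U x, exists2 x, U x & ~ V x & chain n' V]
  else True.

Definition finlen G (U : G -> Prop) := exists n, ~ chain n U.

Lemma chain_mono G n (U V : G -> Prop) :
  (forall x, U x -> V x) -> chain n U -> chain n V.
Proof.
case: n => //= n UV [W [sW WU [x Ux Wx] cW]]; exists W; split=> //.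
  by move=> y /WU /UV.
by exists x => //; apply: UV.
Qed.

Lemma chain_leq G m n (U : G -> Prop) : (m <= n)%N -> chain n U -> chain m U.
Proof.
move=> /subnK <-; elim: (n - m)%N => // k IH /=.
by move=> [V [_ VU _ cV]]; apply: IH; apply: chain_mono cV.
Qed.

Lemma finlen_mono G (U V : G -> Prop) :
  (forall x, U x -> V x) -> finlen V -> finlen U.
Proof. by move=> UV [n nV]; exists n => /(chain_mono UV). Qed.

Fact finlen_ex G (U : G -> Prop) : finlen U -> exists n, `[< ~ chain n U >].
Proof. by move=> [n nU]; exists n; apply/asboolP. Qed.

Definition len G (U : G -> Prop) : nat :=
  if pselect (finlen U) is left h then (ex_minn (finlen_ex h)).-1 else 0%N.

Lemma lenP G (U : G -> Prop) :
  finlen U -> chain (len U) U /\ ~ chain (len U).+1 U.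
Proof.
move=> fU; rewrite /len; case: pselect => // h.
case: ex_minnP => -[/asboolP[]//|m] /asboolP nU minU /=; split=> //.
apply: contrapT => nm; have : (m < m)%N by apply/minU/asboolP.
by rewrite ltnn.
Qed.

Lemma len_eq G (U : G -> Prop) n : chain n U -> ~ chain n.+1 U -> len U = n.
Proof.
move=> cn nn; have fU : finlen U by exists n.+1.
have [c nc] := lenP fU; apply/eqP; rewrite eqn_leq; apply/andP; split.
- by rewrite leqNgt; apply/negP => lt; apply: nn; apply: chain_leq c.
- by rewrite leqNgt; apply/negP => lt; apply: nc; apply: chain_leq cn.
Qed.

Lemma chain_len G (U : G -> Prop) n : finlen U -> chain n U -> (n <= len U)%N.
Proof.
move=> /lenP[_ nc] cn; rewrite leqNgt; apply/negP => lt; apply: nc.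
exact: chain_leq cn.
Qed.

Lemma len_le G (U V : G -> Prop) :
  (forall x, U x -> V x) -> finlen V -> (len U <= len V)%N.
Proof.
move=> UV fV; apply: chain_len => //.
by apply: (chain_mono UV); case: (lenP (finlen_mono UV fV)).
Qed.

Lemma len_lt G (U V : G -> Prop) : opsub U ->
  (forall x, U x -> V x) -> finlen V -> (exists2 x, V x & ~ U x) ->
  (len U < len V)%N.
Proof.
move=> sU UV fV ex; apply: chain_len => //=.
by exists U; split=> //; case: (lenP (finlen_mono UV fV)).
Qed.

Lemma len_eq_sub G (U V : G -> Prop) : opsub U ->
  (forall x, U x -> V x) -> finlen V -> (len V <= len U)%N ->
  forall x, V x -> U x.
Proof.
move=> sU UV fV le x Vx; apply: contrapT => nU.
by have := len_lt sU UV fV; rewrite ltnNge le => /(_ (ex_intro2 _ _ x Vx nU)).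
Qed.

Lemma len_zero G (U : G -> Prop) : (forall x, U x -> x = 0) ->
  finlen U /\ len U = 0%N.
Proof.
move=> U0; have n1 : ~ chain 1 U.
  by move=> [V [[V0 _ _] _ [x /U0-> []]]].
by split; [exists 1%N | apply: len_eq].
Qed.

Lemma opsubN G (U : G -> Prop) x : opsub U -> U x -> U (- x).
Proof. by move=> [U0 UB _] Ux; rewrite -sub0r; apply: UB. Qed.

Lemma opsubD G (U : G -> Prop) x y : opsub U -> U x -> U y -> U (x + y).
Proof. by move=> sU Ux Uy; rewrite -[y]opprK; case: (sU) => _ + _; apply=> //;
    apply: opsubN. Qed.

Lemma opsubT G : opsub (fun _ : G => True).
Proof. by []. Qed.

Definition opmap G H (f : G -> H) :=
  (forall x y, f (x - y) = f x - f y) /\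
  (forall t x, f (og_act t x) = og_act t (f x)).

Section OpMap.
Variables (G H : opGroup T) (f : G -> H).
Hypothesis fM : opmap f.

Lemma opmap0 : f 0 = 0.
Proof. by rewrite -(subrr (0 : G)) fM.1 subrr. Qed.

Definition img (U : G -> Prop) : H -> Prop := fun y => exists2 x, U x & f x = y.
Definition kerin (U : G -> Prop) : G -> Prop := fun x => U x /\ f x = 0.

Lemma opsub_img U : opsub U -> opsub (img U).
Proof.
move=> [U0 UB Ua]; split; first by exists 0; rewrite ?opmap0.
- by move=> _ _ [x Ux <-] [y Uy <-]; exists (x - y); rewrite ?fM.1 //; apply: UB.
- by move=> t _ [x Ux <-]; exists (og_act t x); rewrite ?fM.2 //; apply: Ua.
Qed.

Lemma opsub_preim (W : H -> Prop) : opsub W -> opsub (fun x => W (f x)).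
Proof.
move=> [W0 WB Wa]; split=> [|x y wx wy|t x wx]; rewrite ?opmap0 ?fM.1 ?fM.2 //.
- exact: WB.
- exact: Wa.
Qed.

Lemma opsubI (U V : G -> Prop) : opsub U -> opsub V ->
  opsub (fun x => U x /\ V x).
Proof.
move=> [U0 UB Ua] [V0 VB Va]; split=> [//|x y [? ?] [? ?]|t x [? ?]]; split;
  by [apply: UB | apply: VB | apply: Ua | apply: Va].
Qed.

Lemma opsub_kerin U : opsub U -> opsub (kerin U).
Proof.
move=> sU; apply: opsubI => //; split=> [|u v fu fv|t u fu].
- exact: opmap0.
- by rewrite fM.1 fu fv subrr.
- by rewrite fM.2 fu og_act0.
Qed.

(** A step of a chain is strict in the kernel or in the image of a map, by
the modular law. *)
Lemma chain_split n U : opsub U -> chain n U ->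
  exists a b, [/\ (a + b = n)%N, chain a (kerin U) & chain b (img U)].
Proof.
elim: n U => [|n IH] U sU; first by move=> _; exists 0%N, 0%N.
move=> [V [sV VU [x Ux nVx] cV]].
have [a [b [abn ca cb]]] := IH V sV cV.
have [[y [Uy fy] nVy]|noker] := pselect (exists2 y, kerin U y & ~ V y).
  exists a.+1, b; split; first by rewrite addSn abn.
    exists (kerin V); split=> //; first exact: opsub_kerin.
    - by move=> z [/VU Uz fz].
    - by exists y => // -[].
  by apply: chain_mono cb => z [w /VU Uw <-]; exists w.
exists a, b.+1; split; first by rewrite addnS abn.
  by apply: chain_mono ca => z [/VU Uz fz].
exists (img V); split=> //.
- exact: opsub_img.
- by move=> z [w /VU Uw <-]; exists w.
- exists (f x); first by exists x.
  move=> [v Vv fv]; apply: noker; exists (x - v).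
    split; last by rewrite fM.1 fv subrr.
    by case: sU => _ + _; apply=> //; apply: VU.
  by move=> Vxv; apply: nVx; rewrite -(subrK v x); apply: opsubD.
Qed.

Lemma chain_glue a b U : opsub U ->
  chain a (kerin U) -> chain b (img U) -> chain (a + b) U.
Proof.
elim: b U => [|b IH] U sU ca.
  by move=> _; rewrite addn0; apply: chain_mono ca => x [].
move=> [W [sW WU [_ [x Ux <-] nWx] cW]]; rewrite addnS.
exists (fun y => U y /\ W (f y)); split.
- by apply: opsubI => //; apply: opsub_preim.
- by move=> y [].
- by exists x => // -[].
- apply: IH; first by apply: opsubI => //; apply: opsub_preim.
    apply: chain_mono ca => y [Uy fy]; split=> //; split=> //.
    by rewrite fy; case: sW.
  by apply: chain_mono cW => y Wy; have [z Uz fz] := WU y Wy; exists z; rewrite ?fz.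
Qed.

Lemma finlen_ker U : finlen U -> finlen (kerin U).
Proof. by apply: finlen_mono => x []. Qed.

Lemma finlen_img U : opsub U -> finlen U -> finlen (img U).
Proof.
move=> sU [n nU]; exists n => cn; apply: nU; rewrite -(add0n n).
exact: chain_glue.
Qed.

Lemma finlen_ext U : opsub U ->
  finlen (kerin U) -> finlen (img U) -> finlen U.
Proof.
move=> sU [m nm] [n nn]; exists (m + n)%N => c.
have [a [b [abn ca cb]]] := chain_split sU c.
have lam : (a < m)%N.
  by rewrite ltnNge; apply/negP => le; apply: nm; apply: chain_leq ca.
have lbn : (b < n)%N.
  by rewrite ltnNge; apply/negP => le; apply: nn; apply: chain_leq cb.
by have := leq_add lam (ltnW lbn); rewrite addSn abn ltnn.
Qed.

Lemma len_split U : opsub U -> finlen U ->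
  len U = (len (kerin U) + len (img U))%N.
Proof.
move=> sU fU; have fk := finlen_ker fU; have fi := finlen_img sU fU.
have [ck nk] := lenP fk; have [ci ni] := lenP fi.
apply: len_eq; first exact: chain_glue.
move=> c; have [a [b [abn ca cb]]] := chain_split sU c.
have := leq_add (chain_len fk ca) (chain_len fi cb).
by rewrite abn ltnn.
Qed.

Lemma img_inj U : injective f -> opsub U ->
  (finlen (img U) <-> finlen U) /\ (finlen U -> len (img U) = len U).
Proof.
move=> fI sU.
have [fk lk] : finlen (kerin U) /\ len (kerin U) = 0%N.
  by apply: len_zero => x [_ fx]; apply: fI; rewrite fx opmap0.
split; last by move=> fU; rewrite (len_split sU) // lk.
by split; [apply: finlen_ext | apply: finlen_img].
Qed.

End OpMap.

Definition finlenG G := finlen (fun _ : G => True).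
Definition lenG G := len (fun _ : G => True).

Lemma finlenT G (U : G -> Prop) : finlenG G -> finlen U.
Proof. exact: finlen_mono. Qed.

Lemma finlenG_inj G H (f : G -> H) : opmap f -> injective f ->
  finlenG H -> finlenG G.
Proof.
move=> fM fI fH; apply/(img_inj fM fI (opsubT _)).1; exact: finlenT.
Qed.

Lemma finlenG_surj G H (f : G -> H) : opmap f -> surjective f ->
  finlenG G -> finlenG H.
Proof.
move=> fM fS /(finlen_img fM (opsubT G)); apply: finlen_mono => y _.
by have [x fx] := fS y; exists x.
Qed.

Section Exact.
Variables (K G H : opGroup T) (i : K -> G) (p : G -> H).
Hypotheses (iM : opmap i) (pM : opmap p).
Hypotheses (iI : injective i) (pS : surjective p).
Hypothesis ip : forall x, p x = 0 <-> exists y, i y = x.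

Let kerE : kerin p (fun _ => True) = img i (fun _ => True).
Proof.
apply: pred_ext => x; split=> [[_ /ip[y iy]]|[y _ iy]]; first by exists y.
by split=> //; apply/ip; exists y.
Qed.

Let imgE : img p (fun _ => True) = (fun _ => True).
Proof. by apply: pred_ext => y; split=> // _; have [x px] := pS y; exists x. Qed.

Lemma finlenG_ext : finlenG K -> finlenG H -> finlenG G.
Proof.
move=> fK fH; apply: (finlen_ext pM (opsubT _)); rewrite ?kerE ?imgE //.
exact/(img_inj iM iI (opsubT _)).1.
Qed.

Lemma lenG_ext : finlenG G -> lenG G = (lenG K + lenG H)%N.
Proof.
move=> fG; rewrite /lenG (len_split pM (opsubT _)) // kerE imgE.
by rewrite (img_inj iM iI (opsubT _)).2 //; apply: finlenG_inj iM iI fG.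
Qed.

End Exact.

Lemma lenG_bij G H (f : G -> H) : opmap f -> injective f -> surjective f ->
  finlenG G -> lenG G = lenG H.
Proof.
move=> fM fI fS fG; rewrite /lenG -(img_inj fM fI (opsubT _)).2 //.
by congr len; apply: pred_ext => y; split=> // _; have [x fx] := fS y; exists x.
Qed.

Lemma len_inj_surj G H (f : G -> H) : opmap f -> injective f ->
  finlenG H -> (lenG H <= lenG G)%N -> surjective f.
Proof.
move=> fM fI fH le y.
have : img f (fun _ => True) y; last by move=> [x _ fx]; exists x.
apply: (len_eq_sub (opsub_img fM (opsubT _)) (V := fun _ => True)) => //.
by rewrite (img_inj fM fI (opsubT _)).2 //; apply: finlenG_inj fM fI fH.
Qed.

Lemma len_surj_inj G H (f : G -> H) : opmap f -> surjective f ->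
  finlenG G -> (lenG G <= lenG H)%N -> injective f.
Proof.
move=> fM fS fG le x y fxy; apply/eqP; rewrite -subr_eq0; apply/eqP.
have iE : img f (fun _ => True) = (fun _ => True).
  by apply: pred_ext => z; split=> // _; have [u fu] := fS z; exists u.
have := len_split fM (opsubT G) fG; rewrite iE -/(lenG G) -/(lenG H) => lE.
have k0 : len (kerin f (fun _ => True)) = 0%N.
  by apply/eqP; rewrite -leqn0 -(leq_add2r (lenG H)) -lE.
have fk := finlen_ker f fG; have [_ nk] := lenP fk; apply: contrapT => nz.
apply: nk; rewrite k0 /=; exists (fun z => z = 0); split=> //.
- split=> [//|u v -> ->|t u ->]; first by rewrite subrr.
  exact: og_act0.
- by move=> z ->; split=> //; apply: opmap0.
- by exists (x - y) => //; split=> //; rewrite fM.1 fxy subrr.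
Qed.

Lemma ex_min_sub G (F : (G -> Prop) -> Prop) : finlenG G ->
  (exists U, F U) -> (forall U, F U -> opsub U) ->
  exists2 U, F U & forall V, F V -> (forall x, V x -> U x) ->
    forall x, U x -> V x.
Proof.
move=> fG [U0 FU0] Fsub.
have exn : exists n, `[< exists2 U, F U & len U = n >].
  by exists (len U0); apply/asboolP; exists U0.
have [n /asboolP[U FU lU] minn] := ex_minnP exn.
exists U => // V FV VU x Ux.
apply: (len_eq_sub (Fsub _ FV) VU (finlenT U fG)) => //.
by rewrite lU; apply: minn; apply/asboolP; exists V.
Qed.

Lemma ex_max_sub G (F : (G -> Prop) -> Prop) : finlenG G ->
  (exists U, F U) -> (forall U, F U -> opsub U) ->
  exists2 U, F U & forall V, F V -> (forall x, U x -> V x) ->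
    forall x, V x -> U x.
Proof.
move=> fG [U0 FU0] Fsub.
have exn : exists n, `[< exists2 U, F U & len U = n >].
  by exists (len U0); apply/asboolP; exists U0.
have bound n : `[< exists2 U, F U & len U = n >] -> (n <= lenG G)%N.
  by move=> /asboolP[U FU <-]; apply: len_le.
have [n /asboolP[U FU lU] maxn] := ex_maxnP exn bound.
exists U => // V FV UV.
apply: (len_eq_sub (Fsub _ FU) UV (finlenT V fG)).
by rewrite lU; apply: maxn; apply/asboolP; exists V.
Qed.

(** Generation is phrased through stable predicates; this spares linear
combinations when the elements of the group are homomorphisms. *)
Lemma finlen_gens G (U : G -> Prop) : opsub U -> finlen U ->
  exists (m : nat) (g : 'I_m -> G), (forall i, U (g i)) /\
    forall V : G -> Prop, opsub V -> (forall i, V (g i)) ->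
    forall x, U x -> V x.
Proof.
move=> sU fU.
pose span (s : seq G) x :=
  forall V : G -> Prop, opsub V -> (forall y, y \in s -> V y) -> V x.
have sspan s : opsub (span s).
  split=> [V []//|x y sx sy V sV Vs|t x sx V sV Vs].
    by case: (sV) => _ + _; apply; [apply: sx | apply: sy].
  by case: (sV) => _ _; apply; apply: sx.
suff [s [sUs Us]] : exists s : seq G,
    (forall y, y \in s -> U y) /\ forall x, U x -> span s x.
  exists (size s), (fun i => nth 0 s i); split.
    by move=> i; apply/sUs/mem_nth.
  move=> V sV Vs x /Us; apply=> // y /(nthP 0)[i si <-].
  exact: (Vs (Ordinal si)).
apply: contrapT => none; case: fU => n; apply.
suff [s sUs cs] : exists2 s : seq G, (forall y, y \in s -> U y) & chain n (span s).
  by apply: chain_mono cs => x; apply.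
elim: n => [|n [s sUs cs]]; first by exists [::].
have [x Ux nx] : exists2 x, U x & ~ span s x.
  apply: contrapT => nx; apply: none; exists s; split=> // x Ux.
  by apply: contrapT => ns; apply: nx; exists x.
exists (x :: s) => [y|].
  by rewrite inE => /orP[/eqP->|/sUs].
exists (span s); split=> //.
- by move=> y sy V sV Vs; apply: sy => // z zs; apply: Vs; rewrite inE zs orbT.
- by exists x => // V sV Vs; apply: Vs; rewrite inE eqxx.
Qed.

End Length.

(** * Submodules, quotients and linear maps *)

Section Submodules.
Variable A : pzRingType.
Implicit Types M N X Y : lmodType A.

Definition submod_ok M (U : M -> Prop) :=
  U 0 /\ forall a x y, U x -> U y -> U (a *: x + y).

Record lsub M := Lsub { lsub_prop :> M -> Prop; lsub_ok : submod_ok lsub_prop }.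

Section LsubTheory.
Variables (M : lmodType A) (U : lsub M).

Lemma lsub0 : U 0. Proof. by case: (lsub_ok U). Qed.
Lemma lsubZD a x y : U x -> U y -> U (a *: x + y).
Proof. by case: (lsub_ok U) => _; apply. Qed.
Lemma lsubD x y : U x -> U y -> U (x + y).
Proof. by move=> Ux Uy; rewrite -(scale1r x); apply: lsubZD. Qed.
Lemma lsubZ a x : U x -> U (a *: x).
Proof. by move=> Ux; rewrite -(addr0 (_ *: _)); apply: lsubZD (lsub0). Qed.
Lemma lsubN x : U x -> U (- x).
Proof. by move=> Ux; rewrite -scaleN1r; apply: lsubZ. Qed.
Lemma lsubB x y : U x -> U y -> U (x - y).
Proof. by move=> Ux /lsubN; apply: lsubD. Qed.

Definition lsub_pred : {pred M} := [pred x | `[< U x >]].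

Fact lsub_pred_closed : submod_closed lsub_pred.
Proof.
split=> [|a x y]; first by apply/asboolP; exact: lsub0.
by move=> /asboolP Ux /asboolP Uy; apply/asboolP; apply: lsubZD.
Qed.

HB.instance Definition _ :=
  GRing.isSubmodClosed.Build A M lsub_pred lsub_pred_closed.

Record smod := Smod { smod_val : M; _ : smod_val \in lsub_pred }.

HB.instance Definition _ := [isSub for smod_val].
HB.instance Definition _ := [Choice of smod by <:].
HB.instance Definition _ := [SubChoice_isSubLmodule of smod by <:].

Definition incl : {linear smod -> M} := \val.

Lemma incl_inj : injective incl. Proof. exact: val_inj. Qed.
Lemma incl_in x : U (incl x).
Proof. by case: x => x /= /asboolP. Qed.
Lemma incl_ex x : U x -> exists y, incl y = x.
Proof. by move=> /asboolP Ux; exists (Smod Ux). Qed.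
Lemma incl_exP x : U x <-> exists y, incl y = x.
Proof. by split=> [/incl_ex//|[y <-]]; apply: incl_in. Qed.

Definition quotm := Quotient.quot (lsub_pred : zmodClosed M).
HB.instance Definition _ := GRing.Zmodule.on quotm.

Definition qpi (x : M) : quotm := \pi x.

Lemma qpiE x y : qpi x = qpi y <-> U (x - y).
Proof.
rewrite -(asboolE (U _)); split=> [/eqP|h]; [|apply/eqP];
  by rewrite /qpi -Quotient.idealrBE.
Qed.

Lemma qpiB x y : qpi (x - y) = qpi x - qpi y.
Proof. by rewrite /qpi !piE. Qed.
Lemma qpiD x y : qpi (x + y) = qpi x + qpi y.
Proof. by rewrite /qpi !piE. Qed.
Lemma qpiK x : qpi (repr x) = x. Proof. exact: reprK. Qed.

Definition qscale (a : A) (x : quotm) : quotm := qpi (a *: repr x).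

Lemma qscale_pi a x : qscale a (qpi x) = qpi (a *: x).
Proof.
apply/qpiE; rewrite -scalerBr; apply: lsubZ; apply/qpiE; exact: qpiK.
Qed.

Fact qscaleA a b v : qscale a (qscale b v) = qscale (a * b) v.
Proof. by rewrite -(qpiK v) !qscale_pi scalerA. Qed.
Fact qscale1 : left_id 1 qscale.
Proof. by move=> v; rewrite -(qpiK v) qscale_pi scale1r. Qed.
Fact qscaleDr : right_distributive qscale +%R.
Proof.
by move=> a u v; rewrite -(qpiK u) -(qpiK v) -qpiD !qscale_pi scalerDr qpiD.
Qed.
Fact qscaleDl v : {morph qscale^~ v : a b / a + b}.
Proof. by move=> a b; rewrite -(qpiK v) !qscale_pi scalerDl qpiD. Qed.

HB.instance Definition _ := GRing.Zmodule_isLmodule.Build A quotm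
  qscaleA qscale1 qscaleDr qscaleDl.

Fact qpi_linear : linear qpi.
Proof. by move=> a x y; rewrite qpiD -qscale_pi. Qed.
HB.instance Definition _ := GRing.isLinear.Build A M quotm *:%R qpi qpi_linear.

Lemma qpiZ a x : qpi (a *: x) = a *: qpi x.
Proof. exact: linearZ. Qed.

Lemma qpi_eq0 x : qpi x = 0 <-> U x.
Proof. by rewrite -[U x]/(U x) -{2}(subr0 x) -qpiE linear0. Qed.

End LsubTheory.

Definition mk_linear M N (f : M -> N) (h : linear f) : {linear M -> N} :=
  HB.pack f (GRing.isLinear.Build A M N *:%R f h).

Lemma mk_linearE M N (f : M -> N) h x : @mk_linear M N f h x = f x.
Proof. by []. Qed.

(** A linear map is a functional total submodule of the product; this is how
maps are glued and descended below. *)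
Lemma linear_of_graph M N (G : M -> N -> Prop) :
  (forall x, exists y, G x y) -> (forall y, G 0 y -> y = 0) ->
  (forall a x y x' y', G x y -> G x' y' -> G (a *: x + x') (a *: y + y')) ->
  exists f : {linear M -> N}, forall x y, G x y <-> f x = y.
Proof.
move=> tot fun0 Gl.
have Gfun x y y' : G x y -> G x y' -> y = y'.
  move=> Gy Gy'; have := Gl (-1) _ _ _ _ Gy Gy'.
  by rewrite !scaleN1r !addNr => /fun0/eqP; rewrite addrC subr_eq0 => /eqP.
pose f x := sval (cid (tot x)); have fG x : G x (f x) := svalP (cid (tot x)).
have fin_length : linear f by move=> a x y; apply: (Gfun _ _ _ (fG _)); apply: Gl.
exists (mk_linear fin_length) => x y; rewrite mk_linearE.
by split=> [/(Gfun _ _ _ (fG x))//|<-].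
Qed.

Lemma factor_surj X M N (p : {linear X -> N}) (f : {linear X -> M}) :
  surjective p -> (forall x, p x = 0 -> f x = 0) ->
  exists g : {linear N -> M}, forall x, g (p x) = f x.
Proof.
move=> pS pf.
have [g gP] : exists g : {linear N -> M},
    forall n m, (exists2 x, p x = n & f x = m) <-> g n = m.
  apply: linear_of_graph => [n|m [x /pf <-]//|a _ _ _ _ [x <- <-] [y <- <-]].
    by have [x <-] := pS n; exists (f x), x.
  by exists (a *: x + y); rewrite linearP.
by exists g => x; apply/gP; exists x.
Qed.

Lemma factor_inj X M N (i : {linear M -> N}) (f : {linear X -> N}) :
  injective i -> (forall x, exists y, i y = f x) ->
  exists g : {linear X -> M}, forall x, i (g x) = f x.
Proof.
move=> iI fi.
have [g gP] : exists g : {linear X -> M}, forall x m, i m = f x <-> g x = m.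
  apply: linear_of_graph => [x|m|a x m x' m' e e']; first exact: fi.
    by rewrite linear0 -(linear0 i) => /iI.
  by rewrite !linearP e e'.
by exists g => x; apply/gP.
Qed.

Lemma inv_bij M N (f : {linear M -> N}) : injective f -> surjective f ->
  exists g : {linear N -> M}, cancel f g /\ cancel g f.
Proof.
move=> fI fS; have [g gf] := factor_inj (f := idfun : {linear N -> N}) fI fS.
by exists g; split=> // x; apply: fI; rewrite gf.
Qed.

Section SubConstructions.
Variables (M N : lmodType A).

Program Definition lker (f : {linear M -> N}) := @Lsub M (fun x => f x = 0) _.
Next Obligation.
move=> f; split=> [|a x y fx fy]; first exact: linear0.
by rewrite linearP fx fy scaler0 addr0.
Qed.

Program Definition lpre (f : {linear M -> N}) (W : lsub N) :=
  @Lsub M (fun x => W (f x)) _.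
Next Obligation.
move=> f W; split=> [|a x y fx fy]; first by rewrite linear0; apply: lsub0.
by rewrite linearP; apply: lsubZD.
Qed.

Program Definition limg (f : {linear M -> N}) (U : lsub M) :=
  @Lsub N (fun y => exists2 x, U x & f x = y) _.
Next Obligation.
move=> f U; split=> [|a _ _ [x Ux <-] [y Uy <-]].
  by exists 0; rewrite ?linear0 //; apply: lsub0.
by exists (a *: x + y); rewrite ?linearP //; apply: lsubZD.
Qed.

Program Definition lcap (U V : lsub M) := @Lsub M (fun x => U x /\ V x) _.
Next Obligation.
move=> U V; split=> [|a x y [? ?] [? ?]]; first by split; apply: lsub0.
by split; apply: lsubZD.
Qed.

Program Definition lsum (U V : lsub M) :=
  @Lsub M (fun x => exists u v, [/\ U u, V v & x = u + v]) _.
Next Obligation.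
move=> U V; split=> [|a _ _ [u [v [Uu Vv ->]]] [u' [v' [Uu' Vv' ->]]]].
  by exists 0, 0; rewrite addr0; split=> //; apply: lsub0.
exists (a *: u + u'), (a *: v + v'); split; try exact: lsubZD.
by rewrite scalerDr addrACA.
Qed.

Program Definition lall := @Lsub M (fun _ => True) _.
Next Obligation. by []. Qed.
Program Definition lzero := @Lsub M (fun x => x = 0) _.
Next Obligation. by split=> // a x y -> ->; rewrite scaler0 addr0. Qed.

Program Definition lcyclic (m : M) := @Lsub M (fun x => exists a, x = a *: m) _.
Next Obligation.
move=> m; split=> [|a _ _ [b ->] [c ->]]; first by exists 0; rewrite scale0r.
by exists (a * b + c); rewrite scalerDl scalerA.
Qed.

End SubConstructions.
End Submodules.
Arguments lall {A M}.
Arguments lzero {A M}.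
Arguments incl {A M U} : simpl never.

(** * Free and projective modules *)

Section Modules.
Variable A : pzRingType.
Implicit Types M N X Y Z P : lmodType A.

Lemma lcompE X Y Z (g : {linear Y -> Z}) (f : {linear X -> Y}) x :
  lcomp g f x = g (f x).
Proof. by []. Qed.

Definition pair_map X M N (f : {linear X -> M}) (g : {linear X -> N}) :
  {linear X -> (M * N)%type} :=
  lcomp (@pair_inl A M N) f + lcomp (@pair_inr A M N) g.

Lemma pair_mapE X M N (f : {linear X -> M}) (g : {linear X -> N}) x :
  pair_map f g x = (f x, g x).
Proof. by apply: injective_projections => /=; rewrite ?addr0 ?add0r. Qed.

Definition copair X M N (f : {linear M -> X}) (g : {linear N -> X}) :
  {linear (M * N)%type -> X} :=
  lcomp f (fst : {linear (M * N)%type -> M}) +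
  lcomp g (snd : {linear (M * N)%type -> N}).

Lemma copairE X M N (f : {linear M -> X}) (g : {linear N -> X}) x y :
  copair f g (x, y) = f x + g y.
Proof. by []. Qed.

Definition pw n M : lmodType A := {ffun 'I_n -> M}.

Section Powers.
Variables (n : nat) (M : lmodType A).

Fact pw_proj_linear (i : 'I_n) : linear (fun x : pw n M => x i).
Proof. by move=> a x y; rewrite !ffunE. Qed.
Definition pw_proj i : {linear pw n M -> M} := mk_linear (pw_proj_linear i).

Fact pw_inj_linear (i : 'I_n) :
  linear (fun x : M => [ffun j => if j == i then x else 0] : pw n M).
Proof.
move=> a x y; apply/ffunP => j; rewrite !ffunE.
by case: ifP => _; rewrite ?scaler0 ?addr0.
Qed.
Definition pw_inj i : {linear M -> pw n M} := mk_linear (pw_inj_linear i).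

Fact pw_tuple_linear X (f : 'I_n -> {linear X -> M}) :
  linear (fun x => [ffun i => f i x] : pw n M).
Proof. by move=> a x y; apply/ffunP => i; rewrite !ffunE linearP. Qed.
Definition pw_tuple X (f : 'I_n -> {linear X -> M}) : {linear X -> pw n M} :=
  mk_linear (pw_tuple_linear f).

Lemma pw_sum (x : pw n M) : x = \sum_i pw_inj i (x i).
Proof.
apply/ffunP => j; rewrite sum_ffunE (bigD1 j) //= ffunE eqxx big1 ?addr0 //.
by move=> i ij; rewrite ffunE eq_sym (negPf ij).
Qed.

End Powers.

Definition pw_map n M N (f : {linear M -> N}) : {linear pw n M -> pw n N} :=
  pw_tuple (fun i => lcomp f (@pw_proj n M i)).

Definition free n : lmodType A := pw n A^o.
Definition dlt n (i : 'I_n) : free n := @pw_inj n A^o i 1.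

Section FreeMap.
Variables (n : nat) (M : lmodType A) (v : 'I_n -> M).

Fact free_map_linear : linear (fun x : free n => (\sum_i (x i : A) *: v i : M)).
Proof.
move=> a x y; rewrite scaler_sumr -big_split; apply: eq_bigr => i _ /=.
by rewrite !ffunE scalerDl scalerA.
Qed.
Definition free_map : {linear free n -> M} := mk_linear free_map_linear.

Lemma free_map_dlt i : free_map (dlt i) = v i.
Proof.
rewrite mk_linearE (bigD1 i) //= big1 ?addr0 => [|j ji].
  by rewrite ffunE eqxx scale1r.
by rewrite ffunE (negPf ji) scale0r.
Qed.
End FreeMap.

Lemma free_dlt n (x : free n) : x = \sum_i x i *: dlt i.
Proof.
rewrite {1}[x]pw_sum; apply: eq_bigr => i _; apply/ffunP => j.
by rewrite !ffunE; case: ifP => _; rewrite ?[RHS]mulr1 ?[RHS]mulr0.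
Qed.

Lemma free_ext n M (f g : {linear free n -> M}) :
  (forall i, f (dlt i) = g (dlt i)) -> forall x, f x = g x.
Proof.
move=> fg x; rewrite (free_dlt x) !linear_sum; apply: eq_bigr => i _.
by rewrite !linearZ /= fg.
Qed.

Lemma fin_genP M : fin_gen M <-> exists n (f : {linear free n -> M}), surjective f.
Proof.
split=> [[n [v vP]]|[n [f fS]]].
  exists n, (free_map v) => m; have [c ->] := vP m.
  by exists [ffun i => c i]; rewrite mk_linearE; apply: eq_bigr => i _;
      rewrite ffunE.
exists n, (fun i => f (dlt i)) => m; have [x <-] := fS m.
exists x; rewrite {1}(free_dlt x) linear_sum; apply: eq_bigr => i _.
by rewrite linearZ.
Qed.

Definition retract X Y :=
  exists (s : {linear X -> Y}) (r : {linear Y -> X}), cancel s r.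

Lemma retr_refl X : retract X X. Proof. by exists idfun, idfun. Qed.

Lemma retr_trans X Y Z : retract X Y -> retract Y Z -> retract X Z.
Proof.
move=> [s [r sr]] [t [q tq]]; exists (lcomp t s), (lcomp r q) => x /=.
by rewrite tq sr.
Qed.

Lemma retr_bij X Y (f : {linear X -> Y}) : injective f -> surjective f ->
  retract X Y /\ retract Y X.
Proof.
move=> fI fS; have [g [fg gf]] := inv_bij fI fS.
by split; [exists f, g | exists g, f].
Qed.

Lemma retr_pair X Y X' Y' : retract X X' -> retract Y Y' ->
  retract (X * Y)%type (X' * Y')%type.
Proof.
move=> [s [r sr]] [t [q tq]].
exists (pair_map (lcomp s (fst : {linear (X * Y)%type -> X}))
                 (lcomp t (snd : {linear (X * Y)%type -> Y}))).
exists (pair_map (lcomp r (fst : {linear (X' * Y')%type -> X'}))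
                 (lcomp q (snd : {linear (X' * Y')%type -> Y'}))) => -[x y].
by rewrite !pair_mapE /= sr tq.
Qed.

Lemma retr_pw n X Y : retract X Y -> retract (pw n X) (pw n Y).
Proof.
move=> [s [r sr]]; exists (pw_map n s), (pw_map n r) => x.
by apply/ffunP => i; rewrite !ffunE /= ffunE /= sr.
Qed.

Lemma pw_add m n X : retract (pw m X * pw n X)%type (pw (m + n) X) /\
  retract (pw (m + n) X) (pw m X * pw n X)%type.
Proof.
pose P := (pw m X * pw n X)%type.
pose f : {linear P -> pw (m + n) X} := pw_tuple (fun i => match split i with
  | inl j => lcomp (pw_proj X j) (fst : {linear P -> pw m X})
  | inr j => lcomp (pw_proj X j) (snd : {linear P -> pw n X}) end).
pose g : {linear pw (m + n) X -> P} :=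
  pair_map (pw_tuple (fun i => pw_proj X (lshift n i)))
           (pw_tuple (fun i => pw_proj X (rshift m i))).
have splitl i : split (lshift n i) = inl i by exact: (unsplitK (inl i)).
have splitr i : split (rshift m i) = inr i by exact: (unsplitK (inr i)).
split; [exists f, g => -[x y]|exists g, f => x].
  rewrite /g pair_mapE; congr pair; apply/ffunP => i; rewrite !ffunE /= ffunE.
    by rewrite splitl.
  by rewrite splitr.
apply/ffunP => i; rewrite ffunE /g pair_mapE.
by case: splitP => j ij /=; rewrite ffunE /=; congr (x _); apply: val_inj.
Qed.

Lemma pw_mul m n X : retract (pw m (pw n X)) (pw (m * n) X).
Proof.
elim: m => [|m IH].
  exists 0, 0 => x; apply/ffunP => -[] //.
have [_ s1] := pw_add 1 m (pw n X); rewrite mulSn.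
have [s2 _] := pw_add n (m * n) X.
rewrite -[m.+1]add1n; apply: retr_trans s1 (retr_trans _ s2).
apply: retr_pair IH; exists (pw_proj _ ord0), (pw_inj _ ord0) => x.
by apply/ffunP => i; rewrite ffunE !ord1 eqxx.
Qed.

Lemma retr_pw_pair n X Y : retract (pw n X * pw n Y)%type (pw n (X * Y)%type) /\
  retract (pw n (X * Y)%type) (pw n X * pw n Y)%type.
Proof.
pose P := (pw n X * pw n Y)%type.
pose f : {linear P -> pw n (X * Y)%type} := pw_tuple (fun i => pair_map
  (lcomp (pw_proj X i) (fst : {linear P -> pw n X}))
  (lcomp (pw_proj Y i) (snd : {linear P -> pw n Y}))).
pose g : {linear pw n (X * Y)%type -> P} :=
  pair_map (pw_map n (fst : {linear (X * Y)%type -> X}))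
           (pw_map n (snd : {linear (X * Y)%type -> Y})).
split; [exists f, g => -[x y]|exists g, f => x].
  rewrite /g pair_mapE; congr pair; apply/ffunP => i;
    by rewrite !ffunE /= !ffunE /= ?addr0 ?add0r.
apply/ffunP => i; rewrite ffunE pair_mapE /g pair_mapE /= !ffunE /=.
by case: (x i).
Qed.

(** This agrees with lifting against finitely generated modules, and makes
lifting against arbitrary modules and all closure properties immediate. *)
Definition proj P := exists n, retract P (free n).

Lemma proj_free n : proj (free n). Proof. by exists n; apply: retr_refl. Qed.

Lemma proj_reg : proj A^o.
Proof.
exists 1%N, (pw_inj _ ord0), (pw_proj _ ord0) => x.
by rewrite mk_linearE ffunE.
Qed.

Lemma proj_retr P Q : retract P Q -> proj Q -> proj P.
Proof. by move=> PQ [n Qn]; exists n; apply: retr_trans PQ Qn. Qed.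

Lemma proj_pair P Q : proj P -> proj Q -> proj (P * Q)%type.
Proof.
move=> [m Pm] [n Qn]; exists (m + n)%N.
exact: retr_trans (retr_pair Pm Qn) (pw_add _ _ _).1.
Qed.

Lemma proj_pw n P : proj P -> proj (pw n P).
Proof.
move=> [m Pm]; exists (n * m)%N; apply: retr_trans (retr_pw n Pm) _.
exact: pw_mul.
Qed.

Lemma proj_lift P M N (p : {linear M -> N}) (f : {linear P -> N}) :
  proj P -> (forall x, exists y, p y = f x) ->
  exists h : {linear P -> M}, forall x, p (h x) = f x.
Proof.
move=> [n [s [r sr]]] pf.
have [v vP] := choice (fun i => pf (r (@dlt n i))).
exists (lcomp (free_map v) s) => x /=; rewrite -{2}(sr x).
apply: (free_ext (f := lcomp p (free_map v)) (g := lcomp f r)) => i.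
by rewrite !lcompE free_map_dlt vP.
Qed.

Lemma proj_fg P : proj P -> fin_gen P.
Proof.
move=> [n [s [r sr]]]; apply/fin_genP; exists n, r => x.
by exists (s x); rewrite sr.
Qed.

Lemma fin_gen_free n : fin_gen (free n).
Proof. exact: proj_fg (proj_free n). Qed.

Definition free_fg n : fgModType A := FgMod (fin_gen_free n).

Lemma projectiveP (P : fgModType A) : projective P <-> proj P.
Proof.
split=> [pP|pP M N g f gS].
  have [n [f fS]] := (fin_genP P).1 (fg_fin_gen P).
  have [h hP] := pP (free_fg n) P f idfun fS.
  by exists n, h, f => x; exact: (congr1 (fun u : {linear P -> P} => u x) hP).
have [h hP] := proj_lift pP (fun x => gS (f x)).
by exists h; apply: linear_eqP => x; apply: hP.
Qed.

(** * Modules of finite length *)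

(** The operators are the central elements of the ring: they act on modules
and on groups of homomorphisms alike, and are the same for the opposite
ring. *)
Definition central := {z : A | forall a, z * a = a * z}.

Definition modop M : opGroup central :=
  @OpGroup central M (fun z x => sval z *: x) (fun z => scaler0 _ (sval z)).

Section HomOp.
Variables X Y : lmodType A.

Fact hscale_linear (z : central) (f : {linear X -> Y}) :
  linear (fun x => sval z *: f x).
Proof.
move=> a x y; rewrite linearP scalerDr !scalerA; congr (_ *: _ + _).
by case: z => z /= ->.
Qed.
Definition hscale z f : {linear X -> Y} := mk_linear (hscale_linear z f).

Fact hscale0 z : hscale z 0 = 0.
Proof. by apply: linear_eqP => x; rewrite mk_linearE [X in _ *: X]/= scaler0. Qed.

Definition homop : opGroup central := @OpGroup central {linear X ->
    Y} hscale hscale0.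

End HomOp.

Definition fin_length M := finlenG (modop M).
Definition fin_length_sub M (U : M -> Prop) := @finlen central (modop M) U.
Definition lenM M : nat := lenG (modop M).
Definition lenU M (U : M -> Prop) : nat := @len central (modop M) U.
Definition homlen X Y : nat := lenG (homop X Y).

Lemma lsub_opsub M (U : lsub M) : @opsub central (modop M) U.
Proof.
split=> [|x y|z x]; [exact: lsub0 | exact: lsubB | exact: lsubZ].
Qed.

Lemma linear_opmap M N (f : {linear M -> N}) : @opmap central (modop M) (modop N) f.
Proof. by split=> [x y|z x]; rewrite ?linearB //= linearZ. Qed.

Lemma precomp_opmap X X' Y (g : {linear X -> X'}) :
  @opmap central (homop X' Y) (homop X Y) (fun f => lcomp f g).
Proof. by split=> [f h|z f]; apply: linear_eqP => x. Qed.

Lemma postcomp_opmap X Y Y' (g : {linear Y -> Y'}) :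
  @opmap central (homop X Y) (homop X Y') (fun f => lcomp g f).
Proof.
split=> [f h|z f]; apply: linear_eqP => x /=; first by rewrite [LHS]linearB.
by rewrite [LHS]linearZ.
Qed.

Lemma fl_inj M N (f : {linear M -> N}) : injective f -> fin_length N ->
    fin_length M.
Proof. by move=> fI; apply: finlenG_inj (linear_opmap f) fI. Qed.

Lemma fl_surj M N (f : {linear M -> N}) : surjective f -> fin_length M ->
    fin_length N.
Proof. by move=> fS; apply: finlenG_surj (linear_opmap f) fS. Qed.

Lemma fl_retr M N : retract M N -> fin_length N -> fin_length M.
Proof. by move=> [s [r sr]]; apply: (fl_surj (f := r)) => x; exists (s x). Qed.

Lemma fl_smod M (U : lsub M) : fin_length M -> fin_length (smod U).
Proof. by apply: fl_inj; apply: (@incl_inj _ _ U). Qed.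

Lemma fl_pair M N : fin_length M -> fin_length N -> fin_length (M * N)%type.
Proof.
apply: (@finlenG_ext _ (modop M) (modop (M * N)%type) (modop N)
          (@pair_inl A M N) (@snd M N)).
- exact: linear_opmap.
- by [].
- by move=> x y [].
- by move=> y; exists (0, y).
- by move=> [x y] /=; split=> [->|[z [_ <-]]//]; exists x.
Qed.

Lemma fl_zero M : (forall x : M, x = 0) -> fin_length M.
Proof. by move=> M0; case: (@len_zero _ (modop M) (fun _ => True)). Qed.

Lemma fl_pw n M : fin_length M -> fin_length (pw n M).
Proof.
move=> fM; elim: n => [|n IH].
  by apply: fl_zero => x; apply/ffunP => -[].
rewrite -[n.+1]add1n; apply: fl_retr (pw_add 1 n M).2 _; apply: fl_pair IH.
apply: (@fl_inj _ _ (pw_proj M (@ord0 0)) _ fM) => x y /= xy.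
by apply/ffunP => i; rewrite ord1.
Qed.

Lemma fl_fg M : fin_length M -> fin_gen M.
Proof.
move=> fM; have [m [g [_ gP]]] := finlen_gens (opsubT (modop M)) fM.
exists m, g => x; pose V := limg (free_map g) lall.
have [y _ yx] : V x.
  apply: (gP V (lsub_opsub V)) => // i.
  by exists (dlt i); rewrite ?free_map_dlt.
by exists y.
Qed.

Section FiniteRing.
Hypothesis flA : fin_length A^o.

Lemma fl_free n : fin_length (free n). Proof. exact: fl_pw. Qed.

Lemma fg_fl M : fin_gen M -> fin_length M.
Proof. by move=> /fin_genP[n [f fS]]; apply: fl_surj fS (fl_free n). Qed.

Lemma proj_fl P : proj P -> fin_length P.
Proof. by move=> /proj_fg/fg_fl. Qed.

Lemma fl_hom X Y : fin_length X -> fin_length Y -> finlenG (homop X Y).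
Proof.
move=> /fl_fg/fin_genP[n [f fS]] fY.
apply: (@finlenG_inj _ (homop X Y) (modop (pw n Y))
          (fun h => [ffun i => h (f (dlt i))])) (fl_pw n fY).
- by split=> [h k|z h]; apply/ffunP => i; rewrite !ffunE.
- move=> h k hk; apply: linear_eqP => x; have [y <-] := fS x.
  apply: (free_ext (f := lcomp h f) (g := lcomp k f)) => i /=.
  by move/ffunP: hk => /(_ i); rewrite !ffunE.
Qed.

(** The group of maps has finite length, so every stable family of maps is
finitely generated; generators are the coordinates of the approximation. *)
Lemma approx X Y (U : homop X Y -> Prop) : fin_length X -> fin_length Y ->
    opsub U ->
  exists m (F : {linear X -> pw m Y}), (forall i, U (lcomp (pw_proj Y i) F)) /\
    forall g : {linear X -> Y}, U g ->
      exists h : {linear pw m Y -> Y}, forall x, h (F x) = g x.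
Proof.
move=> fX fY sU; have fU := finlenT U (fl_hom fX fY).
have [m [g [gU gP]]] := finlen_gens sU fU.
exists m, (pw_tuple g); split=> [i|].
  by rewrite (_ : lcomp _ _ = g i) //; apply: linear_eqP => x /=; rewrite ffunE.
apply: gP => [|i]; last first.
  by exists (pw_proj Y i) => x; rewrite /= ffunE.
split=> [|f f' [h hf] [h' hf']|z f [h hf]].
- by exists 0.
- by exists (h - h') => x /=; rewrite [LHS]/= hf hf'.
- by exists (hscale z h) => x; rewrite mk_linearE hf.
Qed.

End FiniteRing.
End Modules.

(** * An Artin algebra has finite length over its centre *)

Section ArtinianMin.
Variables (R : pzRingType) (M : lmodType R).
Hypothesis artM : artinian_module M.

Lemma artinian_min (F : lsub M -> Prop) : (exists U, F U) ->
  exists2 U, F U & forall V, F V -> (forall x, V x -> U x) ->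
    forall x, U x -> V x.
Proof.
move=> [U0 FU0]; apply: contrapT => nomin.
have step (U : {U | F U}) : exists V : {V | F V},
    (forall x, sval V x -> sval U x) /\ exists2 x, sval U x & ~ sval V x.
  case: U => U FU /=; apply: contrapT => nV; apply: nomin.
  exists U => // V FV VU x Ux; apply: contrapT => nVx; apply: nV.
  by exists (exist _ V FV); split=> //; exists x.
have [next nextP] := choice step.
pose s n := iter n next (exist _ U0 FU0).
have [|N NP] := artM (I := fun n => lsub_pred (sval (s n)) : submodClosed M).
  by move=> n x /asboolP sx; apply/asboolP; apply: (nextP (s n)).1.
have [x sNx] := (nextP (s N)).2; apply; have := NP N.+1 (leqnSn N) x.
by rewrite !inE (asboolT sNx) => /asboolP.
Qed.

End ArtinianMin.

Section Hopkins.
Variable k : comNzRingType.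
Let M := (k^o : lmodType k).

Fact cmulr_linear (r : k) : linear (fun x : M => (r * x : M)).
Proof. by move=> a x y; rewrite mulrDr /= mulrCA. Qed.
Let mul r : {linear M -> M} := mk_linear (cmulr_linear r).

Lemma opsub_comm (V : lmodType k) (W : modop V -> Prop) : opsub W -> submod_ok W.
Proof.
move=> sW; split; first by case: sW.
move=> a x y Wx Wy; apply: (opsubD sW) => //.
have az b : a * b = b * a by apply: mulrC.
by case: sW => _ _ /(_ (exist _ a az) _ Wx).
Qed.

(** An ideal that is minimal among those of infinite length is a vector space
over a field, and all its proper subspaces are finite-dimensional; but the
union of an increasing sequence of subspaces missing a given vector is
proper. *)
Lemma artinian_finlen : artinian_module M -> fin_length M.
Proof.
move=> artM; apply: contrapT => nfl.
have [I nI Imin] : exists2 I : lsub M, ~ fin_length_sub I &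
    forall V : lsub M, ~ fin_length_sub V -> (forall x, V x -> I x) ->
      forall x, I x -> V x.
  by apply: (artinian_min artM (F := fun U => ~ fin_length_sub U)); exists lall.
have proper (V : lsub M) : (forall x, V x -> I x) -> (exists2 x, I x & ~ V x) ->
    fin_length_sub V.
  move=> VI [x Ix nVx]; apply: contrapT => nV; apply: nVx.
  exact: (Imin V nV VI).
(* Kernel and image of a multiplication cannot both be proper in [I]. *)
have dich (r : k) : (forall x, I x -> r * x = 0) \/
    (forall x, I x -> exists2 y, I y & r * y = x).
  have [kf|nkf] := pselect (fin_length_sub (lcap I (lker (mul r)))).
    right; apply: (Imin (limg (mul r) I)).
      move=> fi; apply: nI.
      exact: (finlen_ext (linear_opmap (mul r)) (lsub_opsub I)).
    by move=> _ [y Iy <-]; apply: lsubZ.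
  by left=> x Ix; have [_] := Imin _ nkf (fun _ h => h.1) x Ix.
pose P (r : k) := forall x, I x -> r * x = 0.
have ndich (r : k) : ~ P r -> forall x, I x -> exists2 y, I y & r * y = x.
  by move=> nP; case: (dich r).
have P1 : ~ P 1.
  move=> p1; apply: nI.
  by apply: (@len_zero _ (modop M) I _).1 => x Ix; rewrite -(mul1r x) p1.
have [J [r Jr nPr] Jmin] : exists2 J : lsub M, (exists2 r, J r & ~ P r) &
    forall V : lsub M, (exists2 r, V r & ~ P r) -> (forall x, V x -> J x) ->
      forall x, J x -> V x.
  by apply: (artinian_min artM (F := fun U => exists2 r, U r & ~ P r));
    exists lall, 1.
(* The annihilator [P] of [I] is a maximal ideal. *)
have Pinv (s : k) : ~ P s -> exists t, forall x, I x -> t * (s * x) = x.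
  move=> nPs; have [||c rc] := Jmin (lcyclic (r * s : M)) _ _ r Jr.
  - exists (r * s); first by exists 1; rewrite scale1r.
    move=> Prs; apply: nPr => x Ix; have [y Iy <-] := ndich s nPs x Ix.
    by rewrite mulrA Prs.
  - move=> _ [c ->]; apply: lsubZ; rewrite mulrC.
    exact: (lsubZ s Jr).
  - exists c => x Ix; have [y Iy <-] := ndich r nPr x Ix.
    by rewrite {2}rc /= !mulrA; congr (_ * _); rewrite [X in _ = X]mulrA mulrAC.
have [x Ix x0] : exists2 x, I x & x <> 0.
  apply: contrapT => nx; apply: nI.
  apply: (@len_zero _ (modop M) I _).1 => x Ix; apply: contrapT => x0.
  by apply: nx; exists x.
(* A subspace [V] missing [x] has finite length, so [V + kx] is not all of [I]
and [V] can be enlarged without reaching [x]. *)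
have grow (V : lsub M) : (forall y, V y -> I y) /\ ~ V x ->
    exists W : lsub M, [/\ (forall y, W y -> I y) /\ ~ W x,
      forall y, V y -> W y & exists2 y, W y & ~ V y].
  move=> [VI nVx].
  have [y Iy nV1y] : exists2 y, I y & ~ lsum V (lcyclic x) y.
    apply: contrapT => nV1; apply: nI.
    apply: (finlen_ext (linear_opmap (qpi V)) (lsub_opsub I)).
      apply: finlen_mono (proper V VI (ex_intro2 _ _ x Ix nVx)) => y [Iy].
      by move/qpi_eq0.
    pose im := @img _ (modop M) (modop (quotm V)) (qpi V) I.
    have top (W : modop (quotm V) -> Prop) : opsub W -> (exists2 z, W z & z <> 0) ->
        (forall z, W z -> im z) -> forall z, im z -> W z.
      move=> sW [z Wz z0] WI; have [y Iy yz] := WI z Wz.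
      have [u [v [Vu [c cv] yE]]] : lsum V (lcyclic x) y.
        by apply: contrapT => ny; apply: nV1; exists y.
      have /qpi_eq0 qu := Vu.
      have qx : W (qpi V x).
        have [Pc|nPc] := pselect (P c).
          by case: z0; rewrite -yz yE qpiD qu cv /= [_ *: _]Pc // add0r linear0.
        have [t tc] := Pinv c nPc.
        have zE : z = c *: qpi V x by rewrite -yz yE qpiD qu cv add0r qpiZ.
        have : W (t *: z).
          have /opsub_comm[W0 WZ] := sW; rewrite -(addr0 (t *: z)); exact: WZ.
        by rewrite zE scalerA -qpiZ [_ *: _](_ :
            _ = x) // -[LHS]/(_ * _ * _) -mulrA tc.
      move=> _ [y' Iy' <-].
      have [u' [v' [Vu' [c' ->] ->]]] : lsum V (lcyclic x) y'.
        by apply: contrapT => ny; apply: nV1; exists y'.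
      have /qpi_eq0 qu' := Vu'.
      rewrite qpiD qu' add0r qpiZ.
      by have /opsub_comm[W0 WZ] := sW; rewrite -(addr0 (_ *: _)); apply: WZ.
    exists 2%N => -[W [sW WI [z Iz nWz] [W' [sW' _ [z' Wz' nWz'] _]]]].
    apply: nWz; apply: top => //; exists z' => // z0; apply: nWz'.
    by rewrite z0; case: sW'.
  exists (lsum V (lcyclic y)); split.
  - split=> [_ [u [_ [Vu [c ->] ->]]]|[v [_ [Vv [c ->] xE]]]].
      by apply: lsubD; [apply: VI | apply: lsubZ].
    have [Pc|nPc] := pselect (P c).
      by apply: nVx; rewrite xE [c *: y]Pc // addr0.
    have [t tc] := Pinv c nPc; apply: nV1y.
    exists (- (t *: v)), (t *: x); split; first by apply/lsubN/lsubZ.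
      by exists t.
    by rewrite [in RHS]xE scalerDr addrA addNr add0r [RHS]tc.
  - by move=> u Vu; exists u, 0; split=> //; [exists 0;
      rewrite scale0r | rewrite addr0].
  - exists y; first by exists 0, y; split; [exact: lsub0 | exists 1;
      rewrite scale1r | rewrite add0r].
    move=> Vy; apply: nV1y; exists y, 0; split=> //; last by rewrite addr0.
    by exists 0; rewrite scale0r.
pose Q (V : lsub M) := (forall y, V y -> I y) /\ ~ V x.
have Q0 : Q lzero by split=> [y ->|//]; apply: lsub0.
have next_ex (V : {V | Q V}) : exists W : {V | Q V},
    (forall y, sval V y -> sval W y) /\ exists2 y, sval W y & ~ sval V y.
  case: V => V QV; have [W [QW VW ex]] := grow V QV.
  by exists (exist _ W QW).
have [next nextP] := choice next_ex.
pose s n := sval (iter n next (exist _ lzero Q0)).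
have sQ n : Q (s n) by rewrite /s; case: (iter n _ _).
have smono m n : (m <= n)%N -> forall y, s m y -> s n y.
  move=> /subnK <-; elim: (n - m)%N => // d IH y /IH sy.
  exact: (nextP _).1.
have Uok : submod_ok (fun y => exists n, s n y).
  split=> [|a y z [m sy] [n sz]]; first by exists 0%N; apply: lsub0.
  exists (maxn m n); apply: lsubZD; first exact: smono (leq_maxl m n) _ sy.
  exact: smono (leq_maxr m n) _ sz.
have /proper : forall y, Lsub Uok y -> I y by move=> y [n /(sQ n).1].
case=> [|N]; first by exists x => // -[n /(sQ n).2].
apply; suff : chain N (s N : modop M -> Prop).
  by apply: chain_mono => y sy; exists N.
elim: N => // n IH; exists (s n); split=> //.
- exact: lsub_opsub.
- exact: smono.
- exact: (nextP _).2.
Qed.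

End Hopkins.

Lemma chain_coarse (T T' : Type) (Z : zmodType) (act : T -> Z -> Z)
    (act' : T' -> Z -> Z) (a0 : forall t, act t 0 = 0)
    (a0' : forall t, act' t 0 = 0) :
  (forall t', exists t, forall x, act' t' x = act t x) ->
  forall n U, @chain T (OpGroup a0) n U -> @chain T' (OpGroup a0') n U.
Proof.
move=> tt n; elim: n => //= n IH U [V [[V0 VB Va] VU ex cV]].
exists V; split=> //; last exact: IH.
by split=> // t' x Vx /=; have [t ->] := tt t'; apply: Va.
Qed.

Section ArtinAlgebra.
Variables (k : comNzRingType) (L : algType k).
Hypothesis artL : artin_algebra L.

Let flL : fin_length (L : lmodType k).
Proof.
by apply: fg_fl artL.2; apply: artinian_finlen artL.1.
Qed.

Lemma artin_fl : fin_length (L^o : lmodType L).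
Proof.
case: flL => n nL; exists n => c; apply: nL.
apply: chain_coarse c => z.
have zc : forall a : L, (sval z)%:A * a = a * (sval z)%:A.
  by move=> a; rewrite -scalerAl mul1r -scalerAr mulr1.
by exists (exist _ _ zc) => x; rewrite /= -[RHS]/(_ * _) -scalerAl mul1r.
Qed.

Lemma artin_fl_op : fin_length ((L^c)^o : lmodType L^c).
Proof.
case: flL => n nL; exists n => c; apply: nL.
apply: chain_coarse c => z.
have zc : forall a : L^c, ((sval z)%:A : L^c) * a = a * ((sval z)%:A : L^c).
  move=> a; rewrite -[LHS]/((a : L) * ((sval z)%:A : L)).
  rewrite -[RHS]/(((sval z)%:A : L) * (a : L)).
  by rewrite -scalerAl mul1r -scalerAr mulr1.
exists (exist _ _ zc) => x.
rewrite /= -[RHS]/((x : L) * ((sval z)%:A : L)).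
by rewrite -scalerAr mulr1.
Qed.

End ArtinAlgebra.

(** * Torsionless modules and extensions by projectives *)

Section Torsionless.
Variable A : pzRingType.
Implicit Types M N X Y Q P : lmodType A.

(** [closed_in K] says that the quotient by [K] is torsionless, [ext_in K]
that its first extension group by the ring vanishes, and [ext0 N Q] is the
vanishing of the first extension group of [N] by [Q]. The condition
[closed_are_ext] amounts to injective dimension at most one; [ext_are_closed]
is its counterpart on the other side. *)
Definition closed_in N (K : N -> Prop) :=
  forall x, (forall h : {linear N -> A^o}, (forall y, K y -> h y = 0) -> h x = 0) ->
    K x.

Definition ext_in N (K : lsub N) :=
  forall h : {linear smod K -> A^o},
    exists g : {linear N -> A^o}, forall y, g (incl y) = h y.

Definition closed_are_ext := forall n (K : lsub (free A n)), closed_in K ->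
    ext_in K.
Definition ext_are_closed := forall n (K : lsub (free A n)), ext_in K ->
    closed_in K.

Definition torsionless N := exists n (f : {linear N -> free A n}), injective f.

Definition ext0 N Q := forall X (p : {linear X -> N}), surjective p ->
  forall h : {linear smod (lker p) -> Q},
    exists g : {linear X -> Q}, forall y, g (incl y) = h y.

Lemma lker_in M N (f : {linear M -> N}) (x : smod (lker f)) : f (incl x) = 0.
Proof. exact: (incl_in x). Qed.

Lemma inj_ker0 M N (f : {linear M -> N}) : (forall x, f x = 0 -> x = 0) ->
    injective f.
Proof.
by move=> f0 x y /eqP; rewrite -subr_eq0 -linearB => /eqP/f0/eqP;
    rewrite subr_eq0 => /eqP.
Qed.

Lemma ker0_inj M N (f : {linear M -> N}) x : injective f -> f x = 0 -> x = 0.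
Proof. by move=> fI; rewrite -(linear0 f) => /fI. Qed.

Lemma tors_sub M N (f : {linear M -> N}) : injective f -> torsionless N ->
    torsionless M.
Proof. by move=> fI [n [g gI]]; exists n, (lcomp g f) => x y /gI/fI. Qed.

Lemma tors_free n : torsionless (free A n).
Proof. by exists n, idfun. Qed.

Lemma tors_smod N (U : lsub N) : torsionless N -> torsionless (smod U).
Proof. exact: tors_sub (@incl_inj _ _ U). Qed.

Lemma tors_retr M N : retract M N -> torsionless N -> torsionless M.
Proof. by move=> [s [r sr]]; apply: tors_sub (can_inj sr). Qed.

Lemma tors_proj P : proj P -> torsionless P.
Proof. by move=> [n Pn]; apply: tors_retr Pn (tors_free n). Qed.

Lemma tors_pair M N : torsionless M -> torsionless N -> torsionless (M * N)%type.
Proof.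
move=> [m [f fI]] [n [g gI]].
apply: (@tors_sub _ (free A m * free A n)%type
  (pair_map (lcomp f (fst : {linear (M * N)%type -> M}))
            (lcomp g (snd : {linear (M * N)%type -> N})))).
  by move=> [x y] [x' y']; rewrite !pair_mapE => -[/fI-> /gI->].
exact: tors_retr (pw_add m n A^o).1 (tors_free _).
Qed.

Lemma tors_sep M x : torsionless M -> (forall h : {linear M ->
    A^o}, h x = 0) -> x = 0.
Proof.
move=> [n [f fI]] hx; apply: (ker0_inj fI); apply/ffunP => i.
by rewrite ffunE; apply: (hx (lcomp (pw_proj A^o i) f)).
Qed.

(** The presentation maps to any other surjection [q] onto [N]; the extended map
and the given one glue on the sum of [P] and the kernel of [q]. *)
Lemma ext0_of P N Q (p : {linear P -> N}) : proj P -> surjective p ->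
  (forall h : {linear smod (lker p) -> Q},
     exists g : {linear P -> Q}, forall y, g (incl y) = h y) -> ext0 N Q.
Proof.
move=> prP pS pE X q qS h.
have [u uP] := proj_lift prP (fun x => qS (p x)).
have uK (y : smod (lker p)) : exists z : smod (lker q), incl z = lcomp u incl y.
  by apply: incl_ex; rewrite /= uP lker_in.
have [v vP] := factor_inj (@incl_inj _ _ (lker q)) uK.
have [w wP] := pE (lcomp h v).
pose s : {linear (P * smod (lker q))%type -> X} := copair u incl.
pose t : {linear (P * smod (lker q))%type -> Q} := copair w h.
have [||g gP] := @factor_surj _ _ _ _ s t.
- move=> x; have [y yx] := pS (q x).
  have [z zx] : exists z : smod (lker q), incl z = x - u y.
    by apply: incl_ex; rewrite /= linearB uP yx subrr.
  by exists (y, z); rewrite copairE zx addrC subrK.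
- move=> [y z]; rewrite !copairE => e; have py : p y = 0.
    by have := congr1 q e; rewrite linearD uP lker_in addr0 linear0.
  have [y' y'y] := @incl_ex _ _ (lker p) y py.
  have zE : z = - v y'.
    apply: incl_inj; rewrite linearN vP lcompE y'y; apply/eqP.
    by rewrite -addr_eq0 addrC e.
  by rewrite zE linearN -y'y wP lcompE subrr.
exists g => y; have := gP (0, y).
by rewrite !copairE !linear0 !add0r.
Qed.

Lemma ext0_use (K : lmodType A) X N Q (i : {linear K -> X}) (p : {linear X -> N}) :
  ext0 N Q -> injective i -> surjective p ->
  (forall x, p x = 0 <-> exists y, i y = x) ->
  forall h : {linear K -> Q}, exists g : {linear X -> Q}, forall y, g (i y) = h y.
Proof.
move=> e iI pS ip h.
have ki (y : smod (lker p)) : exists z, i z = incl y by apply/ip; apply: lker_in.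
have [j jP] := factor_inj iI ki.
have [g gP] := e X p pS (lcomp h j).
exists g => y; have [z zy] : exists z : smod (lker p), incl z = i y.
  by apply: incl_ex; apply/ip; exists y.
by rewrite -zy gP /=; congr (h _); apply: iI; rewrite jP.
Qed.

Lemma ext0_free N n : ext0 N A^o -> ext0 N (free A n).
Proof.
move=> e X p pS h.
have [g gP] := choice (fun i => e X p pS (lcomp (pw_proj A^o i) h)).
by exists (pw_tuple g) => y; apply/ffunP => i; rewrite ffunE gP.
Qed.

Lemma ext0_proj N Q : proj Q -> ext0 N A^o -> ext0 N Q.
Proof.
move=> [n [s [r sr]]] e X p pS h.
have [g gP] := ext0_free e pS (lcomp s h).
by exists (lcomp r g) => y; rewrite /= gP /= sr.
Qed.

Section Finite.
Hypothesis flA : fin_length A^o.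

Lemma sep_tors M : fin_length M -> (forall x, (forall h : {linear M ->
    A^o}, h x = 0) -> x = 0) ->
  torsionless M.
Proof.
move=> fM sep; have [m [F [_ FP]]] := approx fM flA (opsubT _).
exists m, F; apply: inj_ker0 => x Fx; apply: sep => h.
by have [g <-] := FP h I; rewrite Fx linear0.
Qed.

Lemma torsionless_ext0 N : closed_are_ext -> fin_length N ->
    torsionless N -> ext0 N A^o.
Proof.
move=> cT /fl_fg/fin_genP[n [p pS]] tN.
apply: (ext0_of (proj_free A n) pS).
apply: cT => x hx /=; apply: (tors_sep tN) => h.
by apply: (hx (lcomp h p)) => y /= ->; rewrite linear0.
Qed.

Lemma ext0_closed_are_ext : (forall N, fin_length N -> torsionless N ->
    ext0 N A^o) -> closed_are_ext.
Proof.
move=> e n K cK h.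
have fq : fin_length (quotm K).
  apply: (@fl_surj _ _ _ (qpi K : {linear _ -> quotm K})) (fl_free flA n).
  by move=> y; exists (repr y); apply: qpiK.
have tq : torsionless (quotm K).
  apply: sep_tors => // y; rewrite -(qpiK y) => hy; apply/qpi_eq0/cK => g gK.
  have [g' g'P] := @factor_surj _ _ _ _ (qpi K : {linear _ -> quotm K}) g
     (fun y => ex_intro _ (repr y) (qpiK y)) (fun x h => gK x ((qpi_eq0 K x).1 h)).
  by rewrite -g'P.
have := ext0_use (i := incl) (p := qpi K) (e _ fq tq) (@incl_inj _ _ K).
apply=> [y|x]; first by exists (repr y); apply: qpiK.
by rewrite -incl_exP; apply: qpi_eq0.
Qed.

(** A map from the kernel of [p] to the ring extends to a map [u] into the first
injective. What [u] lacks to land in the ring is a map from [N] to the second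
injective; it extends to a free module containing [N], lifts to the first
injective, and is subtracted from [u]. *)
Lemma injdim_closed_are_ext : injdim_le (regular A) 1 -> closed_are_ext.
Proof.
move=> [I [d [e [Iinj eI ex0 ex I0]]]];
    apply: ext0_closed_are_ext => N fN [n [j jI]].
have /fin_genP[m [p pS]] := fl_fg fN.
apply: (ext0_of (proj_free A m) pS) => h.
have fK : fin_gen (smod (lker p)) by apply/fl_fg/fl_smod/fl_free.
have [u uP] := Iinj 0%N (FgMod fK) (free_fg A m) incl (lcomp e h) (@incl_inj _ _ _).
have {}uP y : u (incl y) = e (h y).
  exact: (congr1 (fun f : {linear _ -> _} => f y) uP).
have du x : p x = 0 -> d 0%N (u x) = 0.
  move=> px; have [y <-] := @incl_ex _ _ (lker p) x px.
  by rewrite uP; apply/ex0; exists (h y).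
have [v vP] := factor_surj (f := lcomp (d 0%N) u) pS du.
have [w wP] := Iinj 1%N (FgMod (fl_fg fN)) (free_fg A n) j v jI.
have {}wP y : w (j y) = v y.
  exact: (congr1 (fun f : {linear _ -> _} => f y) wP).
have [|t tP] := proj_lift (p := d 0%N) (f := w) (proj_free A n).
  by move=> x; apply/(ex 0%N); apply: I0.
have [|g gP] := factor_inj (f := u - lcomp t (lcomp j p)) eI.
  move=> x; apply/ex0; rewrite [_ x]/= linearB /= tP wP vP /=.
  by rewrite subrr.
exists g => y; apply: eI; rewrite gP -[LHS]/(u (incl y) - t (j (p (incl y)))).
by rewrite lker_in !linear0 ?subr0 ?addr0 uP.
Qed.

End Finite.
End Torsionless.

(** * Left and right torsionless quotients *)

Section Annihilators.
Variable A : pzRingType.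

(** For a matrix [X] with rows [X i], [rows_closed X] says that the row space is
the annihilator of its annihilator, i.e. that the quotient by the row space is
torsionless; [cols_closed X] is the same for columns. *)
Definition rows_closed m n (X : 'I_m -> 'I_n -> A) :=
  forall x : 'I_n -> A,
    (forall w : 'I_n -> A, (forall i, \sum_j X i j * w j = 0) ->
       \sum_j x j * w j = 0) ->
    exists v : 'I_m -> A, forall j, x j = \sum_i v i * X i j.

Definition cols_closed m n (X : 'I_m -> 'I_n -> A) :=
  forall u : 'I_m -> A,
    (forall v : 'I_m -> A, (forall j, \sum_i v i * X i j = 0) ->
       \sum_i v i * u i = 0) ->
    exists w : 'I_n -> A, forall i, u i = \sum_j X i j * w j.

Lemma functionalE n (h : {linear free A n -> A^o}) x :
  h x = \sum_j x j * h (dlt A j).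
Proof. by rewrite {1}(free_dlt x) linear_sum; apply: eq_bigr => j _;
    rewrite linearZ. Qed.

Section Matrix.
Variables (m n : nat) (X : 'I_m -> 'I_n -> A).

Definition row_map : {linear free A m -> free A n} :=
  free_map (fun i => [ffun j => X i j] : free A n).

Lemma row_mapE v j : row_map v j = \sum_i v i * X i j.
Proof.
rewrite /row_map mk_linearE sum_ffunE; apply: eq_bigr => i _.
by rewrite !ffunE.
Qed.

Let K := limg row_map lall.

Lemma closed_rows : closed_in K <-> rows_closed X.
Proof.
split=> cX x xw.
  have [|v _ vx] := cX [ffun j => x j].
    move=> h hK; rewrite functionalE; under eq_bigr do rewrite ffunE.
    apply: xw => i.
    transitivity (h (row_map (dlt A i))); last by apply: hK; exists (dlt A i).
    rewrite /row_map free_map_dlt functionalE.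
    by apply: eq_bigr => j _; rewrite ffunE.
  by exists v => j; rewrite -row_mapE vx ffunE.
have [w wX|v vx] := cX x.
  have := xw (free_map (w : 'I_n -> A^o)); rewrite mk_linearE; apply.
  move=> y [v _ <-].
  apply: (free_ext (f := lcomp (free_map (w : 'I_n -> A^o)) row_map)
                   (g := 0)) => i.
  rewrite lcompE /row_map free_map_dlt mk_linearE -[RHS](wX i).
  by apply: eq_bigr => j _; rewrite ffunE.
exists [ffun i => v i] => //; apply/ffunP => j; rewrite row_mapE vx.
by apply: eq_bigr => i _; rewrite ffunE.
Qed.

Lemma ext_cols : ext_in K <-> cols_closed X.
Proof.
have fK (v : free A m) : exists y : smod K, incl y = row_map v.
  by apply: incl_ex; exists v.
have [f fP] := factor_inj (@incl_inj _ _ K) fK.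
have fS : surjective f.
  move=> y; have [v _ vy] := incl_in y; exists v; apply: incl_inj.
  by rewrite fP.
split=> eX.
  move=> u uX.
  have [|h hP] := @factor_surj _ _ _ _ f (free_map (u : 'I_m -> A^o)) fS.
    move=> v fv; rewrite mk_linearE; apply: uX => j.
    by rewrite -row_mapE -fP fv linear0 ffunE.
  have [g gP] := eX h; exists (fun j => g (dlt A j)) => i.
  rewrite -[LHS](free_map_dlt (u : 'I_m -> A^o)) -hP -gP fP.
  rewrite /row_map free_map_dlt functionalE.
  by apply: eq_bigr => j _; rewrite ffunE.
move=> h; have [v vX|w wP] := eX (fun i => h (f (dlt A i))).
  have fv : f [ffun i => v i] = 0.
    apply: incl_inj; rewrite fP linear0; apply/ffunP => j.
    by rewrite row_mapE ffunE -[RHS](vX j); apply: eq_bigr => i _; rewrite ffunE.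
  have := functionalE (lcomp h f) [ffun i => v i]; rewrite lcompE fv linear0.
  by move=> e; rewrite [RHS]e; apply: eq_bigr => i _; rewrite ffunE.
exists (free_map (w : 'I_n -> A^o)) => y; have [v <-] := fS y.
rewrite fP -!lcompE; apply: free_ext => i.
rewrite !lcompE wP /row_map free_map_dlt mk_linearE.
by apply: eq_bigr => j _; rewrite ffunE.
Qed.

End Matrix.

Hypothesis flA : fin_length A^o.

Lemma lsub_row_map n (K : lsub (free A n)) :
  exists m (X : 'I_m -> 'I_n -> A), K = limg (row_map X) lall.
Proof.
have /fin_genP[m [f fS]] := fl_fg (fl_smod K (fl_free flA n)).
exists m, (fun i j => incl (f (dlt A i)) j).
have fE v : row_map (fun i j => incl (f (dlt A i)) j) v = incl (f v).
  apply: (free_ext (g := lcomp incl f)) => i.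
  rewrite /row_map free_map_dlt; apply/ffunP => j.
  by rewrite ffunE.
have UV : lsub_prop K = limg (row_map (fun i j => incl (f (dlt A i)) j)) lall.
  apply: pred_ext => x; split=> [/incl_ex[y <-]|[v _ <-]].
    by have [v <-] := fS y; exists v; rewrite ?fE.
  by rewrite fE; apply: incl_in.
case: K f fS fE UV => U Uok f fS fE UV; case: (limg _ _) UV => V Vok /= UV.
by subst V; congr Lsub; apply: Prop_irrelevance.
Qed.

Lemma closed_are_ext_matrix : closed_are_ext A <->
  forall m n (X : 'I_m -> 'I_n -> A), rows_closed X -> cols_closed X.
Proof.
split=> [cT m n X /closed_rows/cT/ext_cols//|cX n K].
have [m [X ->]] := lsub_row_map K.
by move=> /closed_rows/cX/ext_cols.
Qed.

Lemma ext_are_closed_matrix : ext_are_closed A <->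
  forall m n (X : 'I_m -> 'I_n -> A), cols_closed X -> rows_closed X.
Proof.
split=> [cU m n X /ext_cols/cU/closed_rows//|cX n K].
have [m [X ->]] := lsub_row_map K.
by move=> /ext_cols/cX/closed_rows.
Qed.

End Annihilators.

(** Transposing matrices exchanges the two conditions: the presentation of the
Auslander transpose is the transposed matrix. *)
Lemma closed_ext_op (A : pzRingType) : fin_length A^o -> fin_length (A^c)^o ->
  (closed_are_ext A <-> ext_are_closed A^c) /\ (ext_are_closed A <->
      closed_are_ext A^c).
Proof.
move=> flA flAc; split; rewrite closed_are_ext_matrix // ext_are_closed_matrix //;
  by split=> H m n X; apply: (H n m (fun j i => X i j)).
Qed.

(** * Maximal left ideals and primitive idempotents *)

Section Ideals.
Variable A : pzRingType.
Implicit Types M N X Y Q P : lmodType A.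

Lemma ex_min_lsub M (F : lsub M -> Prop) : fin_length M -> (exists U, F U) ->
  exists2 U, F U & forall V, F V -> (forall x, V x -> U x) ->
    forall x, U x -> V x.
Proof.
move=> fM [U0 FU0].
pose F' (W : modop M -> Prop) := exists2 U : lsub M, F U & lsub_prop U = W.
have [||W [U FU <-] Umin] := @ex_min_sub _ (modop M) F' fM.
- by exists U0, U0.
- by move=> _ [U _ <-]; apply: lsub_opsub.
by exists U => // V FV; apply: Umin; exists V.
Qed.

Lemma ex_max_lsub M (F : lsub M -> Prop) : fin_length M -> (exists U, F U) ->
  exists2 U, F U & forall V, F V -> (forall x, U x -> V x) ->
    forall x, V x -> U x.
Proof.
move=> fM [U0 FU0].
pose F' (W : modop M -> Prop) := exists2 U : lsub M, F U & lsub_prop U = W.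
have [||W [U FU <-] Umax] := @ex_max_sub _ (modop M) F' fM.
- by exists U0, U0.
- by move=> _ [U _ <-]; apply: lsub_opsub.
by exists U => // V FV; apply: Umax; exists V.
Qed.

Definition max_left_ideal (m : lsub A^o) :=
  ~ m 1 /\ forall V : lsub A^o, (forall x, m x -> V x) ->
    (forall x, V x -> m x) \/ V 1.

Fact mulr_linear M (x : M) : linear (fun a : A^o => (a : A) *: x).
Proof. by move=> a b c; rewrite scalerDl scalerA. Qed.
Definition scal M (x : M) : {linear A^o -> M} := mk_linear (mulr_linear x).

Lemma scalE M (x : M) (a : A) : scal x a = a *: x :> M. Proof. by []. Qed.

Definition ann_mod M (U : lsub M) (x : M) : lsub A^o := lpre (scal x) U.

Lemma ex_simple M (U : lsub M) : fin_length M -> (exists x, ~ U x) ->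
  exists x, ~ U x /\ max_left_ideal (ann_mod U x).
Proof.
move=> fM [x0 nUx0].
have [V [x Vx nUx] Vmin] := @ex_min_lsub M
  (fun V => exists2 x, V x & ~ U x) fM (ex_intro _ lall (ex_intro2 _ _ x0 I nUx0)).
exists x; split=> //; split=> [|B qB]; first by rewrite /= scale1r.
have [le|nle] := pselect (forall a, B a -> ann_mod U x a); [by left | right].
have [||c Bc cx] := Vmin (limg (scal x) B) _ _ x Vx.
- apply: contrapT => nex; apply: nle => a Ba; apply: contrapT => na.
  by apply: nex; exists (scal x a) => //; exists a.
- by move=> _ [a _ <-]; apply: lsubZ.
have : ann_mod U x (1 - c) by rewrite /ann_mod /= scalerBl scale1r -[X in _ -
    X]/(scal x c) cx subrr; apply: lsub0.
by move/qB => B1c; rewrite -(subrK c 1); apply: lsubD.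
Qed.

(** The idempotent generates a left ideal [V] that is minimal among those not
contained in [m], a projective cover of the quotient by [m]: right
multiplication by an element of [V] congruent to 1 modulo [m] maps [V] onto
itself, hence is injective on [V]. *)
Lemma ex_idem (m : lsub A^o) : fin_length A^o -> max_left_ideal m ->
  exists e : A, [/\ e * e = e, ~ m e &
    forall m' : lsub A^o, max_left_ideal m' -> (exists a, ~ m' (e * a)) ->
      exists a : A, forall r, m' (r * a) <-> m r].
Proof.
move=> flA [m1 mmax].
have [V [v0 Vv0 nmv0] Vmin] := @ex_min_lsub A^o
  (fun V => exists2 x, V x & ~ m x) flA (ex_intro _ lall (ex_intro2 _ _ 1 I m1)).
have [c [v [mc Vv cv]]] : exists c v, [/\ m c, V v & 1 = c + v].
  have [] := mmax (lsum m V); last by move=> [c [v [mc Vv cv]]]; exists c, v.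
    by move=> x mx; exists x, 0; rewrite addr0; split=> //; apply: lsub0.
  by move=> le; case: nmv0; apply: le; exists 0, v0; rewrite add0r;
      split=> //; apply: lsub0.
have cE : c = 1 - v by rewrite cv addrK.
have [||e Ve ev] := Vmin (limg (scal (v : A^o)) V) _ _ v Vv.
- exists (v0 * v); first by exists v0.
  move=> mv; apply: nmv0.
  have -> : v0 = v0 * v + v0 *: c :> A^o.
    by rewrite cE -[v0 *: _]/(v0 * _) mulrBr mulr1 addrC subrK.
  by apply: lsubD => //; apply: lsubZ.
- by move=> _ [a Va <-]; apply: lsubZ.
have {}ev : e * v = v := ev.
have mulV (x : smod V) : exists y : smod V, incl y = lcomp (scal (v : A^o)) incl x.
  by apply: incl_ex; apply: lsubZ.
have [f fP] := factor_inj (@incl_inj _ _ V) mulV.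
have fS : surjective f.
  move=> y; have [||a Va ay] :=
      Vmin (limg (scal (v : A^o)) V) _ _ (incl y) (incl_in y).
  - exists v => //; first by exists e.
    by move=> mv; apply: m1; rewrite cv; apply: lsubD.
  - by move=> _ [a Va <-]; apply: lsubZ.
  have [x xa] := incl_ex Va; exists x; apply: incl_inj.
  by rewrite fP lcompE xa.
have fI : injective f.
  apply: (len_surj_inj (linear_opmap f) fS); last exact: leqnn.
  exact: fl_smod flA.
have ee : e * e = e.
  have Vd : V (e * e - e) by apply: lsubB => //; apply: (lsubZ (U := V)).
  have [x xd] := incl_ex Vd; have : x = 0.
    apply: (ker0_inj fI); apply: incl_inj; rewrite fP linear0 lcompE xd scalE.
    by rewrite -[LHS]/(_ * _) mulrBl -mulrA ev ev subrr.
  by move=> x0; apply/eqP; rewrite -subr_eq0 -[_ - _]xd x0 linear0.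
have m1e : m (1 - e).
  have -> : 1 - e = c - e *: c :> A^o.
    by rewrite cE -[e *: _]/(e * _) mulrBr mulr1 ev opprB addrA subrK.
  by apply: lsubB => //; apply: lsubZ.
have nme : ~ m e by move=> me; apply: m1; rewrite -(subrK e 1); apply: lsubD.
exists e; split=> // m' [m'1 m'max] [a nea]; exists (e * a).
have Wm r : V r -> m' (r * a) -> m r.
  move=> Vr mra; apply: contrapT => nmr; apply: nea.
  have [||_ //] := Vmin (lcap V (ann_mod m' (a : A^o))) _ _ e Ve.
    by exists r.
  by move=> x [].
have Vm r : V r -> m r -> m' (r * a).
  move=> Vr mr; apply: contrapT => nra; apply: nme.
  have [] := m'max (lsum m' (lcyclic (r * a : A^o))).
  - by move=> x m'x; exists x, 0; rewrite addr0; split=> //; apply: lsub0.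
  - move=> le; case: nra; apply: le; exists 0, (r * a); rewrite add0r; split=> //.
      exact: lsub0.
    by exists 1; rewrite scale1r.
  move=> [n [_ [m'n [s ->] one]]].
  have nE : e * a *: n = e * a - e * a * s * r * a :> A^o.
    by rewrite -[LHS]/(_ * _) -{2}(mulr1 (e * a)) one mulrDr -[s *: _]/(_ * _)
        !mulrA addrK.
  have : m (e - e * a * s * r).
    apply: Wm; first by apply: lsubB => //; apply: (lsubZ (U := V)).
    by rewrite mulrBl -[_ - _]nE; apply: lsubZ.
  move=> md; rewrite -(subrK (e * a * s * r) e); apply: lsubD => //.
  exact: (lsubZ (U := m)).
have mI r : m r -> ann_mod m' (e * a : A^o) r.
  move=> mr; rewrite /= -[_ *: _]/(r * (e * a)) mulrA; apply: Vm.
    exact: (lsubZ (U := V)).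
  have -> : r * e = r - r *: (1 - e) :> A^o.
    by rewrite -[_ *: _]/(r * _) mulrBr mulr1 opprB addrC subrK.
  by apply: lsubB => //; apply: lsubZ.
have [le|] := mmax _ mI; first by move=> r; split; [apply: le | apply: mI].
by rewrite /= scale1r.
Qed.

(** A complete irredundant list of the simple modules, given by maximal left
ideals, with the idempotents that detect them. *)
Record simples n (m : nat -> lsub A^o) (e : nat -> A) := Simples {
  simples_max : forall i, (i < n)%N -> max_left_ideal (m i);
  simples_idem : forall i, (i < n)%N -> e i * e i = e i;
  simples_self : forall i, (i < n)%N -> ~ m i (e i);
  simples_iso : forall i, (i < n)%N -> forall m', max_left_ideal m' ->
    (exists a, ~ m' (e i * a)) -> exists a : A, forall r, m' (r * a) <-> m i r;
  simples_other : forall i j, (i < n)%N -> (j < n)%N -> i <> j ->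
    forall a, m j (e i * a) }.

Lemma simples_bound n m e : fin_length A^o -> simples n m e -> (n <= lenM A^o)%N.
Proof.
move=> flA S; apply: chain_len => //.
have Uok j : @submod_ok _ A^o (fun a => forall i, (i < j)%N ->
    forall b, m i (a * b)).
  split=> [i _ b|a x y Ux Uy i ij b]; first by rewrite mul0r; apply: lsub0.
  by rewrite mulrDl -[a *: x]/(a * x) -mulrA; apply: lsubD;
      [apply: (lsubZ (U := m i)); apply: Ux | apply: Uy].
pose U j : lsub A^o := Lsub (Uok j).
suff c d j : (j + d)%N = n -> chain d (U j : modop A^o -> Prop).
  by apply: chain_mono (c n 0%N (add0n n)).
elim: d j => // d IH j jd; exists (U j.+1); split.
- exact: lsub_opsub.
- by move=> x Ux i ij b; apply: Ux; apply: ltnW.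
- have jn : (j < n)%N by rewrite -jd -addSnnS leq_addr.
  exists (e j) => [i ij b|Ue].
    apply: (simples_other S) => //; first exact: ltn_trans ij jn.
    by move=> ji; rewrite ji ltnn in ij.
  by apply: (simples_self S jn); rewrite -(mulr1 (e j)); apply: Ue.
- by apply: IH; rewrite addSnnS.
Qed.

Lemma ex_simples : fin_length A^o -> exists n m e, simples n m e /\
  forall m', max_left_ideal m' -> exists i, (i < n)%N /\
    exists a : A, forall r, m' (r * a) <-> m i r.
Proof.
move=> flA.
have ex0 : exists n, `[< exists m e, simples n m e >].
  by exists 0%N; apply/asboolP; exists (fun=> lzero), (fun=> 0).
have bound n : `[< exists m e, simples n m e >] -> (n <= lenM A^o)%N.
  by move=> /asboolP[m [e S]]; apply: simples_bound S.
have [n /asboolP[m [e S]] nmax] := ex_maxnP ex0 bound.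
exists n, m, e; split=> // m' Mm'; apply: contrapT => none.
have none' i a : (i < n)%N -> m' (e i * a).
  move=> lin; apply: contrapT => nm'; apply: none; exists i; split=> //.
  by apply: (simples_iso S) => //; exists a.
have [e' [ee' me' iso']] := ex_idem flA Mm'.
have other i a : (i < n)%N -> m i (e' * a).
  move=> lin; apply: contrapT => nmi.
  have [b bP] := iso' (m i) (simples_max S lin) (ex_intro _ a nmi).
  have nb : ~ m i b by move=> mb; case: Mm' => + _; apply; apply/bP; rewrite mul1r.
  have [_ mmax] := simples_max S lin.
  have [] := mmax (lsum (m i) (lcyclic (b : A^o))).
  - by move=> x m'x; exists x, 0; rewrite addr0; split=> //; apply: lsub0.
  - move=> le; case: nb; apply: le; exists 0, b; rewrite add0r; split=> //.
      exact: lsub0.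
    by exists 1; rewrite scale1r.
  move=> [c [_ [mc [s ->] one]]]; apply: (simples_self S lin).
  rewrite -(mulr1 (e i)) one mulrDr; apply: lsubD; first exact: (lsubZ (U := m i)).
  by rewrite -[s *: _]/(s * b) mulrA; apply/bP; apply: none'.
have : (n.+1 <= n)%N; last by rewrite ltnn.
apply: nmax; apply/asboolP.
exists (fun i => if (i < n)%N then m i else m').
exists (fun i => if (i < n)%N then e i else e').
split=> [i|i|i|i|i j].
- by move=> _; case: ltnP => // lin; apply: (simples_max S).
- by move=> _; case: ltnP => // lin; apply: (simples_idem S).
- by move=> _; case: ltnP => // lin; apply: (simples_self S).
- by move=> _; case: ltnP => // lin; apply: (simples_iso S).
- rewrite !ltnS => lein lejn ij a; case: ltnP => ljn; case: ltnP => lin.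
  + exact: (simples_other S).
  + exact: other.
  + exact: none'.
  + by case: ij; apply/eqP; rewrite eqn_leq (leq_trans lein) ?(leq_trans lejn).
Qed.

End Ideals.

(** * Projectives are determined by lengths of groups of maps *)

Section HomLength.
Variable A : pzRingType.
Hypothesis flA : fin_length A^o.
Implicit Types M N X Y Q P : lmodType A.

Lemma qpi_surj M (U : lsub M) : surjective (qpi U).
Proof. by move=> y; exists (repr y); apply: qpiK. Qed.

Lemma fl_quotm M (U : lsub M) : fin_length M -> fin_length (quotm U).
Proof. exact: (@fl_surj _ _ _ (qpi U : {linear _ -> quotm U}) (@qpi_surj _ U)). Qed.

Lemma qpi_exact M (U : lsub M) x : qpi U x = 0 <-> exists y : smod U, incl y = x.
Proof. by rewrite -incl_exP; apply: qpi_eq0. Qed.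

Lemma tors_quotm M Q (U : lsub M) : fin_length M -> torsionless Q ->
  (forall x, (forall h : {linear M -> Q}, (forall y, U y -> h y = 0) -> h x = 0) ->
     U x) -> torsionless (quotm U).
Proof.
move=> fM tQ cU; apply: sep_tors => //; first exact: fl_quotm.
move=> y; rewrite -(qpiK y) => hy; apply/qpi_eq0/cU => g gU.
have [g' g'P] := @factor_surj _ _ _ _ (qpi U : {linear _ -> quotm U}) g
  (@qpi_surj _ U) (fun x h => gU x ((qpi_eq0 U x).1 h)).
apply: (tors_sep tQ) => h; rewrite -g'P.
exact: (hy (lcomp h g')).
Qed.

Section HomExact.
Variables (K X N : lmodType A) (i : {linear K -> X}) (p : {linear X -> N}).
Hypotheses (iI : injective i) (pS : surjective p).
Hypothesis ip : forall x, p x = 0 <-> exists y, i y = x.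

Lemma homlen_exact Q : fin_length X -> fin_length Q -> ext0 N Q ->
    homlen X Q = (homlen K Q + homlen N Q)%N.
Proof.
move=> fX fQ e; rewrite addnC.
apply: (@lenG_ext _ (homop N Q) (homop X Q) (homop K Q)
          (fun f => lcomp f p) (fun f => lcomp f i)).
- exact: precomp_opmap.
- exact: precomp_opmap.
- move=> f g /(congr1 (fun u : {linear X -> Q} => u : X -> Q)) /= fg.
  apply: linear_eqP => y; have [x <-] := pS y.
  by move: (congr1 (fun u => u x) fg).
- move=> h; have [g gP] := ext0_use e iI pS ip h.
  by exists g; apply: linear_eqP => x; rewrite lcompE gP.
- move=> f; split=> [f0|[g <-]]; last first.
    apply: linear_eqP => y; rewrite !lcompE [p _](_ : _ = 0) ?linear0 //.
    by apply/ip; exists y.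
  have [|g gP] := factor_surj (f := f) pS.
    by move=> x /ip[y <-]; apply: (congr1 (fun u : {linear K -> Q} => u y) f0).
  by exists g; apply: linear_eqP => x; rewrite lcompE gP.
- exact: fl_hom.
Qed.
End HomExact.

Lemma homlen_pair X M N : fin_length X -> fin_length M -> fin_length N ->
    homlen X (M * N)%type = (homlen X M + homlen X N)%N.
Proof.
move=> fX fM fN.
apply: (@lenG_ext _ (homop X M) (homop X (M * N)%type) (homop X N)
   (fun f => lcomp (@pair_inl A M N) f)
   (fun f => lcomp (snd : {linear (M * N)%type -> N}) f)).
- exact: postcomp_opmap.
- exact: postcomp_opmap.
- move=> f g fg; apply: linear_eqP => x.
  by have [] := congr1 (fun u : {linear X -> (M * N)%type} => u x) fg.
- move=> f; exists (lcomp (@pair_inr A M N) f); exact: linear_eqP.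
- move=> f; split=> [f0|[g <-]]; last exact: linear_eqP.
  exists (lcomp (fst : {linear (M * N)%type -> M}) f); apply: linear_eqP => x.
  apply: injective_projections => //=.
  by have := congr1 (fun u : {linear X -> N} => u x) f0.
- by apply: fl_hom => //; apply: fl_pair.
Qed.

Lemma precomp_surj X Y Q (F : {linear X -> Y}) :
  fin_length X -> fin_length Q -> (forall g : {linear Y ->
      Q}, (forall x, g (F x) = 0) -> g = 0) ->
  (homlen X Q <= homlen Y Q)%N ->
  forall h : {linear X -> Q}, exists g : {linear Y -> Q}, forall x, g (F x) = h x.
Proof.
move=> fX fQ F0 le h.
have [|g gP] := @len_inj_surj _ (homop Y Q) (homop X Q) (fun g => lcomp g F)
  (precomp_opmap _ F) _ (fl_hom fX fQ) le h.
- move=> g g' e; apply/eqP; rewrite -subr_eq0; apply/eqP; apply: F0 => x.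
  have := congr1 (fun u : {linear X -> Q} => u x) e; rewrite !lcompE => {}e.
  by rewrite -[LHS]/(g (F x) - g' (F x)) e subrr.
- by exists g => x; rewrite -gP.
Qed.

Lemma homlen_precomp X Y Q (F : {linear X -> Y}) :
  fin_length X -> fin_length Y -> fin_length Q ->
  (forall g : {linear Y -> Q}, (forall x, g (F x) = 0) -> g = 0) ->
  (forall h : {linear X -> Q}, exists g : {linear Y ->
      Q}, forall x, g (F x) = h x) ->
  homlen Y Q = homlen X Q.
Proof.
move=> fX fY fQ F0 FS.
apply: (@lenG_bij _ (homop Y Q) (homop X Q) (fun g => lcomp g F)
  (precomp_opmap _ F)).
- move=> g g' e; apply/eqP; rewrite -subr_eq0; apply/eqP; apply: F0 => x.
  have := congr1 (fun u : {linear X -> Q} => u x) e; rewrite !lcompE => {}e.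
  by rewrite -[LHS]/(g (F x) - g' (F x)) e subrr.
- by move=> h; have [g gP] := FS h; exists g; apply: linear_eqP => x;
    rewrite lcompE.
- exact: fl_hom.
Qed.

(** Bongartz's cancellation: an approximation of [P] by powers of [P'] is
injective by the equality of lengths; the part of its cokernel without maps to
[P'] has no maps nor extensions to [P] either, hence splits off and vanishes;
so the cokernel is torsionless and the approximation splits. *)
Lemma retract_of_homlen P P' : closed_are_ext A -> proj P -> proj P' ->
  (forall X, fin_length X -> torsionless X -> homlen X P = homlen X P') ->
  exists m, retract P (pw m P').
Proof.
move=> cT prP prP' E.
have [fP fP'] := (proj_fl flA prP, proj_fl flA prP').
have [tP tP'] := (tors_proj prP, tors_proj prP').
have [m [F [_ FA]]] := approx fP fP' (opsubT _).
have fm : fin_length (pw m P') by apply: fl_pw.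
have tm : torsionless (pw m P') by apply/tors_proj/proj_pw.
exists m.
(* The image of [F] has as many maps to [P'] as [P] has, hence also to [P]. *)
have FI : injective F.
  pose Y := limg F lall.
  have FY x : exists y : smod Y, incl y = F x by apply: incl_ex; exists x.
  have [F1 F1P] := factor_inj (@incl_inj _ _ Y) FY.
  have F1S : surjective F1.
    move=> y; have [x _ xy] := incl_in y; exists x; apply: incl_inj.
    by rewrite F1P.
  have F10 Q (g : {linear smod Y -> Q}) : (forall x, g (F1 x) = 0) -> g = 0.
    by move=> g0; apply: linear_eqP => y; have [x <-] := F1S y; rewrite g0.
  have fY : fin_length (smod Y) by apply: fl_smod.
  have tY : torsionless (smod Y) by apply: tors_smod.
  have e1 : homlen (smod Y) P' = homlen P P'.
    apply: (@homlen_precomp _ _ _ F1) => // [g|h]; first exact: F10.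
    have [g gP] := FA h I; exists (lcomp g incl) => x.
    by rewrite lcompE F1P gP.
  have [|g gP] := @precomp_surj _ _ P F1 fP fP (F10 P) _ idfun.
    by rewrite (E _ fY) // (E _ fP) // e1.
  apply: inj_ker0 => x Fx.
  have F1x : F1 x = 0 by apply: incl_inj; rewrite F1P Fx linear0.
  by have := gP x; rewrite F1x linear0.
have Bok : submod_ok (fun b => forall h : {linear pw m P' -> P'},
    (forall x, h (F x) = 0) -> h b = 0).
  split=> [h _|a x y Bx By h h0]; first exact: linear0.
  by rewrite linearP Bx // By // scaler0 addr0.
(* [B] is the closure of the image of [F]; it will turn out to be that image. *)
pose B := Lsub Bok.
have BF x : B (F x) by move=> h; apply.
have [F2 F2P] := factor_inj (@incl_inj _ _ B) (fun x => incl_ex (BF x)).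
have tC : torsionless (quotm B).
  apply: (tors_quotm fm tP') => x hx h h0; apply: hx => y; exact.
have eC Q : proj Q -> ext0 (quotm B) Q.
  by move=> prQ; apply: ext0_proj => //; apply: torsionless_ext0 => //;
      apply: fl_quotm.
have fB : fin_length (smod B) by apply: fl_smod.
have tB : torsionless (smod B) by apply: tors_smod.
have F20 (g : {linear smod B -> P'}) : (forall x, g (F2 x) = 0) -> g = 0.
  move=> g0; apply: linear_eqP => y.
  have [h hP] := ext0_use (eC _ prP') (@incl_inj _ _ B) (@qpi_surj _ B)
    (qpi_exact B) g.
  by rewrite -hP; apply: (incl_in y) => x; rewrite -F2P hP g0.
have e2 : homlen (smod B) P' = homlen P P'.
  apply: (@homlen_precomp _ _ _ F2) => // h.
  have [g gP] := FA h I; exists (lcomp g incl) => x.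
  by rewrite lcompE F2P gP.
have F2m (g : {linear smod B -> pw m P'}) : (forall x, g (F2 x) = 0) -> g = 0.
  move=> g0; apply: linear_eqP => y; apply/ffunP => j.
  have gj : lcomp (pw_proj P' j) g = 0.
    by apply: F20 => x; rewrite lcompE g0 linear0.
  rewrite [RHS]ffunE.
  exact: (congr1 (fun u : {linear smod B -> P'} => u y) gj).
have [||r rP] := @precomp_surj _ _ P F2 fP fP _ _ idfun.
- move=> g g0.
  have Fg : lcomp F g = 0 by apply: F2m => x; rewrite lcompE g0 linear0.
  apply: linear_eqP => y; apply: FI; rewrite linear0.
  exact: (congr1 (fun u : {linear smod B -> pw m P'} => u y) Fg).
- by rewrite (E _ fB) // (E _ fP) // e2.
have BE b : B b <-> exists x, F x = b.
  split=> [Bb|[x <-]//]; have [y yb] := incl_ex Bb; exists (r y).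
  pose g : {linear smod B -> pw m P'} := incl - lcomp F r.
  have g0 : g = 0.
    apply: F2m => x; rewrite -[LHS]/(incl (F2 x) - F (r (F2 x))).
    by rewrite rP F2P subrr.
  have := congr1 (fun u : {linear smod B -> pw m P'} => u y) g0.
  by rewrite -[LHS]/(incl y - F (r y)) yb => /eqP; rewrite subr_eq0 => /eqP.
have [|g gP] := ext0_use (eC _ prP) FI (@qpi_surj _ B) _ idfun.
  by move=> x; rewrite -BE; apply: qpi_eq0.
by exists F, g.
Qed.

End HomLength.

(** * Vanishing of extensions by the ring on one side implies it on the other *)

Section Count.
Variable A : pzRingType.
Hypothesis flA : fin_length A^o.
Implicit Types K M N X Y Q P : lmodType A.

Definition exact3 (K X N : lmodType A) (i : {linear K ->
    X}) (p : {linear X -> N}) :=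
  [/\ injective i, surjective p & forall x, p x = 0 <-> exists y, i y = x].

Definition tors_additive (f : lmodType A -> nat) :=
  forall K X N (i : {linear K -> X}) (p : {linear X -> N}), exact3 i p ->
    fin_length X -> torsionless X -> torsionless N -> f X = (f K + f N)%N.

Section TorsAdditive.
Variable f : lmodType A -> nat.
Hypothesis fA : tors_additive f.

Lemma tadd_zero M : (forall x : M, x = 0) -> f M = 0%N.
Proof.
move=> M0; have fM : fin_length M by apply: fl_zero.
have tM : torsionless M by exists 0%N, 0 => x y _; rewrite (M0 x) (M0 y).
have := @fA M M M idfun idfun; move=> /(_ _ fM tM tM) e.
have {}e : f M = (f M + f M)%N.
  by apply: e; split=> [//|x|x]; [exists x | split=> _; [exists x | apply: M0]].
by lia.
Qed.

Lemma tadd_iso M N (g : {linear M -> N}) : injective g -> surjective g ->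
  fin_length M -> torsionless N -> f M = f N.
Proof.
move=> gI gS fM tN; have tM := tors_sub gI tN.
rewrite (@fA (smod (lzero : lsub M)) M N incl g) //.
  by rewrite tadd_zero // => x; apply: incl_inj; rewrite linear0;
      apply: (incl_in x).
split=> // [|x]; first exact: incl_inj.
rewrite -incl_exP; split=> [|->]; last exact: linear0.
exact: ker0_inj.
Qed.

Lemma tadd_pair M N : fin_length M -> fin_length N -> torsionless M ->
    torsionless N ->
  f (M * N)%type = (f M + f N)%N.
Proof.
move=> fM fN tM tN.
apply: (@fA M _ N (@pair_inl A M N) (snd : {linear (M * N)%type -> N})).
- split=> [x y []//|y|[x y] /=]; first by exists (0, y).
  by split=> [->|[z [_ <-]]//]; exists x.
- exact: fl_pair.
- exact: tors_pair.
- exact: tN.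
Qed.

(** The sum of [A] and [U] maps onto [U + A x] with kernel the annihilator of
[x] modulo [U]. *)
Lemma tadd_step X (U : lsub X) x (m : lsub A^o) : fin_length X -> torsionless X ->
  (forall r : A, U (r *: x) <-> m r) ->
  (f (smod (lsum U (lcyclic x))) + f (smod m) = f A^o + f (smod U))%N.
Proof.
move=> fX tX Um; set U1 := lsum U (lcyclic x).
have [tA tU] := (tors_proj (proj_reg A), tors_smod U tX).
rewrite -[RHS]tadd_pair //; last exact: fl_smod.
have inU (y : smod U) : exists z : smod U1, incl z = incl y.
  apply: incl_ex; exists (incl y), 0; rewrite addr0; split=> //.
    exact: incl_in.
  exact: lsub0.
have [u uP] := factor_inj (@incl_inj _ _ U1) inU.
have inx (a : A^o) : exists z : smod U1, incl z = scal x a.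
  apply: incl_ex; exists 0, (scal x a); rewrite add0r; split=> //.
    exact: lsub0.
  by exists a.
have [v vP] := factor_inj (@incl_inj _ _ U1) inx.
have inm (r : smod m) : exists z : smod U, incl z = (- lcomp (scal x) incl) r.
  by apply: incl_ex; apply: lsubN; apply/Um; apply: incl_in.
have [w wP] := factor_inj (@incl_inj _ _ U) inm.
have wP' r : incl (w r) = - ((incl r : A) *: x) by exact: wP.
rewrite addnC; apply/esym; apply: (@fA _ _ _ (pair_map incl w) (copair v u)).
- split=> [r s|y|[a y]].
  + by rewrite !pair_mapE => -[/incl_inj].
  + have [b [_ [Ub [a ->] yE]]] := incl_in y; have [z zb] := incl_ex Ub.
    exists (a, z); apply: incl_inj.
    by rewrite copairE linearD vP uP zb yE addrC.
  + rewrite copairE; split=> [/(congr1 incl)|[r]].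
      rewrite linearD linear0 vP uP scalE => e.
      have [r ra] : exists r : smod m, incl r = a.
        by apply: incl_ex; apply/Um; rewrite -[_ *: _](addrK (incl y)) e sub0r;
          apply/lsubN/incl_in.
      exists r; rewrite pair_mapE ra; congr pair; apply: incl_inj.
      by rewrite wP' ra; apply/eqP; rewrite eq_sym -addr_eq0 addrC e.
    rewrite pair_mapE => -[<- <-]; apply: incl_inj.
    by rewrite linearD linear0 vP uP scalE wP' subrr.
- by apply: fl_pair => //; apply: fl_smod.
- exact: tors_pair.
- exact: tors_smod.
Qed.

End TorsAdditive.

(** [elen e X] is the length of [e X]: for a primitive idempotent it is the
multiplicity of the corresponding simple module, up to a factor. *)
Definition efix (e : A) X (x : X) := e *: x = x.
Definition elen (e : A) X : nat := lenU (@efix e X).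

Lemma elen_opsub (e : A) X : @opsub _ (modop X) (@efix e X).
Proof.
rewrite /efix; split=> [|x y ex ey|z x ex]; first exact: scaler0.
- by rewrite scalerBr ex ey.
- by rewrite -{2}ex /= !scalerA; case: z => z /= ->.
Qed.

Lemma elen_add (e : A) K X N (i : {linear K -> X}) (p : {linear X -> N}) :
  e * e = e -> exact3 i p -> fin_length X -> elen e X = (elen e K + elen e N)%N.
Proof.
move=> ee [iI pS ip] fX; rewrite /elen /lenU.
rewrite (len_split (linear_opmap p) (elen_opsub e X) (finlenT _ fX)).
congr (_ + _)%N.
  rewrite -(img_inj (linear_opmap i) iI (elen_opsub e K)).2; last first.
    by apply: finlenT; apply: fl_inj iI fX.
  congr len; apply: pred_ext => x; split.
    move=> [ex /ip[y yx]]; exists y => //; apply: iI.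
    by rewrite linearZ /= yx.
  by move=> [y ey <-]; split; [rewrite /efix -linearZZ ey | apply/ip; exists y].
congr len; apply: pred_ext => y; split.
  by move=> [x ex <-]; rewrite /efix -linearZZ ex.
have [x <-] := pS y; move=> epx; exists (e *: x).
  by rewrite /efix scalerA ee.
by rewrite linearZ /= epx.
Qed.

Lemma elen_gt0 (e : A) X (x : X) : fin_length X -> e *: x = x -> x <> 0 ->
    (0 < elen e X)%N.
Proof.
move=> fX ex x0; apply: chain_len; first exact: finlenT.
exists (fun x => x = 0); split=> //.
- exact: (lsub_opsub (lzero : lsub X)).
- by move=> _ ->; rewrite /efix scaler0.
- by exists x.
Qed.

Lemma exact_quotm M (U : lsub M) : exact3 (@incl A M U) (qpi U).
Proof. by split; [apply: incl_inj | apply: qpi_surj | apply: qpi_exact]. Qed.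

Section Matrix.
Hypothesis cT : closed_are_ext A.
Variables (n : nat) (m : nat -> lsub A^o) (e : nat -> A).
Hypothesis S : simples n m e.
Hypothesis complete : forall m', max_left_ideal m' -> exists i, (i < n)%N /\
    exists a : A, forall r, m' (r * a) <-> m i r.

(** The projective cover of the [i]-th simple module. *)
Definition pim (i : nat) : lmodType A := smod (lcyclic (e i : A^o)).

Lemma pim_retr i : (i < n)%N -> retract (pim i) A^o.
Proof.
move=> lin; have ei (a : A^o) : exists x : pim i, incl x = scal (e i : A^o) a.
  by apply: incl_ex; exists a.
have [r rP] := factor_inj (@incl_inj _ _ (lcyclic (e i : A^o))) ei.
exists incl, r => x; apply: incl_inj; rewrite rP scalE.
have [a ->] := incl_in x.
by rewrite -[LHS]/(a * e i * e i) -mulrA (simples_idem S).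
Qed.

Lemma proj_pim i : (i < n)%N -> proj (pim i).
Proof. by move=> lin; apply: proj_retr (pim_retr lin) (proj_reg A). Qed.

Lemma fl_pim i : (i < n)%N -> fin_length (pim i).
Proof. by move=> lin; apply: proj_fl (proj_pim lin). Qed.

Lemma pim_tadd i : (i < n)%N -> tors_additive (fun X => homlen X (pim i)).
Proof.
move=> lin K X N j p [jI pS jp] fX tX tN.
apply: (homlen_exact jI pS jp) => //; first exact: fl_pim.
apply: ext0_proj; first exact: proj_pim.
by apply: torsionless_ext0 => //; apply: fl_surj pS fX.
Qed.

Lemma elen_tadd i : (i < n)%N -> tors_additive (elen (e i)).
Proof.
by move=> lin K X N j p ex fX _ _; apply: elen_add ex fX; apply: (simples_idem S).
Qed.

Lemma elen_simple i j : (i < n)%N -> (j < n)%N -> i <> j ->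
  elen (e i) (quotm (m j)) = 0%N.
Proof.
move=> lin ljn ij; apply: (@len_zero _ (modop _) _ _).2 => x.
rewrite /efix -(qpiK x) -qpiZ => <-; apply/qpi_eq0.
by apply: (simples_other S).
Qed.

Lemma ex_elen_gt0 X (x : X) : fin_length X -> x <> 0 ->
  exists i, (i < n)%N /\ (0 < elen (e i) X)%N.
Proof.
move=> fX x0; have [|y [y0 My]] := @ex_simple _ X lzero fX; first by exists x.
have [i [lin [a aP]]] := complete My; exists i; split=> //.
apply: (@elen_gt0 _ _ (e i *: (a *: y)) fX).
  by rewrite /efix scalerA (simples_idem S).
by move=> e0; apply: (simples_self S lin); apply/aP; rewrite /= -scalerA.
Qed.

Lemma elen_self i : (i < n)%N -> (0 < elen (e i) (quotm (m i)))%N.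
Proof.
move=> lin; apply: (@elen_gt0 _ _ (qpi (m i) (e i))).
- exact: fl_quotm.
- by rewrite /efix -qpiZ; congr qpi; apply: (simples_idem S).
- by move/qpi_eq0; apply: (simples_self S).
Qed.

(** The Euler form of the [i]-th simple module and [pim j], up to a factor, as
read off from the presentation of the simple module by [m i]. *)
Definition coef (i j : nat) : rat :=
  ((homlen A^o (pim j))%:R - (homlen (smod (m i)) (pim j))%:R) /
  (elen (e i) (quotm (m i)))%:R.

(** When a simple module is added on top of [X], the length of the maps to
[pim j] and the multiplicity of that simple module jump by amounts that depend
on the simple module only. *)
Lemma coef_ok X : fin_length X -> torsionless X -> forall j, (j < n)%N ->
  (homlen X (pim j))%:R = \sum_(i < n) (elen (e i) X)%:R * coef i j :> rat.
Proof.
move=> fX tX.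
pose good Y := forall j, (j < n)%N ->
  (homlen Y (pim j))%:R = \sum_(i < n) (elen (e i) Y)%:R * coef i j :> rat.
have good0 : good (smod (lzero : lsub X)).
  have z (x : smod (lzero : lsub X)) : x = 0.
    by apply: incl_inj; rewrite linear0; apply: (incl_in x).
  move=> j ljn; rewrite (tadd_zero (pim_tadd ljn)) // big1 // => i _.
  by rewrite (tadd_zero (elen_tadd (ltn_ord i))) // mul0r.
have [U gU Umax] := ex_max_lsub fX
  (ex_intro (fun U : lsub X => good (smod U)) _ good0).
have full x : U x.
  apply: contrapT => nUx; have [|y [nUy My]] := ex_simple (U := U) fX.
    by exists x.
  have [l [lln [a aP]]] := complete My.
  have Um r : U (r *: (a *: y)) <-> m l r by rewrite scalerA -aP.
  have nUay : ~ U (a *: y).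
    rewrite -(scale1r (a *: y)) Um; apply: (simples_max S lln).1.
  apply: nUay; apply: (Umax (lsum U (lcyclic (a *: y)))); last first.
  - exists 0, (a *: y); rewrite add0r; split=> //; first exact: lsub0.
    by exists 1; rewrite scale1r.
  - by move=> z Uz; exists z, 0; rewrite addr0; split=> //; exists 0;
      rewrite scale0r.
  move=> j ljn; set U1 := lsum _ _.
  have hs := tadd_step (pim_tadd ljn) fX tX Um.
  have es i : (i < n)%N ->
    (elen (e i) (smod U1) = elen (e i) (smod U) + elen (e i) (quotm (m l)))%N.
    move=> lin; have := tadd_step (elen_tadd lin) fX tX Um.
    rewrite (elen_add (simples_idem S lin) (exact_quotm (m l)) flA).
    by rewrite /reverse_coercion -/U1; lia.
  have -> : (homlen (smod U1) (pim j))%:R = (homlen (smod U) (pim j))%:R +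
      ((homlen A^o (pim j))%:R - (homlen (smod (m l)) (pim j))%:R) :> rat.
    move/(congr1 (fun k : nat => k%:R : rat)): hs; rewrite !natrD -/U1 => hs.
    by apply/eqP; rewrite addrA [_ + _%:R]addrC -hs addrK.
  rewrite (gU j ljn).
  under [RHS]eq_bigr do rewrite es // natrD mulrDl.
  rewrite big_split /=; congr (_ + _); rewrite (bigD1 (Ordinal lln)) //=.
  rewrite big1 ?addr0 => [|i il]; last first.
    rewrite elen_simple ?mul0r // => ie; move/eqP: il; apply; exact: val_inj.
  rewrite /coef mulrC divfK // pnatr_eq0 -lt0n; exact: elen_self.
have inclS : surjective (@incl A X U) by move=> x; apply: incl_ex.
have fU : fin_length (smod U) by apply: fl_smod.
move=> j ljn.
rewrite -(tadd_iso (pim_tadd ljn) (@incl_inj _ _ U) inclS fU tX) gU //.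
apply: eq_bigr => i _; congr (_%:R * _).
exact: (tadd_iso (elen_tadd (ltn_ord i)) (@incl_inj _ _ U) inclS fU tX).
Qed.

Fixpoint psum (s : seq 'I_n) : lmodType A :=
  if s is j :: s' then (pim j * psum s')%type else free A 0.

Lemma proj_psum s : proj (psum s).
Proof.
elim: s => [|j s IH] /=; first exact: proj_free.
by apply: proj_pair => //; apply: proj_pim.
Qed.

Lemma homlen_psum X s : fin_length X ->
    homlen X (psum s) = (\sum_(j <- s) homlen X (pim j))%N.
Proof.
move=> fX; elim: s => [|j s IH] /=.
  rewrite big_nil; apply: (@len_zero _ (homop _ _) _ _).2 => f _.
  by apply: linear_eqP => x; apply/ffunP => -[].
rewrite big_cons -IH; apply: homlen_pair => //; first exact: fl_pim.
exact: proj_fl (proj_psum s).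
Qed.

Lemma pim_psum (j : 'I_n) s : j \in s -> retract (pim j) (psum s).
Proof.
elim: s => // i s IH; rewrite inE => /orP[/eqP->|/IH ret] /=.
  by exists (@pair_inl A _ _), (fst : {linear (pim i * psum s)%type -> pim i}).
apply: retr_trans ret _.
by exists (@pair_inr A _ _), (snd : {linear (pim i * psum s)%type -> psum s}).
Qed.

Lemma psum_ideal s (j : 'I_n) (f : {linear psum s -> A^o}) : j \notin s ->
  forall x, m j (f x).
Proof.
elim: s f => [|i s IH] f.
  move=> _ x; rewrite (_ : x = 0) ?linear0; first exact: lsub0.
  by apply/ffunP => -[].
rewrite inE negb_or => /andP[ji js] [x y].
have -> : (x, y) = @pair_inl A (pim i) (psum s) x + @pair_inr A (pim i) (psum s) y.
  by apply: injective_projections; rewrite /= ?addr0 ?add0r.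
rewrite linearD; apply: lsubD; last first.
  exact: (IH (lcomp f (@pair_inr A (pim i) (psum s))) js).
have [g gE] : exists g : pim i, incl g = e i.
  by apply: incl_ex; exists 1; rewrite scale1r.
have -> : x = (incl x : A) *: g :> pim i.
  apply: incl_inj; rewrite linearZZ gE; have [a ->] := incl_in x.
  by rewrite -[RHS]/(a * e i * e i) -mulrA (simples_idem S).
have -> : g = e i *: g :> pim i.
  apply: incl_inj; rewrite linearZZ gE -[RHS]/(e i * e i).
  by rewrite (simples_idem S).
rewrite !linearZ /=; apply: lsubZ; apply: (simples_other S) => //.
by move=> ij; case/eqP: ji; apply: val_inj.
Qed.

Lemma psum_not_retr s t (j : 'I_n) k : j \in s -> j \notin t ->
  ~ retract (psum s) (pw k (psum t)).
Proof.
move=> js jt ret; have [i [r ir]] := retr_trans (pim_psum js) ret.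
have [g gE] : exists g : pim j, incl g = e j.
  by apply: incl_ex; exists 1; rewrite scale1r.
apply: (simples_self S (ltn_ord j)); rewrite -gE -[g]ir.
rewrite (pw_sum (i g)) !linear_sum.
apply: (big_ind (m j)) => [|x y|l _]; [exact: lsub0 | exact: lsubD |].
exact: (psum_ideal (lcomp incl (lcomp r (pw_inj _ l))) jt).
Qed.

Definition mseq (p : 'I_n -> nat) : seq 'I_n :=
  flatten [seq nseq (p j) j | j <- enum 'I_n].

Lemma mem_mseq p j : (j \in mseq p) = (0 < p j)%N.
Proof.
apply/flatten_mapP/idP => [[i _]|pj].
  by rewrite mem_nseq => /andP[+ /eqP->].
by exists j; rewrite ?mem_enum // mem_nseq pj eqxx.
Qed.

Lemma sum_mseq p (F : 'I_n -> nat) : (\sum_(j <- mseq p) F j = \sum_j p j * F j)%N.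
Proof.
rewrite big_flatten big_map big_enum; apply: eq_bigr => j _.
by rewrite big_nseq iter_addn_0 mulnC.
Qed.

(** If the square matrix is singular, a vector in its kernel on the other side
splits into positive and negative parts; these are two projectives without
common summand to which all torsionless modules have equally many maps, against
cancellation. *)
Lemma coef_unit (z : 'rV[rat]_n) : z *m (\matrix_(i < n,
    j < n) coef i j) = 0 -> z = 0.
Proof.
move=> zb; apply/eqP; apply: contrapT => /negP z0.
have : \det (\matrix_(i < n, j < n) coef i j) == 0 by apply/det0P; exists z.
rewrite -det_tr => /det0P[v v0 vb].
(* Clear denominators. *)
pose w j := numq (v 0 j) * \prod_(l | l != j) denq (v 0 l).
have wE j : (w j)%:~R = (\prod_l denq (v 0 l))%:~R * v 0 j.
  have d0 : (denq (v 0 j))%:~R != 0 :> rat by rewrite intr_eq0 denq_neq0.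
  have dv : (denq (v 0 j))%:~R * v 0 j = (numq (v 0 j))%:~R.
    by rewrite -[X in _ * X]divq_num_den mulrC divfK.
  by rewrite (bigD1 j) //= /w !rmorphM /= -dv mulrAC.
have D0 : (\prod_l denq (v 0 l))%:~R != 0 :> rat.
  by rewrite intr_eq0; apply/prodf_neq0 => l _; apply: denq_neq0.
have wb (i : 'I_n) : \sum_j (w j)%:~R * coef i j = 0.
  under eq_bigr do rewrite wE -mulrA.
  rewrite -mulr_sumr; have := congr1 (fun M : 'rV_n => M 0 i) vb.
  rewrite !mxE => vbi; rewrite (_ : \sum_j _ = 0) ?mulr0 // -[RHS]vbi.
  by apply: eq_bigr => j _; rewrite !mxE.
pose p j := if 0 <= w j then `|w j|%N else 0%N.
pose q j := if 0 <= w j then 0%N else `|w j|%N.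
have wpq j : (w j)%:~R = (p j)%:R - (q j)%:R :> rat.
  rewrite /p /q; case: ifP => wj; rewrite ?subr0 ?sub0r.
    by rewrite -[in LHS](gez0_abs wj).
  have le : w j <= 0 by apply: Order.POrderTheory.ltW;
      rewrite Order.TotalTheory.ltNge wj.
  by rewrite -[in LHS](opprK (w j)) -(lez0_abs le) rmorphN.
have E X : fin_length X -> torsionless X ->
    homlen X (psum (mseq p)) = homlen X (psum (mseq q)).
  move=> fX tX; rewrite !homlen_psum // !sum_mseq.
  apply/eqP; rewrite -(eqr_nat rat) -subr_eq0 !natr_sum -sumrB; apply/eqP.
  transitivity (\sum_(i < n) \sum_(j < n) (elen (e i) X)%:R * ((w j)%:~R * coef
      i j)).
    rewrite exchange_big; apply: eq_bigr => j _ /=.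
    rewrite !natrM -mulrBl -wpq coef_ok // mulr_sumr.
    by apply: eq_bigr => i _; rewrite mulrCA.
  by rewrite big1 // => i _; rewrite -mulr_sumr wb mulr0.
have [j vj] : exists j, v 0 j != 0.
  apply: contrapT => nv; move/eqP: v0; apply; apply/rowP => j; rewrite mxE.
  by apply: contrapT => /eqP vj; apply: nv; exists j.
have wj : w j != 0 by rewrite -(intr_eq0 rat) wE mulf_neq0.
have [k ret] := retract_of_homlen flA cT (proj_psum _) (proj_psum _) E.
have [k' ret'] := retract_of_homlen flA cT (proj_psum _) (proj_psum _)
  (fun X fX tX => esym (E X fX tX)).
have [wj0|wj0] := boolP (0 <= w j).
  by apply: (@psum_not_retr _ _ j k _ _ ret); rewrite mem_mseq /p /q wj0; lia.
by apply: (@psum_not_retr _ _ j k' _ _ ret');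
    rewrite mem_mseq /p /q (negPf wj0); lia.
Qed.

End Matrix.

(** The difference between the closure of [K] and [K] has no maps and no
extensions to projectives, so its dimension vector is killed by the square
matrix [coef]; that matrix is invertible by cancellation. *)
Lemma closed_are_ext_ext_are_closed : closed_are_ext A -> ext_are_closed A.
Proof.
move=> cT; have [n [m [e [S complete]]]] := ex_simples flA.
move=> N K eK.
have K1ok : submod_ok (fun x => forall h : {linear free A N -> A^o},
    (forall y, K y -> h y = 0) -> h x = 0).
  split=> [h _|a x y Bx By h h0]; first exact: linear0.
  by rewrite linearP Bx // By // scaler0 addr0.
pose K1 := Lsub K1ok; have KK1 x : K x -> K1 x by move=> Kx h; apply.
have [j jP] := factor_inj (@incl_inj _ _ K1)
  (fun x : smod K => incl_ex (KK1 _ (incl_in x))).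
have fF := fl_free flA N; have tF := tors_free A N.
have [fK fK1] : fin_length (smod K) /\ fin_length (smod K1) by split;
    apply: fl_smod.
have [tK tK1] : torsionless (smod K) /\ torsionless (smod K1) by split;
    apply: tors_smod.
have jI : injective j by move=> x y /(congr1 incl); rewrite !jP => /incl_inj.
have ext1 (g : {linear smod K1 -> A^o}) : (forall x, g (j x) = 0) -> g = 0.
  move=> g0; apply: linear_eqP => y.
  have cK1 : closed_in K1.
    by move=> x hx h h0; apply: hx => z; apply.
  have [h hP] := cT N K1 cK1 g.
  rewrite -hP; apply: (incl_in y) => x /incl_ex[z <-].
  by rewrite -(g0 z) -hP jP.
have hE i : (i < n)%N -> homlen (smod K1) (pim e i) = homlen (smod K) (pim e i).
  move=> lin; have [s [r sr]] := pim_retr S lin.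
  apply: (@homlen_precomp _ _ _ _ j) => //; first exact: (fl_pim S lin).
    move=> g g0; have sg : lcomp s g = 0.
      by apply: ext1 => x; rewrite lcompE g0 linear0.
    apply: linear_eqP => y; apply: (can_inj sr); rewrite linear0.
    exact: (congr1 (fun u : {linear smod K1 -> A^o} => u y) sg).
  move=> h; have [g gP] := eK (lcomp s h).
  by exists (lcomp r (lcomp g incl)) => x; rewrite !lcompE jP gP lcompE sr.
pose W := limg j lall.
have ex3 : exact3 j (qpi W).
  split=> //; first exact: qpi_surj.
  move=> x; rewrite (qpi_eq0 W x); split=> [[y _ yx]|[y yx]]; by exists y.
have zE i : (i < n)%N ->
  (elen (e i) (smod K1) = elen (e i) (smod K) + elen (e i) (quotm W))%N.
  by move=> lin; apply: elen_add ex3 fK1; apply: (simples_idem S).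
have z0 : (\row_(i < n) (elen (e i) (quotm W))%:R : 'rV[rat]_n) = 0.
  apply: (coef_unit cT S complete); apply/rowP => l; rewrite !mxE.
  transitivity ((homlen (smod K1) (pim e l))%:R - (homlen (smod K) (pim e
      l))%:R : rat);
    last by rewrite hE // subrr.
  rewrite !(coef_ok cT S complete) // -sumrB.
  by apply: eq_bigr => i _; rewrite !mxE zE // natrD -mulrBl addrC addKr.
move=> x K1x; have [y yx] := @incl_ex _ _ K1 x K1x.
have [z _ zy] : W y.
  apply/qpi_eq0; apply: contrapT => y0.
  have [i [lin]] := ex_elen_gt0 S complete (fl_quotm W fK1) y0.
  have := congr1 (fun M : 'rV_n => M 0 (Ordinal lin)) z0; rewrite !mxE.
  by move=> /eqP; rewrite pnatr_eq0 => /eqP /= ->.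
by rewrite -yx -zy jP; apply: incl_in.
Qed.

End Count.

(** * Gorenstein projective modules *)

Section Gprj.
Variable A : pzRingType.
Implicit Types M N X Y Q P : lmodType A.

Lemma gprj_tors (M : fgModType A) : gorenstein_projective M -> torsionless M.
Proof.
move=> [C [pC _ _ [i [f [fI _]]]]].
by apply: tors_sub fI (tors_proj _); apply/projectiveP.
Qed.

(** Pulled back along the complex, a map from the kernel of [p] to the ring
becomes a cocycle, and acyclicity of the dual complex extends it. *)
Lemma gprj_ext0 (M : fgModType A) : gorenstein_projective M -> ext0 M A^o.
Proof.
move=> [C [pC aC hC [i [f [fI fex]]]]].
have [j ij] : exists j, i = j + 1 + 1 + 1 by exists (i - 1 - 1 - 1); rewrite !subrK.
subst i.
have [p pP] : exists p : {linear C (j + 1 + 1) ->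
    M}, forall x, f (p x) = cx_d C _ x.
  by apply: factor_inj fI _ => x; apply/fex/aC; exists x.
have pS : surjective p.
  move=> y; have [x xy] : exists x, cx_d C (j + 1 + 1) x = f y.
    by apply/aC/fex; exists y.
  by exists x; apply: fI; rewrite pP.
have kp x : p x = 0 <-> exists y, cx_d C (j + 1) y = x.
  split=> [px|]; first by apply/aC; rewrite -pP px linear0.
  by move/aC => dx; apply: fI; rewrite pP dx linear0.
apply: (ext0_of ((projectiveP _).1 (pC _)) pS) => h.
have [u uP] : exists u : {linear C (j + 1) -> smod (lker p)},
    forall x, incl (u x) = cx_d C (j + 1) x.
  by apply: factor_inj (@incl_inj _ _ _) _ => x; apply: incl_ex; apply/kp; exists x.
have pR : projective (regular A) by apply/projectiveP/proj_reg.
have [g gP] : exists g : {linear C (j + 1 + 1) -> regular A},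
    lcomp g (cx_d C (j + 1)) = lcomp h u.
  apply/(hC _ pR j); apply: linear_eqP => x; rewrite !lcompE.
  rewrite (_ : u _ = 0) ?linear0 //; apply: incl_inj; rewrite uP linear0.
  by apply/aC; exists x.
exists g => y; have /kp[c cy] := lker_in y.
have := congr1 (fun u : {linear _ -> _} => u c) gP; rewrite !lcompE cy => ->.
by congr (h _); apply: incl_inj; rewrite uP.
Qed.

Section Construction.
Hypothesis flA : fin_length A^o.
Hypotheses (cT : closed_are_ext A) (cU : ext_are_closed A).

(** The images of the differentials embed in projectives, so the next image has
no extensions by projectives and maps on the present one extend. *)
Lemma acyclic_hom (C : precomplex A) (Q : fgModType A) :
  (forall i, projective (C i)) -> acyclic C -> projective Q -> hom_acyclic C Q.
Proof.
move=> pC aC pQ i u; split=> [ud|[v <-]]; last first.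
  apply: linear_eqP => x; rewrite !lcompE (_ : cx_d C (i + 1) _ = 0) ?linear0 //.
  by apply/aC; exists x.
pose d1 := cx_d C (i + 1); pose d2 := cx_d C (i + 1 + 1).
pose I1 := limg d1 lall; pose I2 := limg d2 lall.
have [p1 p1P] := factor_inj (@incl_inj _ _ I1)
  (fun x => incl_ex (ex_intro2 _ _ x I (erefl (d1 x)) : I1 (d1 x))).
have [p2 p2P] := factor_inj (@incl_inj _ _ I2)
  (fun x => incl_ex (ex_intro2 _ _ x I (erefl (d2 x)) : I2 (d2 x))).
have p1S : surjective p1.
  move=> y; have [x _ xy] := incl_in y; exists x; apply: incl_inj.
  by rewrite p1P.
have p2S : surjective p2.
  move=> y; have [x _ xy] := incl_in y; exists x; apply: incl_inj.
  by rewrite p2P.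
have [h hP] : exists h : {linear smod I1 -> Q}, forall x, h (p1 x) = u x.
  apply: factor_surj p1S _ => x p1x; have [y <-] : exists y, cx_d C i y = x.
    by apply/aC; rewrite -[LHS]p1P p1x linear0.
  exact: (congr1 (fun u : {linear _ -> _} => u y) ud).
have tI2 : torsionless (smod I2).
  by apply: tors_smod; apply: tors_proj; apply/projectiveP.
have fI2 : fin_length (smod I2) by apply: fl_smod; apply: fg_fl => //;
    apply: fg_fin_gen.
have e : ext0 (smod I2) Q.
  by apply: ext0_proj; [apply/projectiveP | apply: torsionless_ext0].
have [|g gP] := ext0_use e (@incl_inj _ _ I1) p2S _ h.
  move=> x; split=> [p2x|[y <-]].
    have [y yx] : exists y, d1 y = x by apply/aC; rewrite -[LHS]p2P p2x linear0.
    by exists (p1 y); rewrite p1P.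
  have [x' <-] := p1S y; apply: incl_inj; rewrite p2P p1P linear0.
  by apply/aC; exists x'.
by exists g; apply: linear_eqP => x; rewrite lcompE -hP -gP p1P.
Qed.

(** A torsionless module embeds in a free module so that its functionals
extend: take the coordinates to generate all functionals. *)
Lemma tors_embed X : fin_length X -> torsionless X ->
  exists m (F : {linear X -> free A m}),
  [/\ injective F, ext_in (limg F lall)
    & forall g : {linear X -> A^o},
        exists h : {linear free A m -> A^o}, forall x, h (F x) = g x].
Proof.
move=> fX tX; have [m [F [_ FA]]] := approx fX flA (opsubT _).
exists m, F; split=> [|h|g]; last exact: FA.
  apply: inj_ker0 => x Fx; apply: (tors_sep tX) => h.
  by have [g <-] := FA h I; rewrite Fx linear0.
have [p pP] := factor_inj (@incl_inj _ _ (limg F lall))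
  (fun x => incl_ex (ex_intro2 _ _ x I (erefl (F x)) : limg F lall (F x))).
have [g gP] := FA (lcomp h p) I; exists g => y; have [x _ xy] := incl_in y.
by rewrite -xy gP lcompE; congr (h _); apply: incl_inj; rewrite pP.
Qed.

(** The coordinates of the next map generate the functionals vanishing on the
image of [f]; by [ext_are_closed] they cut out that image and nothing more. *)
Lemma coresolve_step X n (f : {linear X -> free A n}) : ext_in (limg f lall) ->
  exists m (g : {linear free A n -> free A m}),
    exact_at f g /\ ext_in (limg g lall).
Proof.
move=> ef; pose U (h : homop (free A n) A^o) := forall x, h (f x) = 0.
have sU : opsub U.
  split=> [x|h h' Uh Uh' x|z h Uh x] //.
    by rewrite -[LHS]/(h (f x) - h' (f x)) Uh Uh' subrr.
  by rewrite mk_linearE Uh scaler0.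
have [m [g [gU gA]]] := approx (fl_free flA n) flA sU.
have gf x : g (f x) = 0.
  by apply/ffunP => i; rewrite ffunE; apply: (gU i x).
exists m, g; split.
  move=> y; split=> [gy|[x <-]]; last exact: gf.
  suff [x _ xy] : limg f lall y by exists x.
  apply: (cU ef) => h hf; have [h' <-] : exists h' : {linear free A m -> A^o},
      forall x, h' (g x) = h x.
    by apply: gA => x; apply: hf; exists x.
  by rewrite gy linear0.
move=> h; have [p pP] := factor_inj (@incl_inj _ _ (limg g lall))
  (fun x => incl_ex (ex_intro2 _ _ x I (erefl (g x)) : limg g lall (g x))).
have [|h' h'P] := gA (lcomp h p).
  by move=> x; rewrite lcompE (_ : p _ = 0) ?linear0 //; apply: incl_inj;
      rewrite pP gf linear0.
exists h' => y; have [x _ xy] := incl_in y.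
rewrite -xy h'P lcompE; congr (h _); apply: incl_inj.
by rewrite pP.
Qed.

Lemma resolve_step n X (f : {linear free A n -> X}) :
  exists m (g : {linear free A m -> free A n}), exact_at g f.
Proof.
have /fin_genP[m [p pS]] := fl_fg (fl_smod (lker f) (fl_free flA n)).
exists m, (lcomp incl p) => x; split=> [fx|[y <-]]; last exact: lker_in.
by have [y yx] := @incl_ex _ _ (lker f) x fx; have [z zy] := pS y; exists z;
    rewrite lcompE zy.
Qed.

Record rightmap n := RightMap {
  rm_cod : nat;
  rm_map : {linear free A n -> free A rm_cod};
  rm_ext : ext_in (limg rm_map lall) }.

Record leftmap n := LeftMap {
  lm_dom : nat;
  lm_map : {linear free A lm_dom -> free A n} }.

(** Over such a ring a two-sided exact complex of free modules through [M] is
all that is needed, since it stays exact under maps to projectives. *)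
Lemma tors_gprj (M : fgModType A) : torsionless M -> gorenstein_projective M.
Proof.
move=> tM; have fM := fg_fl flA (fg_fin_gen M).
have [m [F [FI eF _]]] := tors_embed fM tM.
have [n [p pS]] := (fin_genP M).1 (fg_fin_gen M).
have rstep k (u : rightmap k) : exists v : rightmap (rm_cod u),
    exact_at (rm_map u) (rm_map v).
  by have [c [g [ug eg]]] := coresolve_step (@rm_ext _ u); exists (RightMap eg).
have [g1 Fg1] : exists g1 : rightmap m, exact_at F (rm_map g1).
  by have [c [g [ug eg]]] := coresolve_step eF; exists (RightMap eg).
pose R k : {j & rightmap j} := iter k (fun t => existT _ (rm_cod (projT2 t))
  (sval (cid (rstep _ (projT2 t))))) (existT _ m g1).
have RP k : exact_at (rm_map (projT2 (R k))) (rm_map (projT2 (R k.+1))).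
  exact: (svalP (cid (rstep _ (projT2 (R k))))).
have lstep k (u : leftmap k) : exists v : leftmap (lm_dom u),
    exact_at (lm_map v) (lm_map u).
  by have [c [g ug]] := resolve_step (lm_map u); exists (LeftMap g).
pose L k : {j & leftmap j} := iter k (fun t => existT _ (lm_dom (projT2 t))
  (sval (cid (lstep _ (projT2 t))))) (existT _ m (LeftMap (lcomp F p))).
have LP k : exact_at (lm_map (projT2 (L k.+1))) (lm_map (projT2 (L k))).
  exact: (svalP (cid (lstep _ (projT2 (L k))))).
pose sz (i : int) : nat := match i with
  | Posz k => projT1 (R k) | Negz k => lm_dom (projT2 (L k)) end.
(* The differentials at [i], with values in a rank computed from [i]. *)
pose can (i : int) :
    {j : int & (((i + 1)%R = j) * {linear free A (sz i) -> free A (sz j)})%type} :=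
  match i return
    {j : int & (((i + 1)%R = j) * {linear free A (sz i) ->
        free A (sz j)})%type} with
  | Posz k => existT _ (Posz k.+1) (congr1 Posz (addn1 k), rm_map (projT2 (R k)))
  | Negz 0 => existT _ (Posz 0) (erefl, lm_map (projT2 (L 0)))
  | Negz k.+1 => existT _ (Negz k) (congr1 Negz (subn0 k), lm_map (projT2 (L k.+1)))
  end.
(* The casts to rank [sz (i + 1)] are removed by elimination of equalities. *)
pose D i : {linear free A (sz i) -> free A (sz (i + 1))} :=
  let: existT j (e, f) := can i in
  eq_rect_r (fun l => {linear free A (sz i) -> free A (sz l)}) f e.
have DP i j e f l e' g : can i = existT _ j (e, f) -> can j = existT _ l (e', g) ->
    exact_at f g -> exact_at (D i) (D (i + 1)).
  move=> ci; case: _ / e f ci l e' g => f ci l e'; case: _ / e' => g cj fg.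
  by rewrite /D ci cj.
have D1 i j e f N (g : {linear N -> free A (sz i)}) :
    can i = existT _ j (e, f) -> exact_at g f -> exact_at g (D i).
  by move=> ci; case: _ / e f ci => f ci gf; rewrite /D ci.
have exD i : exact_at (D i) (D (i + 1)).
  case: i => [k|[|k]].
  - exact: (DP (Posz k) _ _ _ _ _ _ erefl erefl (RP k)).
  - apply: (DP (Negz 0) _ _ _ _ _ _ erefl erefl) => y.
    split=> [/Fg1[x <-]|[x <-]]; last by apply/Fg1; exists (p x).
    by have [z <-] := pS x; exists z.
  - case: k => [|k].
      exact: (DP (Negz 1) _ _ _ _ _ _ erefl erefl (LP 0%N)).
    exact: (DP (Negz k.+2) _ _ _ _ _ _ erefl erefl (LP k.+1)).
pose C := @PreComplex A (fun i => free_fg A (sz i)) D.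
have pC i : projective (C i) by apply/projectiveP/proj_free.
exists C; split=> //.
- by move=> Q pQ; apply: acyclic_hom.
- exists (0 : int), F; split=> //.
  exact: (D1 (Posz 0) _ _ _ _ _ erefl Fg1).
Qed.

End Construction.
End Gprj.

(** * Semisimple functor categories and von Neumann regularity *)

Section QuotientFunctor.
Variables (C : preAddCat) (F : contraFunctor C) (S : forall X : C, F X -> Prop).
Hypothesis S0 : forall X, S (0 : F X).
Hypothesis SB : forall X (x y : F X), S x -> S y -> S (x - y).
Hypothesis Smap : forall X Y (f : cat_hom X Y) x, S x -> S (fun_map F f x).

Definition qf_pred X : {pred F X} := [pred x | `[< S x >]].

Fact qf_closed X : zmod_closed (@qf_pred X).
Proof.
split=> [|x y]; first by apply/asboolP.
by move=> /asboolP Sx /asboolP Sy; apply/asboolP; apply: SB.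
Qed.

HB.instance Definition _ X :=
  GRing.isZmodClosed.Build (F X) (@qf_pred X) (@qf_closed X).

Definition qf_ob X : zmodType := Quotient.quot (@qf_pred X : zmodClosed (F X)).
Definition qf_pi X (x : F X) : qf_ob X := \pi x.

Lemma qf_piE X (x y : F X) : qf_pi x = qf_pi y <-> S (x - y).
Proof.
rewrite -(asboolE (S _)); split=> [/eqP|h]; [|apply/eqP];
  by rewrite /qf_pi -Quotient.idealrBE.
Qed.

Lemma qf_piB X : zmod_morphism (@qf_pi X).
Proof. by move=> x y; rewrite /qf_pi !piE. Qed.
HB.instance Definition _ X :=
  GRing.isZmodMorphism.Build (F X) (qf_ob X) (@qf_pi X) (@qf_piB X).

Lemma qf_piK X (x : qf_ob X) : qf_pi (repr x) = x. Proof. exact: reprK. Qed.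

Lemma qf_pi0 X (x : F X) : qf_pi x = 0 <-> S x.
Proof. by rewrite -[X in S X]subr0 -qf_piE raddf0. Qed.

Definition qf_map X Y (f : cat_hom X Y) (x : qf_ob Y) : qf_ob X :=
  qf_pi (fun_map F f (repr x)).

Lemma qf_mapE X Y (f : cat_hom X Y) x : qf_map f (qf_pi x) = qf_pi (fun_map F f x).
Proof. by apply/qf_piE; rewrite -raddfB; apply: Smap; apply/qf_piE/qf_piK. Qed.

Fact qf_map_morph X Y (f : cat_hom X Y) : zmod_morphism (qf_map f).
Proof.
by move=> x y; rewrite -(qf_piK x) -(qf_piK y) -raddfB !qf_mapE !raddfB.
Qed.
HB.instance Definition _ X Y (f : cat_hom X Y) :=
  GRing.isZmodMorphism.Build (qf_ob Y) (qf_ob X) (qf_map f) (qf_map_morph f).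

Fact qf_map1 X x : qf_map (cat_id X) x = x.
Proof. by rewrite -(qf_piK x) qf_mapE fun_map1. Qed.
Fact qf_mapM X Y Z (g : cat_hom Y Z) (f : cat_hom X Y) x :
  qf_map (cat_comp g f) x = qf_map f (qf_map g x).
Proof. by rewrite -(qf_piK x) !qf_mapE fun_mapM. Qed.
Fact qf_mapD X Y (f g : cat_hom X Y) x : qf_map (f + g) x = qf_map f x + qf_map g x.
Proof. by rewrite -(qf_piK x) !qf_mapE fun_mapD raddfD. Qed.

Definition quot_functor : contraFunctor C :=
  @ContraFunctor C qf_ob (fun X Y f => qf_map f) qf_map1 qf_mapM qf_mapD.

Definition quot_trans : natTrans F quot_functor :=
  @NatTrans C F quot_functor (fun X => @qf_pi X)
    (fun X Y f x => esym (qf_mapE f x)).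

End QuotientFunctor.

Section Regular.
Variable C : preAddCat.

Definition regular_map X Y (f : @cat_hom C X Y) :=
  exists g : cat_hom Y X, cat_comp (cat_comp f g) f = f.

Definition regular_cat := forall X Y (f : @cat_hom C X Y), regular_map f.

Lemma comp0l X Y Z (f : @cat_hom C X Y) : cat_comp (0 : cat_hom Y Z) f = 0.
Proof. by apply: (addrI (cat_comp 0 f)); rewrite -cat_compDl !addr0. Qed.
Lemma comp0r X Y Z (f : @cat_hom C Y Z) : cat_comp f (0 : cat_hom X Y) = 0.
Proof. by apply: (addrI (cat_comp f 0)); rewrite -cat_compDr !addr0. Qed.
Lemma compBl X Y Z (f g : @cat_hom C Y Z) (h : cat_hom X Y) :
  cat_comp (f - g) h = cat_comp f h - cat_comp g h.
Proof. by apply: (addIr (cat_comp g h)); rewrite -cat_compDl !subrK. Qed.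
Lemma compBr X Y Z (h : @cat_hom C Y Z) (f g : cat_hom X Y) :
  cat_comp h (f - g) = cat_comp h f - cat_comp h g.
Proof. by apply: (addIr (cat_comp h g)); rewrite -cat_compDr !subrK. Qed.

Fact postcomp_morph X A B (f : @cat_hom C A B) :
  zmod_morphism (fun u : cat_hom X A => cat_comp f u).
Proof. by move=> u v; apply: compBr. Qed.

Definition yoneda A B (f : @cat_hom C A B) :
  natTrans (representable A) (representable B) :=
  @NatTrans C (representable A) (representable B)
    (fun X => HB.pack (fun u : cat_hom X A => cat_comp f u)
       (GRing.isZmodMorphism.Build _ _ _ (@postcomp_morph X A B f)))
    (fun X Y g x => cat_compA f x g).

Lemma yonedaE A B (f : @cat_hom C A B) X u : yoneda f X u = cat_comp f u.
Proof. by []. Qed.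

Lemma nat_id A (F : contraFunctor C) (a : natTrans (representable A) F) X
    (u : cat_hom X A) : a X u = fun_map F u (a A (cat_id A)).
Proof. by rewrite -nat_natural /= /precomp cat_comp1l. Qed.

Lemma representable_fp A : fin_presented (@representable C A).
Proof.
exists A, A, (yoneda 0), (yoneda (cat_id A)) => X; split=> [b|b].
  rewrite yonedaE cat_comp1l; split=> [->|[a <-]]; first by exists 0;
      rewrite yonedaE comp0l.
  by rewrite yonedaE comp0l.
by exists b; rewrite yonedaE cat_comp1l.
Qed.

Section Coker.
Variables (X Y : C) (f : cat_hom X Y).

Let S W (u : cat_hom W Y) := exists v : cat_hom W X, u = cat_comp f v.

Definition coker : contraFunctor C.
Proof.
apply: (@quot_functor C (representable Y) S).
- by move=> W; exists 0; rewrite comp0r.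
- by move=> W u v [u' ->] [v' ->]; exists (u' - v'); rewrite compBr.
- by move=> W Z g _ [v ->]; exists (cat_comp v g); rewrite cat_compA.
Defined.

Definition coker_pi : natTrans (representable Y) coker.
Proof. exact: quot_trans. Defined.

Lemma coker_pi0 W (u : cat_hom W Y) :
  coker_pi W u = 0 <-> exists v : cat_hom W X, u = cat_comp f v.
Proof. exact: qf_pi0. Qed.

Lemma coker_pi_surj W : surjective (coker_pi W).
Proof. by move=> y; exists (repr y); apply: qf_piK. Qed.

Lemma coker_fp : fin_presented coker.
Proof.
exists X, Y, (yoneda f), coker_pi => W; split; last exact: coker_pi_surj.
by move=> u; rewrite coker_pi0; split=> -[v]; [move=> ->|move=> <-]; exists v.
Qed.

End Coker.

(** Splitting the projection of the represented functor [Y] onto the cokernel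
of [f], seen on the identity of [Y], gives the quasi-inverse of [f]. *)
Lemma semisimple_regular : fp_semisimple C -> regular_cat.
Proof.
move=> ss X Y f.
pose F := FpFunctor (coker_fp f); pose G := FpFunctor (representable_fp Y).
pose p : natTrans G F := coker_pi f.
have pe : fp_epi p.
  move=> H u v uv W y; have [x <-] := coker_pi_surj y; exact: uv.
pose idF : natTrans F F := @NatTrans C F F (fun X => idfun) (fun _ _ _ _ => erefl).
have [s sP] := ss F G F p idF pe.
pose e : cat_hom Y Y := s Y (p Y (cat_id Y)).
have [g gP] : exists g, cat_id Y - e = cat_comp f g.
  apply/(coker_pi0 f); rewrite raddfB; apply/eqP; rewrite subr_eq0 eq_sym;
      apply/eqP.
  exact: (sP Y (p Y (cat_id Y))).
exists g; rewrite -gP compBl cat_comp1l.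
suff -> : cat_comp e f = 0 by rewrite subr0.
rewrite -[LHS]/(fun_map G f e) /e -!nat_natural /= /precomp cat_comp1l.
rewrite (_ : p X f = 0) ?raddf0 //; apply/coker_pi0.
by exists (cat_id X); rewrite cat_comp1r.
Qed.

(** The idempotent is the sum of one onto the image of [f] and one onto the
image of the part of [g] that is complementary to [f]. This makes cokernels of
maps of finitely presented functors finitely presented without biproducts. *)
Lemma regular_span A1 A2 B (f : @cat_hom C A1 B) (g : cat_hom A2 B) : regular_cat ->
  exists d : cat_hom B B, forall W (u : cat_hom W B),
    (exists w, u = cat_comp d w) <->
    (exists v v', u = cat_comp f v + cat_comp g v').
Proof.
move=> reg; have [f' ff'] := reg _ _ f.
pose g1 := g - cat_comp (cat_comp f f') g.
have [t tP] := reg _ _ g1.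
pose p2 := cat_comp (cat_comp g1 t) (cat_id B - cat_comp f f').
have kf : cat_comp (cat_id B - cat_comp f f') f = 0.
  by rewrite compBl cat_comp1l ff' subrr.
have kg : cat_comp (cat_id B - cat_comp f f') g = g1.
  by rewrite compBl cat_comp1l.
have p2f : cat_comp p2 f = 0 by rewrite /p2 -cat_compA kf comp0r.
have p2g : cat_comp p2 g = g1 by rewrite /p2 -cat_compA kg tP.
exists (cat_comp f f' + p2) => W u; split=> [[w ->]|[v [v' ->]]].
  have [w' w'E] : exists w',
      w' = cat_comp (cat_comp t (cat_id B - cat_comp f f')) w.
    by eexists.
  exists (cat_comp f' w - cat_comp (cat_comp f' g) w'), w'.
  rewrite cat_compDl compBr !cat_compA -addrA; congr (_ + _).
  by rewrite addrC -compBl -/g1 w'E /p2 !cat_compA.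
exists (cat_comp f v + cat_comp g v').
rewrite cat_compDr !cat_compDl !cat_compA ff' p2f p2g comp0l addr0.
by congr (_ + _); rewrite -cat_compDl addrC subrK.
Qed.

Lemma fp_epi_surj (F G : fpFunctor C) (e : natTrans F G) :
  regular_cat -> fp_epi e -> forall X, surjective (e X).
Proof.
move=> reg epi.
have [A' [B' [a' [p' GP]]]] := fp_fin_presented G.
have [A'' [B'' [a'' [p'' FP]]]] := fp_fin_presented F.
have [c cP] := (GP B'').2 (e B'' (p'' B'' (cat_id B''))).
have [d dP] := regular_span (a' A' (cat_id A')) c reg.
pose S W (y : G W) := exists x, e W x = y.
pose S0 W : S W 0 := ex_intro _ 0 (raddf0 _).
have SB W (x y : G W) : S W x -> S W y -> S W (x - y).
  by move=> [x' <-] [y' <-]; exists (x' - y'); rewrite raddfB.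
have Smap W Z (f : cat_hom W Z) x : S Z x -> S W (fun_map G f x).
  by move=> [x' <-]; exists (fun_map F f x'); rewrite nat_natural.
pose H := quot_functor S0 SB Smap; pose q : natTrans G H := quot_trans S0 SB Smap.
have fpH : fin_presented H.
  exists B', B', (yoneda d), (nat_comp q p') => W; split; last first.
    move=> y; have [x xy] := (GP W).2 (repr y : G W); exists x.
    by rewrite -[RHS](qf_piK (S0 := S0) (SB := SB)) -xy.
  move=> u; rewrite -[nat_comp q p' W u]/(qf_pi S0 SB (p' W u)) (qf_pi0 S0 SB).
  transitivity (exists w, u = cat_comp d w); last first.
    by split=> -[w]; [move=> ->|move=> <-]; exists w.
  rewrite dP; split=> [[x xu]|[v [v' ->]]].
    have [v' v'x] := (FP W).2 x.
    have [v vE] : exists v, a' W v = u - cat_comp c v'.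
      apply/(GP W).1; rewrite raddfB; apply/eqP; rewrite subr_eq0; apply/eqP.
      rewrite -xu -v'x (nat_id p'') nat_natural -cP -nat_natural.
      by [].
    exists v, v'; apply/eqP; rewrite -subr_eq -vE (nat_id a').
    by [].
  exists (p'' W v'); rewrite raddfD.
  have -> : p' W (cat_comp (a' A' (cat_id A')) v) = 0.
    by apply/(GP W).1; exists v; rewrite (nat_id a').
  rewrite add0r (nat_id p'') nat_natural -cP -nat_natural.
  by [].
move=> W y; pose H' := FpFunctor fpH.
pose zero : natTrans G H' := @NatTrans C G H' (fun X => \0)
  (fun X Y f x => esym (raddf0 _)).
have := epi H' q zero.
move=> /(_ _ W y) hq; apply/(qf_pi0 S0 SB); apply: hq => Z x.
by rewrite -[RHS]/(0 : H Z); apply/(qf_pi0 S0 SB); exists x.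
Qed.

Lemma regular_semisimple : regular_cat -> fp_semisimple C.
Proof.
move=> reg F G H e f epi.
have eS := fp_epi_surj reg epi.
have [A [B [a [p FP]]]] := fp_fin_presented F.
pose al := a A (cat_id A).
have aE W (v : cat_hom W A) : a W v = cat_comp al v by rewrite (nat_id a).
have [be bP] := reg _ _ al.
have [x xP] := eS B (f B (p B (cat_id B))).
pose ep := cat_id B - cat_comp al be.
have epal : cat_comp ep al = 0 by rewrite compBl cat_comp1l bP subrr.
pose lift W (t : F W) := sval (cid ((FP W).2 t)).
have liftP W t : p W (lift W t) = t by exact: svalP (cid ((FP W).2 t)).
pose g W (t : F W) : G W := fun_map G (cat_comp ep (lift W t)) x.
have gE W u : g W (p W u) = fun_map G (cat_comp ep u) x.
  have [v vE] : exists v, a W v = lift W (p W u) - u.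
    by apply/(FP W).1; rewrite raddfB liftP subrr.
  rewrite /g; congr (fun_map G _ x); apply/eqP; rewrite -subr_eq0 -compBr -vE.
  by rewrite aE cat_compA epal comp0l.
have fmB W Z (u v : cat_hom W Z) y :
    fun_map G (u - v) y = fun_map G u y - fun_map G v y.
  by apply: (addIr (fun_map G v y)); rewrite -fun_mapD !subrK.
have gB W : zmod_morphism (g W).
  move=> s t; rewrite -(liftP W s) -(liftP W t) -raddfB !gE compBr.
  exact: fmB.
have gN W Z (h : cat_hom W Z) t : g W (fun_map F h t) = fun_map G h (g Z t).
  rewrite -(liftP Z t) -nat_natural !gE -fun_mapM; congr (fun_map G _ x).
  by rewrite /= /precomp cat_compA.
exists (@NatTrans C F G (fun W => HB.pack (g W)
  (GRing.isZmodMorphism.Build _ _ _ (gB W))) gN) => W t.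
rewrite -[LHS]/(e W (g W t)) -(liftP W t) gE nat_natural xP -nat_natural.
rewrite -nat_natural; congr (f W _).
rewrite -[LHS]/(p W (cat_comp (cat_id B) (cat_comp ep (lift W t)))).
rewrite cat_comp1l compBl cat_comp1l raddfB -cat_compA.
rewrite (_ : p W (cat_comp al _) = 0) ?subr0 //.
by apply/(FP W).1; exists (cat_comp be (lift W t)); rewrite aE.
Qed.

End Regular.

(** * Injective modules of finite length *)

Section Injectives.
Variable A : pzRingType.
Hypothesis flA : fin_length A^o.
Implicit Types M N X Y Q V : lmodType A.

Definition essential M X (i : {linear M -> X}) :=
  injective i /\ forall x : X, x <> 0 ->
    exists (r : A) (y : M), r *: x = i y /\ y <> 0.

Definition annihilated X (J : lsub A^o) (x : X) := forall a, J a ->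
    (a : A) *: x = 0.

Lemma annihilated_opsub X J : @opsub _ (modop X) (@annihilated X J).
Proof.
split=> [a _|x y Jx Jy a Ja|z x Jx a Ja]; first exact: scaler0.
- by rewrite scalerBr Jx // Jy // subrr.
- rewrite [og_act _ _]/= scalerA; case: z => z /= <-.
  by rewrite -scalerA Jx // scaler0.
Qed.

Fact scale_opmap X (a : A) : @opmap _ (modop X) (modop X) (fun x : X => a *: x : X).
Proof.
split=> [x y|z x]; first exact: scalerBr.
by rewrite /= !scalerA; case: z => z /= ->.
Qed.

(** Along a composition series of left ideals the parts of [X] they annihilate
decrease by subquotients of the socle of [X], which lies in [M]. *)
Lemma essential_bound M X (i : {linear M -> X}) : fin_length M ->
    fin_length X -> essential i ->
  (lenM X <= lenM A^o * lenM M)%N.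
Proof.
move=> fM fX [iI ess].
have lM : lenU (limg i lall : X -> Prop) = lenM M.
  exact: (img_inj (linear_opmap i) iI (opsubT (modop M))).2.
suff bound n (J : lsub A^o) : (lenU J <= n)%N ->
    (lenM X <= lenU (@annihilated X J) + n * lenM M)%N.
  have := bound _ lall (leqnn _); rewrite [lenU (annihilated _)](_ : _ = 0%N) //.
  apply: (@len_zero _ (modop X) _ _).2 => x ax.
  by rewrite -(scale1r x); apply: (ax 1).
have zero (I : lsub A^o) : (forall a, I a -> a = 0) ->
    (lenM X <= lenU (@annihilated X I))%N.
  by move=> I0; apply: len_le => [x _ a /I0->|]; [rewrite scale0r | apply: finlenT].
elim: n J => [|n IH] J lJ.
  rewrite mul0n addn0; apply: zero => x Jx; apply: contrapT => x0.
  have : (0 < lenU J)%N; last by lia.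
  apply: chain_len; first exact: finlenT.
  exists (fun y => y = 0); split=> //; first exact: (lsub_opsub (lzero : lsub A^o)).
    by move=> _ ->; apply: lsub0.
  by exists x.
have [J0|J0] := pselect (forall a, J a -> a = 0).
  by apply: leq_trans (zero J J0) (leq_addr _ _).
(* [J'] is maximal in [J]. *)
have [|J' [J'J [a Ja nJ'a]] J'max] := @ex_max_lsub _ A^o
    (fun V : lsub A^o => (forall x, V x -> J x) /\ exists2 x, J x & ~ V x) flA.
  exists lzero; split=> [_ ->|]; first exact: lsub0.
  by apply: contrapT => h; apply: J0 => b Jb; apply: contrapT => b0; apply: h;
      exists b.
have gen b : J b -> ~ J' b -> forall c, J c -> lsum J' (lcyclic b) c.
  move=> Jb nJ'b c Jc; apply: contrapT => nc; apply: nJ'b.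
  apply: (J'max (lsum J' (lcyclic b))).
  - split; last by exists c.
    by move=> _ [u [_ [/J'J Ju [r ->] ->]]]; apply: lsubD => //; apply: lsubZ.
  - by move=> x J'x; exists x, 0; rewrite addr0; split=> //; apply: lsub0.
  - exists 0, b; rewrite add0r; split=> //; first exact: lsub0.
    by exists 1; rewrite scale1r.
have lJ' : (lenU J' <= n)%N.
  rewrite -ltnS; apply: leq_trans lJ; apply: len_lt.
  - exact: lsub_opsub.
  - exact: J'J.
  - exact: finlenT.
  - by exists a.
apply: leq_trans (IH J' lJ') _; rewrite mulSn addnA leq_add2r.
rewrite [lenU (@annihilated X J')](len_split (scale_opmap X a)
    (annihilated_opsub X J'));
  last exact: finlenT.
apply: leq_add; last first.
  rewrite -lM; apply: len_le; last exact: finlenT.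
  move=> _ [x J'x <-]; have [->|ax0] := EM ((a : A) *: (x : X) = 0);
      first exact: lsub0.
  have [r [y [ry y0]]] := ess _ ax0.
  have nra : ~ J' (r * a).
    by move=> /J'x; rewrite -scalerA ry -(linear0 i) => /iI.
  have Jra : J (r * a) by apply: (lsubZ (U := J)).
  have [u [_ [J'u [b ->] aE]]] := gen _ Jra nra a Ja.
  exists (b *: y) => //.
  by rewrite aE scalerDl J'x // add0r linearZZ -ry -[RHS]/((b * (r * a)) *: (x
      : X)) !scalerA mulrA.
apply: len_le; last exact: finlenT.
move=> x [J'x ax0] c Jc; have [u [_ [J'u [b ->] ->]]] := gen a Ja nJ'a c Jc.
by rewrite scalerDl J'x // add0r -[LHS]/((b * a) *: (x : X)) -scalerA ax0 scaler0.
Qed.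

(** An essential extension of maximal length is injective: a map into it from a
submodule extends, because pushing out and dividing by a complement gives
another essential extension. *)
Lemma ex_injective M : fin_length M ->
    exists (X : fgModType A) (i : {linear M -> X}),
  injective i /\ injective_module X.
Proof.
move=> fM.
pose Pn k := exists (X : lmodType A) (i : {linear M -> X}),
  [/\ fin_length X, essential i & lenM X = k].
have ex0 : exists k, `[< Pn k >].
  exists (lenM M); apply/asboolP; exists M, idfun; split=> //; split=> // x x0.
  by exists 1, x; rewrite scale1r.
have bound k : `[< Pn k >] -> (k <= lenM A^o * lenM M)%N.
  by move=> /asboolP[X [i [fX ess <-]]]; apply: essential_bound ess.
have [k /asboolP[X [i [fX [iI ess] lX]]] kmax] := ex_maxnP ex0 bound.
exists (FgMod (fl_fg fX)), i; split=> // U V g f gI.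
have fV := fg_fl flA (fg_fin_gen V).
have [|D [D0 DX] Dmax] := @ex_max_lsub _ (X * V)%type
  (fun D => (forall u, D (- f u, g u)) /\ forall x, D (x, 0) -> x = 0)
  (fl_pair fX fV) .
  exists (limg (pair_map (- f) g) lall); split=> [u|x [u _]].
    by exists u => //; rewrite pair_mapE.
  rewrite pair_mapE => -[<- /(ker0_inj gI) ->].
  by rewrite -[LHS]/(- f 0) linear0 oppr0.
pose j : {linear X -> quotm D} := lcomp (qpi D) (@pair_inl A X V).
have jI : injective j by apply: inj_ker0 => x /qpi_eq0 /DX.
have fD : fin_length (quotm D) by apply: fl_quotm; apply: fl_pair.
have jess : essential (lcomp j i).
  split; first by move=> x y /jI/iI.
  move=> q; rewrite -(qpiK q); case: (repr q) => z1 z2 q0.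
  set z := (z1, z2) in q0 *.
  have nDz : ~ D z by move=> /qpi_eq0.
  have [x [Dx x0]] : exists x, lsum D (lcyclic z) (x, 0) /\ x <> 0.
    apply: contrapT => nx; apply: nDz; apply: (Dmax (lsum D (lcyclic z))).
    - split=> [u|x Dx].
        by exists (- f u, g u), 0; rewrite addr0; split=> //; exists 0;
            rewrite scale0r.
      by apply: contrapT => x0; apply: nx; exists x.
    - by move=> w Dw; exists w, 0; rewrite addr0; split=> //; exists 0;
        rewrite scale0r.
    - exists 0, z; rewrite add0r; split=> //; first exact: lsub0.
      by exists 1; rewrite scale1r.
  case: Dx => d [_ [Dd [r ->] xE]].
  have [s [y [sy y0]]] := ess x x0; exists (s * r), y; split=> //.
  rewrite -scalerA lcompE -sy linearZ /=; congr (s *: _).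
  have /qpi_eq0 d0 := Dd.
  by rewrite -[RHS]/(qpi D (x, 0)) xE qpiD d0 add0r qpiZ.
have jS : surjective j.
  apply: (len_inj_surj (linear_opmap j) jI fD);
      rewrite -/(lenM X) -/(lenM (quotm D)) lX.
  by apply: kmax; apply/asboolP; exists (quotm D), (lcomp j i).
have [h hP] := factor_inj (f := lcomp (qpi D) (@pair_inr A X V)) jI (fun v => jS _).
exists h; apply: linear_eqP => u; apply: jI; rewrite lcompE hP; apply/esym/qpiE.
rewrite -[_ - _]opprK; apply: lsubN; rewrite opprB.
by rewrite -[_ - _]/(0 - f u, g u - 0) sub0r subr0.
Qed.

(** Baer's criterion; maximal left ideals suffice because modules of finite
length are reached by simple steps. *)
Lemma baer (X : fgModType A) :
  (forall m : lsub A^o, max_left_ideal m -> forall g : {linear smod m -> X},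
     exists y : X, forall r, g r = (incl r : A) *: y) -> injective_module X.
Proof.
move=> bX U V g f gI.
have [fX fV] := (fg_fl flA (fg_fin_gen X), fg_fl flA (fg_fin_gen V)).
have [|G [G0 GX] Gmax] := @ex_max_lsub _ (V * X)%type
  (fun G => (forall u, G (g u, f u)) /\ forall x, G (0, x) -> x = 0)
  (fl_pair fV fX).
  exists (limg (pair_map g f) lall); split=> [u|x [u _]].
    by exists u => //; rewrite pair_mapE.
  by rewrite pair_mapE => -[/(ker0_inj gI) -> <-]; rewrite linear0.
pose W := limg (fst : {linear (V * X)%type -> V}) G.
have WP v : W v <-> exists x, G (v, x).
  by split=> [[[v' x] Gx /= <-]|[x Gx]]; [exists x | exists (v, x)].
have tot v : W v.
  apply: contrapT => nWv.
  have [|v0 [nWv0 Mv0]] := ex_simple (U := W) fV; first by exists v.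
  have mW (r : smod (ann_mod W v0)) : W ((incl r : A) *: v0) by apply: (incl_in r).
  have [g0 g0P] : exists g0 : {linear smod (ann_mod W v0) -> X},
      forall (r : smod (ann_mod W v0)) x, G ((incl r : A) *: v0, x) <-> g0 r = x.
    apply: linear_of_graph => [r|x|a r x r' x' Gr Gr'].
    - by apply/WP/mW.
    - by rewrite linear0 scale0r => /GX.
    - rewrite linearP scalerDl -scalerA.
      exact: lsubZD Gr Gr'.
  have [y yP] := bX _ Mv0 g0.
  apply: nWv0; apply/WP; exists y.
  apply: (Gmax (lsum G (lcyclic (v0, y)))).
  - split=> [u|x [[v1 x1] [_ [Gd [r ->] [vE ->]]]]].
      by exists (g u, f u), 0; rewrite addr0; split=> //; exists 0; rewrite scale0r.
    have v1E : v1 = (- r) *: v0.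
      by rewrite scaleNr; apply/eqP; rewrite -addr_eq0 eq_sym; apply/eqP.
    have [r' r'E] : exists r' : smod (ann_mod W v0), incl r' = - r.
      by apply: incl_ex; rewrite /= -v1E; apply/WP; exists x1.
    have : g0 r' = x1 by apply/g0P; rewrite r'E -v1E.
    by rewrite yP r'E scaleNr => <-; rewrite addNr.
  - by move=> w Dw; exists w, 0; rewrite addr0; split=> //; exists 0;
      rewrite scale0r.
  - exists 0, (v0, y); rewrite add0r; split=> //; first exact: lsub0.
    by exists 1; rewrite scale1r.
have [h hP] : exists h : {linear V -> X}, forall v x, G (v, x) <-> h v = x.
  apply: linear_of_graph => [v|x|a r x r' x' Gr Gr'].
  - exact/WP.
  - exact: GX.
  - exact: lsubZD Gr Gr'.
by exists h; apply: linear_eqP => u; apply/hP.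
Qed.

(** If maximal left ideals have no extensions by the ring, then simple modules
have no second extensions, so the cosyzygy of the ring is injective. *)
Lemma injdim1 : (forall m : lsub A^o, max_left_ideal m -> ext0 (smod m) A^o) ->
  injdim_le (regular A) 1.
Proof.
move=> em; have [I0 [i [iI I0inj]]] := ex_injective flA.
pose W := limg i lall.
have fI0 := fg_fl flA (fg_fin_gen I0).
pose I1 : fgModType A := FgMod (fl_fg (fl_quotm W fI0)).
have I1inj : injective_module I1.
  apply: baer => m Mm g.
  pose YT := (smod m * I0)%type.
  have Yok : @submod_ok _ YT (fun z => g z.1 = qpi W z.2).
    split=> [|a z z' e e']; first by rewrite !linear0.
    by rewrite !linearP /= e e'.
  pose Y := Lsub Yok.
  have YP (z : smod Y) : g (incl z).1 = qpi W (incl z).2 by exact: (incl_in z).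
  pose p : {linear smod Y -> smod m} := lcomp (fst : {linear YT -> smod m}) incl.
  have pS : surjective p.
    move=> r; have [z zE] : exists z : smod Y, incl z = (r, repr (g r : quotm W)).
      by apply: incl_ex; apply/esym/qpiK.
    by exists z; rewrite lcompE zE.
  have [k kP] : exists k : {linear A^o -> smod Y}, forall a, incl (k a) = (0, i a).
    apply: (factor_inj (f := lcomp (@pair_inr A (smod m) I0) i)) (@incl_inj _ _
        Y) _ => a.
    by apply: incl_ex; rewrite /= linear0; apply/esym/qpi_eq0; exists a.
  have kI : injective k.
    by move=> a b /(congr1 incl); rewrite !kP => -[/iI].
  have [|h hP] := ext0_use (em m Mm) kI pS _ idfun.
    move=> z; split=> [pz|[a <-]]; last by rewrite lcompE kP.
    have := YP z; rewrite -[(incl z).1]/(p z) pz linear0 => /esym/qpi_eq0[a _ az].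
by exists a; apply: incl_inj; rewrite kP az;
    apply: injective_projections => //=; exact: esym pz.
  have [|g1 g1P] := factor_surj
      (f := lcomp (snd : {linear YT -> I0}) incl - lcomp i h) pS.
    move=> z pz; rewrite -[LHS]/((incl z).2 - i (h z)).
    have := YP z; rewrite -[(incl z).1]/(p z) pz linear0 => /esym/qpi_eq0[a _ az].
    have -> : z = k a.
      by apply: incl_inj; rewrite kP az; apply: injective_projections => //=;
          exact: pz.
    by rewrite hP kP subrr.
  have g1q r : qpi W (g1 r) = g r.
    have [z <-] := pS r; rewrite g1P -[X in qpi W X]/((incl z).2 - i (h z)) qpiB.
    rewrite [qpi W (i _)](_ : _ = 0) ?subr0 -?YP //.
    by apply/qpi_eq0; exists (h z).
  have fm : fin_gen (smod m) by apply/fl_fg/fl_smod.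
  have [G GP] := I0inj (FgMod fm) (regular A) incl g1 (@incl_inj _ _ m).
  exists (qpi W (G 1)) => r; rewrite -g1q -qpiZ; congr (qpi W _).
  transitivity (G (incl r)).
    exact: (esym (congr1 (fun u : {linear smod m -> I0} => u r) GP)).
  rewrite -[RHS](linearZZ G); congr (G _); exact: (esym (mulr1 (incl r : A))).
pose I (n : nat) : fgModType A :=
    match n with 0 => I0 | 1 => I1 | _ => zero_fg A end.
pose d n : {linear I n -> I n.+1} :=
  match n with 0 => (qpi W : {linear I0 -> I1}) | _ => 0 end.
have z0 (x : zero_fg A) : x = 0 by apply/ffunP => -[].
exists I, d, i; split=> //.
- move=> [|[|j]] //= U V g f gI; exists 0; apply: linear_eqP => x.
  by rewrite [RHS]z0 [LHS]z0.
- move=> x; rewrite [d 0%N x]/(qpi W x) qpi_eq0.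
  by split=> [[y _ yx]|[y yx]]; exists y.
- move=> [|j] y.
    split=> // _; have [x xy] := @qpi_surj _ _ W y; by exists x.
  by split=> // _; exists 0; case: j y => [|j] y; rewrite [RHS]z0 [LHS]z0.
- by move=> [|[|j]] // _ x; apply: z0.
Qed.

End Injectives.

(** * The radical *)

Section RadicalTheory.
Variable A : pzRingType.
Implicit Types M N X Y Q P : lmodType A.

Program Definition lrad N := @Lsub A N (fun x => x \in @rad_pred A N) _.
Next Obligation.
move=> N; have [R0 RZ] := @rad_submod_closed A N; split=> // a x y; exact: RZ.
Qed.

Definition max_lsub N (U : lsub N) := (exists x, ~ U x) /\
  forall V : lsub N, (forall x, U x -> V x) ->
    (forall x, V x -> U x) \/ forall x, V x.

Lemma lradP N x : lrad N x <-> forall U : lsub N, max_lsub U -> U x.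
Proof.
split=> [/asboolP rx U [[y nUy] Umax]|rx].
  have : x \in (lsub_pred U : submodClosed N); last by move/asboolP.
  apply: rx; split; first by exists y; apply/asboolP.
  move=> B UB.
  have Bok : submod_ok (fun x => x \in B).
    by split=> [|a u v Bu Bv]; [apply: rpred0 | rewrite rpredD ?rpredZ].
  have [|le|all] := Umax (Lsub Bok).
  - by move=> z Uz; apply: UB; apply/asboolP.
  - left=> z; apply/idP/asboolP => [/le//|Uz].
    by apply: UB; apply/asboolP.
  - by right.
apply/asboolP => B [[y nBy] Bmax].
have Bok : submod_ok (fun x => x \in B).
  by split=> [|a u v Bu Bv]; [apply: rpred0 | rewrite rpredD ?rpredZ].
apply: (rx (Lsub Bok)); split; first by exists y; apply/negP.
move=> V BV; have [|e|all] := Bmax (lsub_pred V : submodClosed N).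
- by move=> z Bz; apply/asboolP/BV.
- by left=> z Vz; rewrite /= -e; apply/asboolP.
- by right=> z; have /asboolP := all z.
Qed.

Lemma max_left_ideal_lsub m : @max_left_ideal A m <-> max_lsub m.
Proof.
have full (V : lsub A^o) : V 1 -> forall x, V x.
  by move=> V1 x; rewrite -(mulr1 x); apply: (lsubZ (U := V)).
split=> [[m1 mmax]|[[x nx] mmax]]; split.
- by exists 1.
- by move=> V /mmax[le|/full]; [left | right].
- by move/full => all; apply: nx; apply: all.
- by move=> V /mmax[le|all]; [left | right].
Qed.

Lemma max_lsub_pre M N (f : {linear M -> N}) (U : lsub N) : max_lsub U ->
  max_lsub (lpre f U) \/ forall x, U (f x).
Proof.
move=> [_ Umax]; have [all|nall] := pselect (forall x, U (f x)); [by right | left].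
split.
  by apply: contrapT => h; apply: nall => x; apply: contrapT => nx; apply: h;
      exists x.
move=> V UV; have [|le|all] := Umax (lsum (limg f V) U).
- move=> x Ux; exists 0, x; rewrite add0r; split=> //; exact: lsub0.
- left=> x Vx; apply: le; exists (f x), 0; rewrite addr0; split=> //;
    last exact: lsub0.
  by exists x.
- right=> x; have [_ [u [[v Vv <-] Uu fx]]] := all (f x).
  rewrite -(subrK v x); apply: lsubD => //; apply: UV.
  by rewrite /= linearB fx addrAC subrr add0r.
Qed.

Lemma rad_map M N (f : {linear M -> N}) x : lrad M x -> lrad N (f x).
Proof.
move=> /lradP rx; apply/lradP => U mU.
by have [mf|] := max_lsub_pre f mU; [apply: (rx _ mf) | apply].
Qed.

Lemma rad_regP (x : A^o) : lrad A^o x <-> forall m, max_left_ideal m -> m x.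
Proof. by rewrite lradP; split=> h m /max_left_ideal_lsub; apply: h. Qed.

Lemma nakayama N (U : lsub N) : fin_length N ->
  (forall x, exists u r, [/\ U u, lrad N r & x = u + r]) -> forall x, U x.
Proof.
move=> fN UR x; apply: contrapT => nUx.
have [|V [UV [y nVy]] Vmax] := @ex_max_lsub _ N
    (fun V : lsub N => (forall x, U x -> V x) /\ exists x, ~ V x) fN.
  by exists U; split=> //; exists x.
have mV : max_lsub V.
  split; first by exists y.
  move=> W VW; have [all|nall] := pselect (forall x, W x); [by right | left].
  apply: Vmax => //; split; first by move=> z /UV/VW.
  by apply: contrapT => h; apply: nall => z; apply: contrapT => nz; apply: h;
      exists z.
apply: nVy; have [u [r [Uu /lradP rr ->]]] := UR y.
by apply: lsubD; [apply: UV | apply: rr].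
Qed.

(** Submodules above the radical have complements modulo the radical: take one
that is minimal among those spanning with [E]; a maximal submodule missing an
element of the intersection would cut it down. *)
Lemma rad_complement P (E : lsub P) : fin_length P -> (forall x, lrad P x -> E x) ->
  exists E' : lsub P,
    [/\ forall x, exists e e', [/\ E e, E' e' & x = e + e'],
        forall x, E x -> E' x -> lrad P x & forall x, lrad P x -> E' x].
Proof.
move=> fP RE.
have [|E' [E'S E'R] E'min] := @ex_min_lsub _ P
  (fun V : lsub P => (forall x, exists e e', [/\ E e, V e' & x = e + e']) /\
                     forall x, lrad P x -> V x) fP.
  exists lall; split=> // x; exists 0, x; rewrite add0r; split=> //; exact: lsub0.
exists E'; split=> // x Ex E'x; apply/lradP => U mU; apply: contrapT => nUx.
have [_ Umax] := mU.
have : lcap E' U x; last by case.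
apply: (E'min (lcap E' U) _ _ x E'x); last by move=> y [].
split=> [y|y Ry]; last by split; [apply: E'R | move/lradP: Ry; apply].
have [e [e' [Ee E'e' ->]]] := E'S y.
have [|le|all] := Umax (lsum U (lcyclic x)).
- by move=> z Uz; exists z, 0; rewrite addr0; split=> //; exists 0; rewrite scale0r.
- case: nUx; apply: le; exists 0, x; rewrite add0r; split=> //; first exact: lsub0.
  by exists 1; rewrite scale1r.
have [u [_ [Uu [r ->] e'E]]] := all e'.
exists (e + r *: x), u; split.
- by apply: lsubD => //; apply: lsubZ.
- split=> //; rewrite (_ : u = e' - r *: x); last by rewrite e'E addrK.
  by apply: lsubB => //; apply: lsubZ.
- by rewrite e'E -addrA [u + _]addrC.
Qed.

Lemma retr_rad_pair P (E : lsub P) : fin_length P -> proj P ->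
    (forall x, lrad P x -> E x) ->
  retract (smod E) (smod (lrad P) * P)%type.
Proof.
move=> fP prP RE; have [E' [S I R]] := rad_complement fP RE.
pose T := (smod E * smod E')%type.
pose d : {linear T -> P} := copair incl incl.
have [s sP] : exists s : {linear P -> T}, forall x, d (s x) = x.
  apply: (proj_lift (f := idfun) prP) => x.
  have [e [e' [Ee E'e' ->]]] := S x.
  have [y yE] := incl_ex Ee; have [z zE] := incl_ex E'e'.
  by exists (y, z); rewrite copairE yE zE.
pose q : {linear smod E -> P} :=
    incl - lcomp incl (lcomp (fst : {linear T -> smod E}) (lcomp s incl)).
have [r rP] : exists r : {linear smod E ->
    smod (lrad P)}, forall x, incl (r x) = q x.
  apply: factor_inj (@incl_inj _ _ (lrad P)) _ => x; apply: incl_ex.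
  have qE : q x = incl (s (incl x)).2.
    have := sP (incl x); case E1: (s (incl x)) => [a b].
    rewrite copairE -[q x]/(incl x - incl (s (incl x)).1) E1 /= => <-.
    by rewrite addrC addKr.
  apply: I; last by rewrite qE; apply: incl_in.
  by apply: lsubB; apply: incl_in.
have [j jP] : exists j : {linear smod (lrad P) ->
    smod E}, forall x, incl (j x) = incl x.
  apply: factor_inj (@incl_inj _ _ E) _ => x; apply: incl_ex.
  by apply: RE; apply: incl_in.
exists (pair_map r incl), (copair j (lcomp (fst : {linear T -> smod E}) s)) => x.
rewrite pair_mapE copairE; apply: incl_inj; rewrite linearD jP rP.
by rewrite -[q x]/(incl x - incl (s (incl x)).1) lcompE subrK.
Qed.

Definition radval N : {linear rad_type N -> N} := \val.

Lemma radval_in N (x : rad_type N) : lrad N (radval N x).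
Proof. by case: x. Qed.
Lemma radval_inj N : injective (radval N). Proof. exact: val_inj. Qed.
Lemma radval_ex N x : lrad N x -> exists y, radval N y = x.
Proof. by move=> rx; exists (RadElt rx). Qed.

Lemma retr_rad_free P : proj P ->
  exists n, retract (smod (lrad P)) (pw n (rad_type A^o)).
Proof.
move=> [n [s [r sr]]]; exists n.
have sx (i : 'I_n) : exists t : {linear smod (lrad P) -> rad_type A^o},
    forall x, radval _ (t x) = s (incl x) i.
  apply: (factor_inj (f := lcomp (pw_proj A^o i) (lcomp s incl))) (@radval_inj
      _) _ => x.
  by apply: radval_ex; apply: (rad_map (lcomp (pw_proj A^o i) s) (x :=
      incl x)); apply: incl_in.
have [t tP] := choice sx.
have [b bP] : exists b : {linear pw n (rad_type A^o) -> smod (lrad P)},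
    forall y, incl (b y) = r (pw_map n (radval _) y).
  apply: (factor_inj (f := lcomp r (pw_map n (radval _)))) (@incl_inj _ _ _) _ => y.
  apply: incl_ex; apply: (rad_map r (x := pw_map n (radval _) y)).
  rewrite (pw_sum (pw_map _ _ _)).
  apply: (big_ind (lrad (free A n))) => [|x z|i _]; [exact: lsub0 | exact: lsubD |].
  by apply: rad_map; rewrite ffunE; apply: radval_in.
exists (pw_tuple t), b => x; apply: incl_inj; rewrite bP -[RHS]sr; congr (r _).
by apply/ffunP => i; rewrite [LHS]ffunE -[LHS]/(radval _ (pw_tuple t x i)) ffunE tP.
Qed.

Lemma retr_rad P (E : lsub P) : fin_length P -> proj P ->
    (forall x, lrad P x -> E x) ->
  exists n, retract (smod E) (pw n (rad_type A^o * A^o)%type).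
Proof.
move=> fP prP RE; have ret := retr_rad_pair fP prP RE.
have [m retm] := retr_rad_free prP; have [n retn] := prP.
exists (maxn m n); apply: retr_trans ret (retr_trans (retr_pair retm retn) _).
have wid k l X : (k <= l)%N -> retract (pw k X) (pw l X).
  move=> /subnKC <-; apply: retr_trans (pw_add k (l - k) X).1.
  by exists (@pair_inl A _ _),
      (fst : {linear (pw k X * pw (l - k) X)%type -> pw k X}).
apply: retr_trans (retr_pair (wid _ _ _ (leq_maxl m n)) (wid _ _ _ (leq_maxr m
    n))) _.
exact: (retr_pw_pair _ _ _).1.
Qed.

(** The complement in [in_add] is the kernel of the retraction. *)
Lemma in_addP X (M : fgModType A) : in_add X M <-> exists n, retract M (pw n X).
Proof.
split=> [[n [N [f fB]]]|[n [s [r sr]]]].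
  exists n; have [g [fg gf]] := inv_bij (bij_inj fB)
     (fun y => let: Bijective h hf fh := fB in ex_intro _ (h y) (fh y)).
  exists (lcomp f (@pair_inl A M N)), (lcomp (fst : {linear (M * N)%type ->
      M}) g) => x.
  by rewrite !lcompE fg.
pose F : {linear (M * smod (lker r))%type -> pw n X} := copair s incl.
exists n, (smod (lker r)), F.
have [k kP] : exists k : {linear pw n X -> smod (lker r)}, forall y,
    incl (k y) = ((idfun : {linear pw n X -> pw n X}) - lcomp s r) y.
  apply: factor_inj (@incl_inj _ _ _) _ => y; apply: incl_ex.
  by rewrite /= -[X in r X]/(y - s (r y)) linearB sr subrr.
exists (pair_map r k) => [[x y]|y].
  have rF : r (F (x, y)) = x.
    by rewrite copairE linearD sr lker_in addr0.
  rewrite pair_mapE rF; congr pair; apply: incl_inj; rewrite kP.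
  by rewrite -[LHS]/(F (x, y) - s (r (F (x, y)))) rF copairE addrC addKr.
rewrite pair_mapE copairE kP -[X in _ + X]/(y - s (r y)).
by rewrite addrC subrK.
Qed.

(** The map induced by [h] from [N] to the simple quotient of the ring by [m]
kills the radical of [N]. *)
Lemma rad_to_max_ideal Q N (g : {linear Q -> N}) (h : {linear Q ->
    A^o}) (m : lsub A^o) :
  surjective g -> max_left_ideal m -> (forall q, g q = 0 -> m (h q)) ->
  forall q, lrad N (g q) -> m (h q).
Proof.
move=> gS Mm gm q rq.
have pull x : limg g (lpre h m) (g x) -> m (h x).
  move=> [y my gy]; rewrite -(subrK y x) linearD; apply: lsubD => //.
  by apply: gm; rewrite linearB gy subrr.
apply: (pull q); have [all|nall] := pselect (forall y, m (h y)).
  by exists q => //; apply: all.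
move/lradP: rq; apply; split.
  apply: contrapT => none; apply: nall => y; apply: pull.
  by apply: contrapT => ny; apply: none; exists (g y).
have /max_left_ideal_lsub/max_lsub_pre := Mm; move=> /(_ _ h)[[_ hmax]|//].
move=> V UV; have [|le|all] := hmax (lpre g V).
- by move=> x mx; apply: UV; exists x.
- left=> y; have [x <-] := gS y => Vx; exists x => //; exact: le.
- by right=> y; have [x <-] := gS y; apply: all.
Qed.

End RadicalTheory.

(** * Regular maps in the stable category *)

Section RegularMaps.
Variable C : preAddCat.

Lemma regular_split_epi X Y Z (f : @cat_hom C Y Z) (r : cat_hom X Y) s :
  cat_comp r s = cat_id Y -> regular_map f -> regular_map (cat_comp f r).
Proof.
move=> rs [g fgf]; exists (cat_comp s g).
by rewrite !cat_compA -(cat_compA f r s) rs cat_comp1r fgf.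
Qed.

Lemma regular_split_mono X Y Z (s : @cat_hom C Y Z) (f : cat_hom X Y) r :
  cat_comp r s = cat_id Y -> regular_map (cat_comp s f) -> regular_map f.
Proof.
move=> rs [g /(congr1 (cat_comp r))]; rewrite !cat_compA rs !cat_comp1l => e.
by exists (cat_comp g s); rewrite -[RHS]e !cat_compA.
Qed.

(** For idempotents [e] and [f], [ef] is regular as soon as [(1-f)(1-e)] is;
here [e] is [th h], and [f] is [i rho], with complement [s q]. *)
Lemma regular_complement M E E' N (h : @cat_hom C E E') (th : cat_hom E' E)
    (i : cat_hom M E) (rho : cat_hom E M) (q : cat_hom E N) (s : cat_hom N E) :
  cat_comp (cat_comp h th) h = h -> cat_comp q i = 0 ->
  cat_comp i rho + cat_comp s q = cat_id E ->
  regular_map (cat_comp q (cat_id E - cat_comp th h)) ->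
  regular_map (cat_comp h i).
Proof.
set e := cat_comp th h; set g := cat_comp q (cat_id E - e).
move=> hth qi isq [t0 gtg].
have he : cat_comp h e = h by rewrite cat_compA.
have ee : cat_comp e e = e by rewrite {1}/e -cat_compA he.
have [t tE] : exists t, t = cat_comp (cat_id E - e) t0 by eexists.
pose w := cat_id E - e - cat_comp t g.
have et : cat_comp e t = 0.
  by rewrite tE cat_compA compBr cat_comp1r ee subrr comp0l.
have qt : cat_comp q t = cat_comp g t0 by rewrite tE cat_compA.
have qw : cat_comp q w = 0 by rewrite compBr -/g cat_compA qt gtg subrr.
have ew : cat_comp e w = 0.
  by rewrite !compBr cat_comp1r ee cat_compA et comp0l !subrr.
have hw : cat_comp h w = 0 by rewrite -he -cat_compA ew comp0r.
have gi : cat_comp g i = - cat_comp q (cat_comp e i).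
  by rewrite /g -cat_compA compBl cat_comp1l compBr qi sub0r.
have key : cat_comp (cat_id E - cat_comp t q) (cat_comp e i) = i - cat_comp w i.
  rewrite /w !compBl !cat_comp1l -(cat_compA t g) gi -(cat_compA t q).
  rewrite -[- cat_comp q _]sub0r compBr comp0r sub0r !opprB.
  by rewrite [RHS]addrCA [i + _]addrC subrK addrC.
have iD : cat_comp i (cat_comp rho (i - cat_comp w i)) = i - cat_comp w i.
  rewrite -[RHS]cat_comp1l -isq cat_compDl -(cat_compA s q) (compBr q) qi.
  by rewrite (cat_compA q) qw comp0l subrr comp0r addr0 cat_compA.
exists (cat_comp (cat_comp rho (cat_id E - cat_comp t q)) th).
rewrite -!cat_compA (cat_compA th h i) -/e key iD compBr cat_compA hw.
by rewrite comp0l subr0.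
Qed.

End RegularMaps.

(** * Stable maps between torsionless modules *)

Section StableMaps.
Variable A : pzRingType.
Implicit Types X Y Z : gprjType A.

Definition stable_map X Y (f : {linear X ->
    Y}) : @cat_hom (stable_gprj A) X Y := stable_pi f.

Lemma stable_map_surj X Y (u : @cat_hom (stable_gprj A) X Y) : exists f,
    u = @stable_map X Y f.
Proof. by exists (repr u); rewrite /stable_map stable_reprK. Qed.

Lemma stable_map_comp X Y Z (g : {linear Y -> Z}) (f : {linear X -> Y}) :
  cat_comp (@stable_map Y Z g) (@stable_map X Y f) = @stable_map X Z (lcomp g f).
Proof. exact: stable_pi_comp. Qed.

Lemma stable_mapD X Y (f g : {linear X ->
    Y}) : @stable_map X Y (f + g) = @stable_map X Y f + @stable_map X Y g.
Proof. exact: stable_piD. Qed.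

Lemma stable_map_eqP X Y (f g : {linear X ->
    Y}) : @stable_map X Y f = @stable_map X Y g <->
  exists (Q : lmodType A) (b : {linear Q -> Y}) (a : {linear X -> Q}),
    proj Q /\ forall x, f x = g x + b (a x).
Proof.
rewrite stable_piE; split=> [[P [pP [b [a fg]]]]|[Q [b [a [pQ fg]]]]].
  exists P, b, a; split=> [|x]; first exact/projectiveP.
  have := congr1 (fun u : {linear X -> Y} => u x) fg.
  by rewrite -[LHS]/(f x - g x) lcompE => <-; rewrite addrC subrK.
exists (FgMod (proj_fg pQ)); split; first exact/projectiveP.
exists b, a; apply: linear_eqP => x; rewrite -[LHS]/(f x - g x) fg lcompE.
by rewrite addrC addKr.
Qed.

Lemma stable_map_ext X Y (f g : {linear X -> Y}) : (forall x, f x = g x) ->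
  @stable_map X Y f = @stable_map X Y g.
Proof. by move=> fg; congr stable_pi; apply: linear_eqP. Qed.

Lemma regular_stable_mapP X Y (f : {linear X -> Y}) :
  regular_map (@stable_map X Y f) <->
  exists g : {linear Y -> X},
      @stable_map X Y (lcomp f (lcomp g f)) = @stable_map X Y f.
Proof.
split=> [[u]|[g gP]].
  have [g ->] := stable_map_surj u; rewrite !stable_map_comp => e; exists g.
  by rewrite -[RHS]e; apply: stable_map_ext.
by exists (@stable_map Y X g); rewrite !stable_map_comp -[RHS]gP;
    apply: stable_map_ext.
Qed.

End StableMaps.

Section Torsionless.
Variable A : pzRingType.
Hypothesis flA : fin_length A^o.
Hypotheses (cT : closed_are_ext A) (cU : ext_are_closed A).
Implicit Types X Y Z N K W : gprjType A.

Definition tgprj (M : lmodType A) (fM : fin_length M) (tM : torsionless M) :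
    gprjType A :=
  GprjMod (@tors_gprj A flA cT cU (FgMod (fl_fg fM)) tM).

Lemma gprj_fl X : fin_length X. Proof. exact: fg_fl (fg_fin_gen X). Qed.
Lemma gprj_tl X : torsionless X. Proof. exact: gprj_tors (gprj_gp X). Qed.
Lemma gprj_ext X (Q : lmodType A) : proj Q -> ext0 X Q.
Proof.
move=> pQ; apply: ext0_proj => //; apply: torsionless_ext0 => //.
  exact: gprj_fl.
exact: gprj_tl.
Qed.

(** Regularity of [p] or of [i] means that the triangle splits: if [p g p] is
stably [p] then [1 - g p] factors through [i] up to a stably zero map, and the
factor is a quasi-inverse of [i]; the other direction is dual. *)
Lemma regular_rot K W N (i : {linear K -> W}) (p : {linear W -> N}) :
  injective i -> surjective p -> (forall x, p x = 0 <-> exists y, i y = x) ->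
  regular_map (@stable_map _ W N p) <-> regular_map (@stable_map _ K W i).
Proof.
move=> iI pS ip; rewrite !regular_stable_mapP;
    split=> [[g]|[g]] /stable_map_eqP[Q [b [a [pQ gP]]]].
  have [c cP] := proj_lift pQ (fun x => pS (b x)).
  pose u : {linear W -> W} := (idfun : {linear W -> W}) - lcomp g p + lcomp c a.
  have uE x : u x = x - g (p x) + c (a x) by [].
  have [|k kP] := factor_inj (f := u) iI.
    move=> x; apply/ip; rewrite uE linearD linearB cP.
    by have := gP x; rewrite !lcompE => ->; rewrite opprD addrA subrr add0r addNr.
  exists k; apply/stable_map_eqP; exists Q, c, (lcomp a i); split=> // x.
  rewrite !lcompE kP uE (_ : p (i x) = 0); last by apply/ip; exists x.
  by rewrite linear0 subr0.
have [a' a'P] := ext0_use (gprj_ext pQ) iI pS ip a.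
pose v : {linear W -> W} := (idfun : {linear W -> W}) - lcomp i g + lcomp b a'.
have vE x : v x = x - i (g x) + b (a' x) by [].
have [|k kP] := factor_surj (f := v) pS.
  move=> x /ip[y <-]; rewrite vE a'P.
  by have := gP y; rewrite !lcompE => ->; rewrite opprD addrA subrr add0r addNr.
exists k; apply/stable_map_eqP; exists Q, (lcomp p b), a'; split=> // x.
rewrite !lcompE kP vE linearD linearB (_ : p (i _) = 0) ?subr0 //.
by apply/ip; exists (g x).
Qed.

(** Adding to [f] an embedding of [Y] in a projective does not change it stably
and makes it the first map of a triangle whose second map goes out of [N]. *)
Lemma regular_into N :
  (forall Z (f : {linear N -> Z}), regular_map (@stable_map _ N Z f)) ->
  forall Y (f : {linear Y -> N}), regular_map (@stable_map _ Y N f).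
Proof.
move=> out Y f; have [n [j jI]] := gprj_tl N.
have [m [F [FI eF FA]]] := tors_embed flA (gprj_fl Y) (gprj_tl Y).
have [l [G [FG _]]] := coresolve_step flA cU eF.
have [k kP] : exists k : {linear free A m -> free A n}, forall y, k (F y) = j (f y).
  have [k kP] := choice (fun i => FA (lcomp (pw_proj A^o i) (lcomp j f))).
  by exists (pw_tuple k) => y; apply/ffunP => i; rewrite ffunE kP.
pose W0 := (N * free A m)%type.
have fW : fin_length W0 by apply: fl_pair; [exact: gprj_fl | exact: fl_free].
have tW : torsionless W0 by apply: tors_pair; [exact: gprj_tl | exact: tors_free].
pose W := tgprj fW tW.
pose p0 : {linear W0 -> (free A n * free A l)%type} :=
  copair (lcomp (@pair_inl A (free A n) (free A l)) j) (pair_map (- k) G).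
have p0E x q : p0 (x, q) = (j x - k q, G q).
  rewrite /p0 copairE pair_mapE; apply: injective_projections => //=.
  by rewrite add0r.
pose Z0 := smod (limg p0 lall).
have fZ : fin_length Z0.
  by apply: fl_smod; apply: fl_pair; apply: fl_free.
have tZ : torsionless Z0.
  by apply: tors_smod; apply: tors_pair; apply: tors_free.
pose Z := tgprj fZ tZ.
have [p pP] := factor_inj (@incl_inj _ _ (limg p0 lall))
    (fun x => incl_ex (ex_intro2 _ _ x I (erefl (p0 x)) : limg p0 lall (p0 x))).
have pS : surjective p.
  by move=> y; have [x _ xy] := incl_in y; exists x; apply: incl_inj; rewrite pP.
pose i : {linear Y -> W0} := pair_map f F.
have iI : injective i by move=> x y; rewrite !pair_mapE => -[_ /FI].
have ip x : p x = 0 <-> exists y, i y = x.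
  case: x => x q; split=> [px|[y <-]].
    have := congr1 incl px; rewrite pP linear0 p0E => -[jk /FG[y yq]].
    exists y; rewrite pair_mapE yq; congr pair; apply: jI.
    by rewrite -kP yq; apply/esym/eqP; rewrite -subr_eq0 jk.
  apply: incl_inj; rewrite pP linear0 pair_mapE p0E kP subrr.
  by congr pair; apply/FG; exists y.
pose inl : {linear N -> W0} := @pair_inl A N (free A m).
pose prl : {linear W0 -> N} := (fst : {linear W0 -> N}).
have regp : regular_map (@stable_map _ W Z p).
  rewrite (_ : @stable_map _ W Z p = cat_comp (@stable_map _ N Z (lcomp p inl))
      (@stable_map _ W N prl)).
    apply: (@regular_split_epi _ _ _ _ _ _ (@stable_map _ N W inl));
        last exact: out.
    by rewrite stable_map_comp; apply: stable_map_ext.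
  rewrite stable_map_comp; apply/stable_map_eqP.
  exists (free A m), (lcomp p (@pair_inr A N (free A m))),
      (snd : {linear W0 -> free A m}).
  split=> [|[x q]]; first exact: proj_free.
  rewrite !lcompE -linearD; congr (p _).
  by apply: injective_projections; rewrite /= ?addr0 ?add0r.
have regi := (@regular_rot Y W Z i p iI pS ip).1 regp.
apply: (@regular_split_mono _ _ _ _ (@stable_map _ N W inl) _ (@stable_map _ W
    N prl)).
  by rewrite stable_map_comp; apply: stable_map_ext.
rewrite (_ : cat_comp _ _ = @stable_map _ Y W i) // stable_map_comp;
    apply/esym/stable_map_eqP.
exists (free A m), (@pair_inr A N (free A m)), F; split=> [|y];
    first exact: proj_free.
rewrite pair_mapE lcompE.
by apply: injective_projections; rewrite /= ?addr0 ?add0r.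
Qed.

(** As [N'] has no extensions by projectives, a quasi-inverse of the map on
syzygies extends to the projectives; on cokernels it induces one of [f]. *)
Lemma regular_syzygy (P P' : lmodType A) K K' N N'
    (i : {linear K -> P}) (p : {linear P -> N})
    (i' : {linear K' -> P'}) (p' : {linear P' -> N'})
    (F : {linear P -> P'}) (w : {linear K -> K'}) (f : {linear N -> N'}) :
  proj P -> proj P' ->
  injective i -> surjective p -> (forall x, p x = 0 <-> exists y, i y = x) ->
  injective i' -> surjective p' -> (forall x, p' x = 0 <-> exists y, i' y = x) ->
  (forall x, p' (F x) = f (p x)) -> (forall y, i' (w y) = F (i y)) ->
  regular_map (@stable_map _ K K' w) -> regular_map (@stable_map _ N N' f).
Proof.
move=> prP prP' iI pS ip i'I p'S ip' pF iF.
rewrite !regular_stable_mapP => -[c /stable_map_eqP[Q [b [a [pQ wP]]]]].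
have [g gP] := ext0_use (gprj_ext prP) i'I p'S ip' (lcomp i c).
have [a' a'P] := ext0_use (gprj_ext pQ) iI pS ip a.
have [|d dP] := factor_surj (f := lcomp p g) p'S.
  by move=> x /ip'[y <-]; rewrite lcompE gP lcompE; apply/ip; exists (c y).
pose D : {linear P -> P'} := lcomp F (lcomp g F) - F - lcomp i' (lcomp b a').
have DE x : D x = F (g (F x)) - F x - i' (b (a' x)) by [].
have [|e eP] := factor_surj (f := D) pS.
  move=> x /ip[y <-]; rewrite DE -iF gP lcompE -iF a'P.
  have := wP y; rewrite !lcompE => ->.
  by rewrite linearD [i' (w y) + _]addrC addrK subrr.
exists d; apply/stable_map_eqP; exists P', p', e; split=> // y.
have [x <-] := pS y; rewrite !lcompE eP DE -pF dP lcompE -pF !linearB.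
rewrite [p' (i' _)](_ : _ = 0); last by apply/ip'; exists (b (a' x)).
by rewrite subr0 addrC subrK.
Qed.

Definition rad_stably_zero (N : lmodType A) :=
  exists (Q : lmodType A) (b : {linear Q -> N}) (a : {linear smod (lrad N) -> Q}),
    proj Q /\ forall x, incl x = b (a x).

Section Presentation.
Variables (N : lmodType A) (P : lmodType A) (p : {linear P -> N}).
Hypotheses (prP : proj P) (pS : surjective p).

Definition radpre : lsub P := lpre p (lrad N).

Lemma rad_radpre x : lrad P x -> radpre x.
Proof. exact: rad_map. Qed.

(** Lifting the inclusion of the radical of [N] to [P] splits the pullback of
[p] along that inclusion. *)
Lemma radpre_split : rad_stably_zero N ->
  exists (i : {linear smod (lker p) -> smod radpre})
         (r : {linear smod radpre -> smod (lker p)})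
         (q : {linear smod radpre -> smod (lrad N)})
         (s : {linear smod (lrad N) -> smod radpre}),
  [/\ forall x, incl (i x) = incl x, forall x, incl (q x) = p (incl x),
      forall x, r (i x) = x, forall x, i (r x) + s (q x) = x
    & forall x, q (i x) = 0].
Proof.
move=> [Q [b [a [pQ baE]]]].
have [c cP] := proj_lift pQ (fun x => pS (b x)).
have [i iP] : exists i : {linear smod (lker p) -> smod radpre},
    forall x, incl (i x) = incl x.
  apply: factor_inj (@incl_inj _ _ _) _ => x; apply: incl_ex.
  by change (lrad N (p (incl x))); rewrite lker_in; apply: lsub0.
have [q qP] : exists q : {linear smod radpre -> smod (lrad N)},
    forall x, incl (q x) = lcomp p incl x.
  apply: factor_inj (@incl_inj _ _ _) _ => x; apply: incl_ex.
  exact: (incl_in x).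
have [s sP] : exists s : {linear smod (lrad N) -> smod radpre},
    forall x, incl (s x) = lcomp c a x.
  apply: factor_inj (@incl_inj _ _ _) _ => x; apply: incl_ex.
  by change (lrad N (p (c (a x)))); rewrite cP -baE; apply: incl_in.
have [r rP] : exists r : {linear smod radpre -> smod (lker p)},
    forall x, incl (r x) = (incl - lcomp incl (lcomp s q) :
        {linear smod radpre -> P}) x.
  apply: factor_inj (@incl_inj _ _ _) _ => x; apply: incl_ex.
  rewrite /= -[X in p X]/(incl x - incl (s (q x))) linearB sP lcompE cP -baE qP.
  by rewrite lcompE subrr.
have rE x : incl (r x) = incl x - incl (s (q x)) by exact: rP.
have qi x : q (i x) = 0.
  by apply: incl_inj; rewrite qP linear0 lcompE iP lker_in.
exists i, r, q, s; split=> // x.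
- by apply: incl_inj; rewrite rE qi !linear0 ?subr0 ?addr0 iP.
- by apply: incl_inj; rewrite linearD iP rE subrK.
Qed.

End Presentation.

(** The quotients by [E] and [E'] are semisimple, so complements of the image
and of the kernel of the induced map give it a quasi-inverse, which lifts. *)
Lemma semisimple_inverse (P P' : lmodType A) (F : {linear P -> P'})
    (E : lsub P) (E' : lsub P') :
  fin_length P -> fin_length P' -> proj P' ->
  (forall x, lrad P x -> E x) -> (forall x, lrad P' x -> E' x) ->
  (forall x, E x -> E' (F x)) ->
  exists G : {linear P' -> P}, (forall x, E' x -> E (G x)) /\
    forall x, E' (F (G (F x)) - F x).
Proof.
move=> fP fP' prP' RE RE' EF.
pose V : lsub P' := lsum (limg F lall) E'.
have FV x : V (F x) by exists (F x), 0; rewrite addr0; split=> //;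
    [exists x | exact: lsub0].
have E'V x : E' x -> V x by move=> Ex; exists 0, x; rewrite add0r; split=> //;
    exact: lsub0.
have [V' [VS VI VR]] := @rad_complement _ _ V fP' (fun x h => E'V _ (RE' _ h)).
pose W : lsub P := lpre F E'.
have [W' [WS WI WR]] := @rad_complement _ _ W fP (fun x h => EF _ (RE _ h)).
pose T := (smod W' * (smod E' * smod V'))%type.
pose d : {linear T -> P'} := copair (lcomp F incl) (copair incl incl).
have dE a b c : d (a, (b, c)) = F (incl a) + (incl b + incl c) by [].
have [t tP] : exists t : {linear P' -> T}, forall x, d (t x) = x.
  apply: (proj_lift (f := idfun) prP') => x.
  have [_ [v' [[_ [e [[y _ <-] E'e ->]]] V'v' ->]]] := VS x.
  have [y1 [y2 [Wy1 W'y2 ->]]] := WS y.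
  have [a aE] := incl_ex W'y2; have [c cE] := incl_ex V'v'.
  have [b bE] : exists b : smod E', incl b = F y1 + e.
    by apply: incl_ex; apply: lsubD.
  exists (a, (b, c)); rewrite dE aE bE cE -[RHS]/(F (y1 + y2) + e + v') linearD.
  by rewrite !addrA [F y2 + _]addrC.
pose G : {linear P' -> P} := lcomp incl (lcomp (fst : {linear T -> smod W'}) t).
(* On the image of [F] modulo [E'] the lifted map is a section. *)
have FG x : V x -> E' (F (G x) - x).
  move=> Vx; have := tP x; change (G x) with (incl (t x).1).
  case: (t x) => a [b c]; rewrite dE => xE.
  change (E' (F (incl a) - x)).
  have Vc : V (incl c).
    have -> : incl c = x - F (incl a) - incl b.
      by rewrite -[x]xE [F _ + _]addrC addrK [incl b + _]addrC addrK.
    by apply: lsubB; [apply: lsubB | apply: E'V; apply: incl_in].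
  have /RE' E'c := VI _ Vc (incl_in c).
  rewrite -[X in _ - X]xE opprD addrA subrr add0r; apply: lsubN; apply: lsubD => //.
  exact: incl_in.
exists G; split=> [x E'x|x]; last exact: FG.
have WG : W (G x).
  rewrite /= -(subrK x (F (G x))); apply: lsubD => //; apply: FG; exact: E'V.
by apply: RE; apply: WI => //; rewrite /G lcompE; apply: incl_in.
Qed.

Section AllRadicals.
Hypothesis rz : forall N, rad_stably_zero N.

Let fR N : fin_length (smod (lrad N)) := fl_smod (lrad N) (gprj_fl N).
Let tR N : torsionless (smod (lrad N)) := tors_smod (lrad N) (gprj_tl N).

(** On the preimages of the radicals the lift of [f] is regular, because the
semisimple quotients provide a quasi-inverse up to maps that factor through the
free module. The syzygy of [N] is a summand of the preimage of the radical of
[N], with that radical as complement, so [regular_complement] replaces the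
restriction to the syzygy by a map into the radical. *)
Lemma regular_out N N' (f : {linear N -> N'}) :
  (forall Y (g : {linear Y -> tgprj (fR N) (tR N)}),
      regular_map (@stable_map _ Y _ g)) ->
  regular_map (@stable_map _ N N' f).
Proof.
move=> into.
have /fin_genP[n [p pS]] := fg_fin_gen N;
    have /fin_genP[n' [p' p'S]] := fg_fin_gen N'.
have [F FP] := proj_lift (f := lcomp f p) (proj_free A n) (fun x => p'S _).
have [i [r [q [s [iP qP ri irsq qi]]]]] := radpre_split pS (rz N).
have [i' [r' [q' [s' [i'P _ r'i' _ _]]]]] := radpre_split p'S (rz N').
pose E := radpre p; pose E' := radpre p'.
have fP k := fl_free flA k; have tP k := tors_free A k.
pose K := tgprj (fl_smod (lker p) (fP n)) (tors_smod (lker p) (tP n)).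
pose K' := tgprj (fl_smod (lker p') (fP n')) (tors_smod (lker p') (tP n')).
pose Eg := tgprj (fl_smod E (fP n)) (tors_smod E (tP n)).
pose Eg' := tgprj (fl_smod E' (fP n')) (tors_smod E' (tP n')).
pose RN := tgprj (fR N) (tR N).
have [w wP] : exists w : {linear K -> K'}, forall x, incl (w x) = F (incl x).
  apply: (factor_inj (f := lcomp F incl)) (@incl_inj _ _ _) _ => x; apply: incl_ex.
  by rewrite /= FP lcompE lker_in linear0.
have [G [GE GF]] := @semisimple_inverse _ _ F E E' (fP n) (fP n')
  (proj_free A n') (rad_radpre p) (rad_radpre p')
  (fun x Ex => eq_ind_r (lrad N') (rad_map f Ex) (FP x)).
have [h hP] : exists h : {linear Eg -> Eg'}, forall x, incl (h x) = F (incl x).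
  apply: (factor_inj (f := lcomp F incl)) (@incl_inj _ _ _) _ => x; apply: incl_ex.
  by change (lrad N' (p' (F (incl x)))); rewrite FP;
      apply: (rad_map f (x := p (incl x))); apply: (incl_in x).
have [g gP] : exists g : {linear Eg' -> Eg}, forall x, incl (g x) = G (incl x).
  apply: (factor_inj (f := lcomp G incl)) (@incl_inj _ _ _) _ => x; apply: incl_ex.
  exact: (GE _ (incl_in x)).
have [d dP] : exists d : {linear free A n -> Eg'},
    forall x, incl (d x) = (lcomp F (lcomp G F) - F) x.
  apply: factor_inj (@incl_inj _ _ _) _ => x; apply: incl_ex.
  exact: GF.
apply: (@regular_syzygy _ _ K K' N N' incl p incl p' F w f) => //;
  try exact: proj_free; try exact: incl_inj.
- by move=> x; rewrite -incl_exP.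
- by move=> x; rewrite -incl_exP.
apply: (@regular_split_mono _ _ _ _ (@stable_map _ K' Eg' i') _ (@stable_map _
    Eg' K' r')).
  by rewrite stable_map_comp; apply: stable_map_ext.
rewrite stable_map_comp (_ :
    @stable_map _ K Eg' _ = cat_comp (@stable_map _ Eg Eg' h) (@stable_map _ K
        Eg i)); last first.
  rewrite stable_map_comp; apply: stable_map_ext => x; apply: incl_inj.
  by rewrite !lcompE i'P wP hP iP.
apply: (@regular_complement _ _ _ _ (RN :
    stable_gprj A) _ (@stable_map _ Eg' Eg g) _
  (@stable_map _ Eg K r) (@stable_map _ Eg RN q) (@stable_map _ RN Eg s)).
- rewrite !stable_map_comp; apply/stable_map_eqP; exists (free A n), d, incl.
  split=> [|x]; first exact: proj_free.
  apply: incl_inj; rewrite linearD dP !lcompE hP gP hP.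
  by rewrite -[X in _ + X]/(F (G (F (incl x))) - F (incl x)) addrC subrK.
- rewrite stable_map_comp -[RHS](_ : @stable_map _ K RN 0 = 0).
    by apply: stable_map_ext => x; apply: qi.
  by rewrite /stable_map /stable_pi; apply: (addrI (@stable_map _ K RN 0));
      rewrite -stable_mapD !addr0.
- by rewrite !stable_map_comp -stable_mapD; apply: stable_map_ext => x;
    rewrite -[LHS]/(i (r x) + s (q x)) irsq.
- have [u ->] := stable_map_surj (cat_comp (@stable_map _ Eg RN q)
    (cat_id (Eg : stable_gprj A) - cat_comp (@stable_map _ Eg' Eg g)
        (@stable_map _ Eg Eg' h))).
  exact: into.
Qed.

(** Induction on the length of the target: maps into the radical of [N] control
maps out of [N], and those control maps into [N]. *)
Lemma rad_zero_regular : regular_cat (stable_gprj A).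
Proof.
suff into k N : (lenM N < k)%N -> forall Y (f : {linear Y -> N}),
    regular_map (@stable_map _ Y N f).
  by move=> Y N u; have [f ->] := stable_map_surj u; apply: into (ltnSn _) _ _.
elim: k N => // k IH N lN Y f.
have [N0|nN0] := pselect (forall x : N, x = 0).
  apply/regular_stable_mapP; exists 0; apply: stable_map_ext => x.
  by rewrite [LHS]N0 [RHS]N0.
apply: regular_into => Z g; apply: regular_out => X h; apply: IH.
rewrite -ltnS; apply: leq_trans lN.
rewrite ltnS /lenM /lenG.
rewrite -(img_inj (linear_opmap (@incl _ _ (lrad N))) (@incl_inj _ _ _) (opsubT
    (modop (smod (lrad N))))).2;
  last exact: fR.
apply: len_lt => //; last 2 first.
- exact: gprj_fl.
- apply: contrapT => all; apply: nN0;
    apply: (nakayama (U := lzero) (gprj_fl N)) => x.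
  exists 0, x; rewrite add0r; split=> //; apply: contrapT => nx; apply: all.
  exists x => // -[y _ yx]; apply: nx; rewrite -yx; exact: incl_in.
- exact: (lsub_opsub (limg (@incl _ _ (lrad N)) lall)).
Qed.

End AllRadicals.

(** Conversely, if the inclusion [j] of the radical is regular with
quasi-inverse [g] then [1 - jg] is bijective by Nakayama's lemma, while
[(1 - jg) j] is stably zero. *)
Lemma regular_rad_zero : regular_cat (stable_gprj A) -> forall N, rad_stably_zero N.
Proof.
move=> reg N; have fN := gprj_fl N.
pose R := tgprj (fl_smod (lrad N) fN) (tors_smod (lrad N) (gprj_tl N)).
have /regular_stable_mapP[g /stable_map_eqP[Q [b [a [pQ gP]]]]] :=
    reg R N (@stable_map _ R N incl).
pose v : {linear N -> N} := (idfun : {linear N -> N}) - lcomp incl g.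
have vE x : v x = x - incl (g x) by [].
have vS : surjective v.
  move=> y; have [|x _ xy] := nakayama (U := limg v lall) fN _ y; last by exists x.
  move=> x; exists (v x), (incl (g x)); split; [by exists x | exact: incl_in |].
  by rewrite vE subrK.
have vI : injective v by apply: (len_surj_inj (linear_opmap v) vS fN (leqnn _)).
have [u [vu uv]] := inv_bij vI vS.
exists Q, (lcomp u (- b)), a; split=> // x.
rewrite lcompE -[LHS]vu; congr (u _); rewrite vE.
by have := gP x; rewrite !lcompE => ->; rewrite opprD addrA subrr add0r.
Qed.

End Torsionless.

(** * The two conditions of the theorem *)

Section RadicalGenerates.
Variable A : pzRingType.
Hypothesis flA : fin_length A^o.
Implicit Types M N X P : lmodType A.

Let G : lmodType A := (rad_type (A^o : lmodType A) * A^o)%type.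

Lemma tors_pw n X : torsionless X -> torsionless (pw n X).
Proof.
move=> [m [f fI]]; apply: (tors_sub (f := pw_map n f)).
  move=> x y /ffunP xy; apply/ffunP => i; apply: fI.
  by have := xy i; rewrite !ffunE.
exact: tors_retr (pw_mul n m A^o) (tors_free _ _).
Qed.

Lemma tors_G : torsionless G.
Proof.
apply: tors_pair; last exact: tors_proj (proj_reg A).
exact: tors_sub (@radval_inj _ _) (tors_proj (proj_reg A)).
Qed.

Lemma in_add_tors (M : fgModType A) : in_add G M -> torsionless M.
Proof. by move=> /in_addP[n ret]; apply: tors_retr ret (tors_pw n tors_G). Qed.

Section OneGorenstein.
Hypotheses (cT : closed_are_ext A) (cU : ext_are_closed A).

(** [M] is the syzygy of some [N]; as the inclusion of the radical of [N] lifts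
to the free module covering [N], [M] splits off the preimage of that radical,
which contains the radical of the free module. *)
Lemma gprj_in_add (M : fgModType A) :
  (forall N : gprjType A, rad_stably_zero N) ->
  gorenstein_projective M -> in_add G M.
Proof.
move=> rz gM; apply/in_addP.
have fM := fg_fl flA (fg_fin_gen M).
have [m [F [FI eF _]]] := tors_embed flA fM (gprj_tors gM).
have [l [H [FH _]]] := coresolve_step flA cU eF.
have fN : fin_length (smod (limg H lall)) by apply: fl_smod; apply: fl_free.
have tN : torsionless (smod (limg H lall)) by apply: tors_smod; apply: tors_free.
have [p pP] := factor_inj (@incl_inj _ _ (limg H lall))
  (fun x => incl_ex (ex_intro2 _ _ x I (erefl (H x)) : limg H lall (H x))).
have pS : surjective p.
  by move=> y; have [x _ xy] := incl_in y; exists x; apply: incl_inj; rewrite pP.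
have [i [r [q [s [_ _ ri _ _]]]]] := radpre_split pS (rz (tgprj flA cT cU fN tN)).
have [k kP] : exists k : {linear M -> smod (lker p)}, forall x, incl (k x) = F x.
  apply: factor_inj (@incl_inj _ _ _) _ => x; apply: incl_ex.
  by apply: incl_inj; rewrite pP linear0; apply/FH; exists x.
have kI : injective k by move=> x y /(congr1 incl); rewrite !kP => /FI.
have kS : surjective k.
  move=> y; have [x xy] : exists x, F x = incl y.
    by apply/FH; rewrite -pP lker_in linear0.
  by exists x; apply: incl_inj; rewrite kP.
have [n ret] := retr_rad (fl_free flA m) (proj_free A m) (rad_radpre p).
exists n; apply: retr_trans ret; apply: retr_trans (retr_bij kI kS).1 _.
by exists i, r.
Qed.

(** When all syzygies are summands of powers of [G], the map of a syzygy [M] of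
[N] into such a power extends to the free cover of [N], and sends the preimage
of the radical back into the power; so [M] splits off that preimage. *)
Lemma in_add_rad_zero :
  (forall M : fgModType A, gorenstein_projective M -> in_add G M) ->
  forall N : gprjType A, rad_stably_zero N.
Proof.
move=> H N; have /fin_genP[k [p pS]] := fg_fin_gen N.
have fK := fl_smod (lker p) (fl_free flA k).
have tK := tors_smod (lker p) (tors_free A k).
have /in_addP[n [s [r sr]]] := H _ (gprj_gp (tgprj flA cT cU fK tK)).
pose T : lmodType A := (A^o * A^o)%type.
pose j : {linear G -> T} :=
  pair_map (lcomp (radval _) (fst : {linear G -> rad_type (A^o : lmodType A)}))
           (snd : {linear G -> A^o}).
have jE x y : j (x, y) = (radval _ x, y) by exact: pair_mapE.
have jI : injective j.
  by move=> [x y] [x' y']; rewrite !jE => -[/radval_inj-> ->].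
pose J : {linear pw n G -> pw n T} := pw_map n j.
have JE x i : J x i = j (x i) by rewrite ffunE.
have JI : injective J.
  by move=> x y /ffunP xy; apply/ffunP => i; apply: jI; rewrite -!JE xy.
have pT : proj (pw n T) by apply: proj_pw; apply: proj_pair; apply: proj_reg.
have kP x : p x = 0 <-> exists y : smod (lker p), incl y = x by rewrite -incl_exP.
have [g gP] := ext0_use (gprj_ext flA cT (X := N) pT) (@incl_inj _ _ (lker p)) pS kP
  (lcomp J s).
pose E := radpre p.
have [t tP] : exists t : {linear smod E -> pw n G}, forall x, J (t x) = g (incl x).
  apply: (factor_inj (f := lcomp g incl)) JI _ => x.
  have rx i : lrad A^o (g (incl x) i).1.
    apply/rad_regP => m Mm.
    apply: (@rad_to_max_ideal _ _ _ p (lcomp (fst : {linear T ->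
        A^o}) (lcomp (pw_proj T i) g))
      m pS Mm); last exact: (incl_in x).
    move=> q /kP[y <-]; rewrite !lcompE gP lcompE [pw_proj _ _ _]JE.
    case: (s y i) => a b; rewrite jE.
    have /rad_regP := radval_in a; exact.
  have [c cP] := choice (fun i => radval_ex (rx i)).
  exists [ffun i => (c i, (g (incl x) i).2)]; apply/ffunP => i.
  by rewrite JE ffunE jE cP lcompE; case: (g _ i).
have [q qP] : exists q : {linear smod E -> smod (lrad N)},
    forall x, incl (q x) = p (incl x).
  apply: (factor_inj (f := lcomp p incl)) (@incl_inj _ _ _) _ => x; apply: incl_ex.
  exact: (incl_in x).
have qS : surjective q.
  move=> y; have [x xy] := pS (incl y).
  have [z zx] : exists z : smod E, incl z = x.
    by apply: incl_ex; change (lrad N (p x)); rewrite xy; apply: incl_in.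
  by exists z; apply: incl_inj; rewrite qP zx.
have [|a aP] := factor_surj
    (f := incl - lcomp incl (lcomp r t) : {linear smod E -> free A k}) qS.
  move=> x qx; have /kP[y yx] : p (incl x) = 0 by rewrite -qP qx linear0.
  rewrite -[LHS]/(incl x - incl (r (t x))).
  have -> : t x = s y by apply: JI; rewrite tP -yx gP.
  by rewrite sr yx subrr.
exists (free A k), p, a; split=> [|x]; first exact: proj_free.
have [z <-] := qS x.
by rewrite aP -[X in p X]/(incl z - incl (r (t z))) linearB lker_in subr0 qP.
Qed.

End OneGorenstein.

(** Maximal left ideals contain the radical, hence are Gorenstein projective
and have no extensions by the ring. *)
Lemma in_add_injdim :
  (forall M : fgModType A, in_add G M -> gorenstein_projective M) ->
  injdim_le (regular A) 1.
Proof.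
move=> H; apply: injdim1 => // m Mm.
have fm : fin_length (smod m) by apply: fl_smod.
apply: (@gprj_ext0 _ (FgMod (fl_fg fm))); apply: H; apply/in_addP.
apply: (retr_rad flA (proj_reg A)) => x /rad_regP; exact.
Qed.

End RadicalGenerates.

Theorem proposition3p13 (k : comNzRingType) (L : algType k)
    (artinL : artin_algebra L)
    (gprj_cf : gprj_contravariantly_finite L^c) :
  (one_gorenstein L /\ G_semisimple L)
  <->
  (forall M : fgModType L^c,
     gorenstein_projective M <-> in_add (rad_ring L * (L^c)^o)%type M).
Proof.
have [flL flR] := (artin_fl artinL, artin_fl_op artinL).
split=> [[gor ss] M|H].
  have [cT cU] : closed_are_ext L^c /\ ext_are_closed L^c.
    have [TU UT] := closed_ext_op flL flR.
    case: gor => [/(injdim_closed_are_ext flR) cT|/(injdim_closed_are_ext flL) cT].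
      by split=> //; apply: closed_are_ext_ext_are_closed.
    by split; [apply/UT; apply: closed_are_ext_ext_are_closed | apply/TU].
  split=> [gM|/in_add_tors]; last exact: tors_gprj.
  apply: gprj_in_add => // N; apply: regular_rad_zero => //.
  exact: semisimple_regular.
have inj : injdim_le (regular L^c) 1.
  by apply: in_add_injdim => // M; apply: (H M).2.
have cT := injdim_closed_are_ext flR inj;
    have cU := closed_are_ext_ext_are_closed flR cT.
split; first by left.
apply: regular_semisimple; apply: (rad_zero_regular flR cT cU).
by apply: in_add_rad_zero => // M; apply: (H M).1.
Qed.
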